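(* Let $k,\ell,m,n$ be nonnegative integers with $n\ge2$, $m$ even and $k+\ell+m=n$. The stacked twist map $\theta$ restricts to a homeomorphism $$\theta:\mathrm{Gr}_{\ge m}(k,n)\times\mathrm{Gr}^{\perp}_{>0}(k+m,n)\to\mathrm{Gr}^{\perp}_{>0}(\ell+m,n)\times\mathrm{Gr}_{\ge m}(\ell,n),$$ and for each $f\in\tilde S_n(-k,\ell)$, $\theta$ restricts to a diffeomorphism $$\theta:\Pi^{>0}_{k+f}\times\mathrm{Gr}^{\perp}_{>0}(k+m,n)\to\mathrm{Gr}^{\perp}_{>0}(\ell+m,n)\times\Pi^{>0}_{\ell+f^{-1}}.$$
   Context: For integers $a,b\ge0$, $\tilde S_n(-a,b)$ is the set of bijections $f:\mathbb Z\to\mathbb Z$ with $f(i+n)=f(i)+n$ for all $i$, $\sum_{i=1}^n(f(i)-i)=0$, and $i-a\le f(i)\le i+b$ for all $i$. $\mathrm{Gr}(r,n)$ is the Grassmannian of $r$-dimensional subspaces of $\mathbb R^n$, represented as row spans of full rank $r\times n$ matrices. $\mathrm{Gr}_{\ge0}(r,n)$ (resp. $\mathrm{Gr}_{>0}(r,n)$) is the set of elements representable by a matrix with all maximal minors $\ge0$ (resp. $>0$). For $f\in\tilde S_n(-r,n-r)$, the positroid cell $\Pi^{>0}_{r+f}$ is the set of $V\in\mathrm{Gr}_{\ge0}(r,n)$ such that for all integers $a<b$ the rank of the matrix with columns $V(a),\dots,V(b-1)$ (indices modulo $n$) equals $\#\{i<a\mid a\le f(i)+r<b\}$; it is a smooth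 submanifold of $\mathrm{Gr}(r,n)$, and these cells partition $\mathrm{Gr}_{\ge0}(r,n)$. For $0\le m\le n-r$, $\mathrm{Gr}_{\ge m}(r,n):=\bigsqcup_{f\in\tilde S_n(-r,n-r-m)}\Pi^{>0}_{r+f}$. Also $\mathrm{Gr}^{\perp}_{>0}(r,n):=\{Z^\perp\mid Z\in\mathrm{Gr}_{>0}(r,n)\}\subset\mathrm{Gr}(n-r,n)$, with $Z^\perp$ the orthogonal complement for the standard inner product. Stacked twist map: for a $k\times n$ matrix $V$ and an $\ell\times n$ matrix $W$, $U=\mathrm{stack}(V,W)$ is the $(k+\ell)\times n$ matrix with $V$ on top of $W$. Extend its columns $U(1),\dots,U(n)$ to all $j\in\mathbb Z$ by $U(j+n)=(-1)^{k-1}U(j)$. Write $U\in\mathrm{Mat}^\circ(k+\ell,n)$ if for all $j\in\mathbb Z$ the vectors $U(j-\ell),\dots,U(j+k-1)$ form a basis of $\mathbb R^{k+\ell}$. In that case let $\tilde U=\tau(U)$ be the $(k+\ell)\times n$ matrix with columns $\tilde U(j)$, $1\le j\le n$, where for $j\in\mathbb Z$, $\tilde U(j)$ is the unique vector with $\langle\tilde U(j),U(j-\ell)\rangle=(-1)^j$ and $\langle\tilde U(j),U(i)\rangle=0$ for $j-\ell+1\le i\le j+k-1$. Let $\tilde W$ be the matrix of the first $k$ rows and $\tilde V$ the matrix of the last $\ell$ rows of $\tilde U$; set $\theta(V,W):=(\tilde W,\tilde V)$. The row spans of $\tilde W,\tilde V$ depend only on those of $V,W$, so $\theta$ is regarded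 as a rational map $\mathrm{Gr}(k,n)\times\mathrm{Gr}(\ell,n)\dashrightarrow\mathrm{Gr}(k,n)\times\mathrm{Gr}(\ell,n)$, defined at those pairs $(V,W)$ with $\mathrm{stack}(V,W)\in\mathrm{Mat}^\circ(k+\ell,n)$. *)

(* Defs.v *)
From HB Require Import structures.
From mathcomp Require Import all_boot all_order all_algebra.
From mathcomp Require Import all_classical all_reals.
From mathcomp Require Import topology normedtype derive.
Set Implicit Arguments.
Unset Strict Implicit.
Unset Printing Implicit Defensive.
Import Order.TTheory GRing.Theory Num.Theory.
Import numFieldNormedType.Exports.

Local Open Scope classical_set_scope.
Local Open Scope ring_scope.

(* The affine permutations in \tilde S_n(-a, b). *)
Definition affperm (n a b : nat) : set (int -> int) :=
  [set f | [/\ bijective f,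
               forall i : int, f (i + n%:Z) = f i + n%:Z,
               \sum_(1 <= i < n.+1) (f i%:Z - i%:Z) = 0
             & forall i : int, i - a%:Z <= f i <= i + b%:Z]].

Definition rowspan (R : realType) (r n : nat) (A : 'M[R]_(r, n)) :
    {vspace 'rV[R]_n} :=
  <<[seq row i A | i : 'I_r]>>%VS.

Record Gr (R : realType) (r n : nat) := MkGr {
  gr_space :> {vspace 'rV[R]_n};
  gr_dim : \dim gr_space == r }.

HB.instance Definition _ (R : realType) (r n : nat) :=
  [isSub for @gr_space R r n].
HB.instance Definition _ (R : realType) (r n : nat) :=
  [Choice of Gr R r n by <:].

(* Quotient topology: O is open when its preimage in the space of full rank
   r x n matrices, with the subspace topology, is open. *)
Definition gr_open (R : realType) (r n : nat) (O : set (Gr R r n)) : Prop :=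
  exists2 D : set 'M[R]_(r, n), open D &
    forall (A : 'M[R]_(r, n)) (V : Gr R r n), rowspan A = V -> (D A <-> O V).

Lemma gr_openT (R : realType) (r n : nat) : @gr_open R r n setT.
Proof. by exists setT => //; exact: openT. Qed.

Lemma gr_openI (R : realType) (r n : nat) (O P : set (Gr R r n)) :
  gr_open O -> gr_open P -> gr_open (O `&` P).
Proof.
move=> [D oD DO] [E oE EP]; exists (D `&` E); first exact: openI.
by move=> A V AV; have := DO _ _ AV; have := EP _ _ AV; rewrite /setI /=; tauto.
Qed.

Lemma gr_open_bigU (R : realType) (r n : nat) (I : Type)
    (F : I -> set (Gr R r n)) :
  (forall i, gr_open (F i)) -> gr_open (\bigcup_i F i).
Proof.
move=> oF; have /choice[D DF] : forall i, exists D : set 'M[R]_(r, n), open D /\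
    forall (A : 'M[R]_(r, n)) (V : Gr R r n), rowspan A = V -> (D A <-> F i V).
  by move=> i; have [D] := oF i; exists D.
exists (\bigcup_i D i); first by apply: bigcup_open => i _; have [] := DF i.
move=> A V AV.
by split=> -[i _ H]; exists i => //; have [_ /(_ _ _ AV) []] := DF i; auto.
Qed.

HB.instance Definition _ (R : realType) (r n : nat) :=
  @isOpenTopological.Build (Gr R r n) (@gr_open R r n)
    (@gr_openT R r n) (@gr_openI R r n) (@gr_open_bigU R r n).

(* A matrix with row span V. *)
Definition gr_mx (R : realType) (r n : nat) (V : Gr R r n) : 'M[R]_(r, n) :=
  \matrix_(i < r) (vbasis V)`_i.

Definition Gr_ge0 (R : realType) (r n : nat) : set (Gr R r n) :=
  [set V | exists2 A : 'M[R]_(r, n), rowspan A = V &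
     forall s : 'I_r -> 'I_n, {homo s : i j / (i < j)%N} ->
       0 <= \det (colsub s A)].

Definition Gr_gt0 (R : realType) (r n : nat) : set (Gr R r n) :=
  [set V | exists2 A : 'M[R]_(r, n), rowspan A = V &
     forall s : 'I_r -> 'I_n, {homo s : i j / (i < j)%N} ->
       0 < \det (colsub s A)].

(* The elements of Gr(q, n) of the form Z^\perp with Z in Gr_{>0}(r, n); this
   is empty unless q = n - r. *)
Definition Gr_perp_gt0 (R : realType) (r q n : nat) : set (Gr R q n) :=
  [set V | exists2 Z : Gr R r n, Gr_gt0 Z &
     forall v : 'rV[R]_n,
       v \in gr_space V <->
       (forall z : 'rV[R]_n, z \in gr_space Z -> (v *m z^T) 0 0 = 0)].

(* The columns U(1), ..., U(n) of U are its columns 0, ..., n - 1 in the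
   library's numbering; extcol c U extends them to all integers so that
   U(j + n) = c U(j). *)
Definition extcol (R : realType) (p n : nat) (c : R) (U : 'M[R]_(p, n))
    (j : int) : 'cV[R]_p :=
  if insub `|((j - 1) %% n%:Z)%Z|%N is Some i
  then c ^ ((j - 1) %/ n%:Z)%Z *: col i U else 0.

(* The columns A(a), ..., A(b - 1), with indices modulo n. *)
Definition cyclic_cols (R : realType) (r n : nat) (A : 'M[R]_(r, n))
    (a b : int) : 'M[R]_(r, `|b - a|) :=
  \matrix_(i, j) extcol 1 A (a + j%:Z) i 0.

(* Pi^{>0}_{r + f} *)
Definition positroid_cell (R : realType) (r n : nat) (f : int -> int) :
    set (Gr R r n) :=
  [set V | Gr_ge0 V /\
     forall a b : int, a < b ->
       ([set i : int | (i < a)%R /\ (a <= f i + r%:Z < b)%R] #=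
        `I_(\rank (cyclic_cols (gr_mx V) a b)))%card].

Definition Gr_ge (R : realType) (m r n : nat) : set (Gr R r n) :=
  \bigcup_(f in affperm n r (n - r - m)) @positroid_cell R r n f.

(* The columns of stack(V, W), extended with the sign (-1)^(k-1). *)
Definition stackcol (R : realType) (k l n : nat) (U : 'M[R]_(k + l, n))
    (j : int) : 'cV[R]_(k + l) :=
  extcol ((-1) ^ (k%:Z - 1)) U j.

Definition Mat_circ (R : realType) (k l n : nat) : set 'M[R]_(k + l, n) :=
  [set U | forall j : int,
     basis_of fullv [seq stackcol U (j - l%:Z + i%:Z) | i <- iota 0 (k + l)]].

Definition is_twist_col (R : realType) (k l n : nat) (U : 'M[R]_(k + l, n))
    (j : int) : set 'cV[R]_(k + l) :=
  [set u | (u^T *m stackcol U (j - l%:Z)) 0 0 = (-1) ^ j /\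
     forall i : int, j - l%:Z + 1 <= i <= j + k%:Z - 1 ->
       (u^T *m stackcol U i) 0 0 = 0].

Definition twist (R : realType) (k l n : nat) (U : 'M[R]_(k + l, n)) :
    'M[R]_(k + l, n) :=
  \matrix_(i, j) xget 0 (is_twist_col U (j.+1)%:Z) i 0.

(* The default values p.1 and p.2 of insubd are not reached on theta_dom, where
   both blocks of the twisted matrix have full rank. *)
Definition theta (R : realType) (k l n : nat) (p : Gr R k n * Gr R l n) :
    Gr R k n * Gr R l n :=
  let U := twist (col_mx (gr_mx p.1) (gr_mx p.2)) in
  (insubd p.1 (rowspan (usubmx U)), insubd p.2 (rowspan (dsubmx U))).

Definition theta_dom (R : realType) (k l n : nat) :
    set (Gr R k n * Gr R l n) :=
  [set p | Mat_circ (col_mx (gr_mx p.1) (gr_mx p.2))].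

Definition homeomorphism_on (M N : topologicalType) (A : set M) (B : set N)
    (f : M -> N) : Prop :=
  [/\ set_bij A B f, {within A, continuous f}
    & exists2 g : N -> M,
        (forall x, A x -> g (f x) = x) & {within B, continuous g}].

Fixpoint Ck_on (R : realType) (E F : normedModType R) (d : nat) (O : set E)
    (h : E -> F) : Prop :=
  (forall x, O x -> {for x, continuous h}) /\
  if d is d'.+1 then
    forall v : E, (forall x, O x -> derivable h x v) /\
                  Ck_on d' O (fun x => 'D_v h x)
  else True.

Definition smooth_on (R : realType) (E F : normedModType R) (O : set E)
    (h : E -> F) : Prop :=
  forall d : nat, Ck_on d O h.

(* A chart with values in E is a pair (domain, coordinate map). *)
Definition atlas (R : realType) (E : normedModType R) (M : topologicalType) :=
  set (set M * (M -> E)).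

(* The chart attached to sigma is defined at those V with a representing matrix
   that is the identity on the columns sigma(inl _), and maps V to the columns
   sigma(inr _) of this matrix. *)
Definition gr_chart (R : realType) (r n : nat) (s : 'I_r + 'I_(n - r) -> 'I_n) :
    set (Gr R r n) * (Gr R r n -> 'M[R]_(r, n - r)) :=
  ([set V | colsub (s \o inl) (gr_mx V) \in unitmx],
   fun V => invmx (colsub (s \o inl) (gr_mx V))
              *m colsub (s \o inr) (gr_mx V)).

Definition gr_atlas (R : realType) (r n : nat) :
    atlas 'M[R]_(r, n - r) (Gr R r n) :=
  [set gr_chart R s | s in [set s | bijective s]].

Definition prod_atlas (R : realType) (E F : normedModType R)
    (M N : topologicalType) (aM : atlas E M) (aN : atlas F N) :
    atlas (E * F)%type (M * N)%type :=
  [set c | exists p q, [/\ aM p, aN q &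
     c = (p.1 `*` q.1, fun x : M * N => (p.2 x.1, q.2 x.2))]].

(* Smoothness of f on an arbitrary subset A: near each point of A, f read in
   charts is the restriction of a smooth map h on an open set. If A is a
   submanifold, this is smoothness for the submanifold structure on A. *)
Definition smooth_within (R : realType) (E F : normedModType R)
    (M N : topologicalType) (aM : atlas E M) (aN : atlas F N)
    (A : set M) (f : M -> N) : Prop :=
  forall x, A x -> exists p q (O : set E) (h : E -> F),
    [/\ aM p /\ aN q, p.1 x /\ q.1 (f x), open O /\ O (p.2 x), smooth_on O h
      & forall y, A y -> p.1 y -> O (p.2 y) ->
          q.1 (f y) /\ q.2 (f y) = h (p.2 y)].

Definition diffeomorphism_on (R : realType) (E F : normedModType R)
    (M N : topologicalType) (aM : atlas E M) (aN : atlas F N)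
    (A : set M) (B : set N) (f : M -> N) : Prop :=
  [/\ set_bij A B f, smooth_within aM aN A f
    & exists2 g : N -> M,
        (forall x, A x -> g (f x) = x) & smooth_within aN aM B g].

(* Main.v *)
(* After the sign change (-1)^j on columns, Gr^perp_{>0} becomes total
   positivity (duality of complementary minors). For V nonnegative and W in
   Gr^perp_{>0}, the windows of stack(V, W) are invertible by Cauchy-Binet, and
   the orthogonality relation between U and its twist says that each window of
   one block of the twist is the orthogonal complement of a window of the other
   block of U; hence all ranks of cyclic windows, and so the affine permutation,
   are carried over and inverted. Positivity of the two blocks is proved first
   when V is totally positive: a nonnegative family whose consecutive maximal
   minors do not vanish is totally positive, so positivity of the image is an
   open and closed condition on a connected set, and it holds at the cyclically
   symmetric point. The nonnegative case follows by density. Reversing the order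
   of the columns turns the inverse map into a stacked twist with k and l
   exchanged, which gives surjectivity. In charts both maps are rational. *)

Require Import Defs.
From HB Require Import structures.
From mathcomp Require Import all_boot all_order all_algebra.
From mathcomp Require Import fingroup perm.
From mathcomp Require Import lra zify.
Set Implicit Arguments.
Unset Strict Implicit.
Unset Printing Implicit Defensive.
Import Order.TTheory GRing.Theory Num.Theory.
Local Open Scope ring_scope.

(** The extension sign [(-1) ^+ k.+1] is the one for which sliding a window of [n] columns by one
    step carries maximal minors to maximal minors, so a sign pattern seen on one period holds on all
    of them. Alternation, and with it the twist, multiplies the quasi-period by [(-1) ^+ n]; this
    turns the sign for [k] into the sign for [l] because [m] is even. The open-and-closed argument
    needs invertible windows in both blocks, and a nonnegative V may have singular windows of length
    [k]. In the limit only weak inequalities survive; they suffice for the block that has to be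
    nonnegative, and strictness of the other block is regained because its windows of length [k] are
    complementary to those of W. At the symmetric point no twist is computed: its blocks obey the
    recursions of V and W up to transposition and inversion, the Gram matrix of a period removes
    these, and a sequence with the recursion of V is a polynomial in the one-step matrix applied to
    V. *)

(** * Increasing column selections and the Cauchy-Binet formula *)

Definition incr (k n : nat) (s : 'I_k -> 'I_n) := {homo s : i j / (i < j)%N}.

Lemma incr_inj (k n : nat) (s : 'I_k -> 'I_n) : incr s -> injective s.
Proof.
move=> hs i j e; apply/val_inj/eqP.
by case: (ltngtP i j) => // /hs; rewrite e ltnn.
Qed.

Lemma incr_comp (p k n : nat) (t : 'I_k -> 'I_n) (s : 'I_p -> 'I_k) :
  incr t -> incr s -> incr (t \o s).
Proof. by move=> ht hs i j /hs /ht. Qed.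

(** The function [r], counting the smaller values of [s], is an injective self-map of ['I_k]; the
    sorting permutation is its inverse. *)
Lemma sort_inj (k n : nat) (s : 'I_k -> 'I_n) :
  injective s -> exists t : 'S_k, incr (s \o t).
Proof.
move=> sI.
have rk_lt i : (#|[set j | (s j < s i)%N]| < k)%N.
  rewrite -[X in (_ < X)%N]card_ord -cardsT; apply: proper_card.
  by apply/properP; split; [exact/subsetP | exists i; rewrite !inE ?ltnn].
pose r i := Ordinal (rk_lt i).
have r_mono i j : (s i < s j)%N -> (r i < r j)%N.
  move=> ij; apply: proper_card; apply/properP; split.
    by apply/subsetP => x; rewrite !inE => /ltn_trans; apply.
  by exists i; rewrite !inE ?ltnn.
have rI : injective r.
  move=> i j e; apply: sI; apply/val_inj/eqP.
  by case: (ltngtP (s i) (s j)) => // /r_mono; rewrite e ltnn.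
exists (perm rI)^-1%g => i j ij /=.
rewrite ltnNge leq_eqVlt negb_or; apply/andP; split.
  by apply: contraTneq ij => /val_inj/sI/perm_inj ->; rewrite ltnn.
apply/negP => /r_mono; rewrite -!(permE rI) !permKV.
by rewrite ltnNge (ltnW ij).
Qed.

Lemma det_colsub_perm (F : comPzRingType) (k n : nat) (A : 'M[F]_(k, n))
    (s : 'I_k -> 'I_n) (t : 'S_k) :
  \det (colsub (s \o t) A) = (-1) ^+ t * \det (colsub s A).
Proof.
rewrite [colsub _ _](_ : _ = colsub s A *m perm_mx t^-1%g).
  by rewrite det_mulmx det_perm odd_permV mulrC.
by rewrite -col_permE; apply/matrixP => i j; rewrite !mxE.
Qed.

Lemma det_colsub_ninj (F : comPzRingType) (k n : nat) (A : 'M[F]_(k, n))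
    (s : 'I_k -> 'I_n) :
  ~~ injectiveb s -> \det (colsub s A) = 0.
Proof.
move=> /injectivePn[i [j ij e]]; rewrite -det_tr.
by apply: (determinant_alternate ij) => x; rewrite !mxE e.
Qed.

Lemma det_mulmx_ffun (F : comPzRingType) (k n : nat) (A : 'M[F]_(k, n))
    (B : 'M[F]_(n, k)) :
  \det (A *m B) =
  \sum_(s : {ffun 'I_k -> 'I_n}) (\prod_i A i (s i)) * \det (rowsub s B).
Proof.
pose AB (s : 'S_k) (i : 'I_k) (j : 'I_n) := A i j * B j (s i).
transitivity (\sum_(f : {ffun 'I_k -> 'I_n}) \sum_(s : 'S_k)
    (-1) ^+ s * \prod_i AB s i (f i)).
  rewrite exchange_big; apply: eq_bigr => /= s _; rewrite -big_distrr /=.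
  congr (_ * _); rewrite -(bigA_distr_bigA (AB s)) /=.
  by apply: eq_bigr => x _; rewrite mxE.
apply: eq_bigr => f _; rewrite big_distrr /=; apply: eq_bigr => s _.
rewrite [RHS]mulrCA; congr (_ * _); rewrite big_split /=; congr (_ * _).
by apply: eq_bigr => i _; rewrite mxE.
Qed.

(* A form of the Cauchy-Binet formula which runs over all maps s, so that no
   representatives of the k-subsets are chosen; hence the factor k!. *)
Lemma cauchy_binet (F : comPzRingType) (k n : nat) (A : 'M[F]_(k, n))
    (B : 'M[F]_(n, k)) :
  \det (A *m B) *+ k`! =
  \sum_(s : {ffun 'I_k -> 'I_n}) \det (colsub s A) * \det (rowsub s B).
Proof.
transitivity (\sum_(t : 'S_k) \det (A *m B)).
  by rewrite sumr_const card_Sn.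
transitivity (\sum_(t : 'S_k) \sum_(s : {ffun 'I_k -> 'I_n})
   (-1) ^+ t * (\prod_i A i (s (t i))) * \det (rowsub s B)).
  apply: eq_bigr => t _; rewrite det_mulmx_ffun.
  rewrite (reindex (fun s : {ffun 'I_k -> 'I_n} => [ffun i => s (t i)])) /=;
    last first.
    exists (fun s : {ffun 'I_k -> 'I_n} => [ffun i => s (t^-1%g i)]) => s _;
    by apply/ffunP => i; rewrite !ffunE ?permK ?permKV.
  apply: eq_bigr => s _.
  rewrite [X in \det X](_ : _ = (colsub (s \o t) B^T)^T); last first.
    by apply/matrixP => i j; rewrite !mxE ffunE.
  rewrite det_tr det_colsub_perm mulrA [_ * (-1) ^+ _]mulrC; congr (_ * _ * _).
    by apply: eq_bigr => i _; rewrite ffunE.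
  by rewrite -det_tr; congr (\det _); apply/matrixP => i j; rewrite !mxE.
rewrite exchange_big /=; apply: eq_bigr => s _.
rewrite -mulr_suml; congr (_ * _); rewrite /determinant; apply: eq_bigr => t _.
by congr (_ * _); apply: eq_bigr => i _; rewrite !mxE.
Qed.

(** * Minors of constant sign *)

Section SameSign.
Variable F : realFieldType.

(** Products of two minors, because the minors of a row span are defined only up to a common nonzero
    factor: left multiplication by an invertible matrix preserves this condition and the strict
    one. *)
Definition tnn (k n : nat) (A : 'M[F]_(k, n)) :=
  forall s s' : 'I_k -> 'I_n, incr s -> incr s' ->
    0 <= \det (colsub s A) * \det (colsub s' A).

Definition tpos (k n : nat) (A : 'M[F]_(k, n)) :=
  forall s s' : 'I_k -> 'I_n, incr s -> incr s' ->
    0 < \det (colsub s A) * \det (colsub s' A).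

Lemma tposW k n (A : 'M[F]_(k, n)) : tpos A -> tnn A.
Proof. by move=> h s s' hs hs'; exact/ltW/h. Qed.

Lemma tpos_neq0 k n (A : 'M[F]_(k, n)) s : tpos A -> incr s ->
  \det (colsub s A) != 0.
Proof. by move=> h hs; apply: contraTneq (h _ _ hs hs) => ->; rewrite mul0r ltxx. Qed.

Lemma tnn_tpos k n (A : 'M[F]_(k, n)) : tnn A ->
  (forall s, incr s -> \det (colsub s A) != 0) -> tpos A.
Proof.
by move=> h h0 s s' hs hs'; rewrite lt_def mulf_neq0 ?h0 // h.
Qed.

Lemma det_colsub_mull k n (g : 'M[F]_k) (A : 'M[F]_(k, n)) s :
  \det (colsub s (g *m A)) = \det g * \det (colsub s A).
Proof.
rewrite -det_mulmx; congr (\det _); apply/matrixP => i j; rewrite !mxE.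
by apply: eq_bigr => x _; rewrite !mxE.
Qed.

Lemma tnn_mull k n (g : 'M[F]_k) (A : 'M[F]_(k, n)) : tnn A -> tnn (g *m A).
Proof.
move=> h s s' hs hs'; rewrite !det_colsub_mull mulrACA mulr_ge0 ?h //.
by rewrite -expr2 sqr_ge0.
Qed.

Lemma tpos_mull k n (g : 'M[F]_k) (A : 'M[F]_(k, n)) :
  g \in unitmx -> tpos A -> tpos (g *m A).
Proof.
rewrite unitmxE unitfE => g0 h s s' hs hs'.
rewrite !det_colsub_mull mulrACA mulr_gt0 ?h //.
by rewrite -expr2 exprn_even_gt0.
Qed.

(** After multiplication by [c], the product of one nonzero minor of [A] with the corresponding
    minor of [B], every Cauchy-Binet term is a product of two minors of [A] and two of [B], hence
    nonnegative, and the term of [s0] is the square of [c]. Selections that are not increasing are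
    sorted, which changes both factors of a term by the same sign. *)
Lemma det_mulmx_same_sign k n (A B : 'M[F]_(k, n)) : tnn A -> tpos B ->
  (exists2 s : 'I_k -> 'I_n, incr s & \det (colsub s A) != 0) ->
  \det (A *m B^T) != 0.
Proof.
move=> hA hB [s0 hs0 As0].
have fact0 : (k`!%:R : F) != 0 by rewrite pnatr_eq0 -lt0n fact_gt0.
pose c := \det (colsub s0 A) * \det (colsub s0 B).
have c0 : c != 0 by rewrite mulf_neq0 // tpos_neq0.
suff : 0 < c * (\det (A *m B^T) *+ k`!).
  by apply: contraTneq => ->; rewrite mul0rn mulr0 ltxx.
rewrite cauchy_binet mulr_sumr.
have rowT (s : {ffun 'I_k -> 'I_n}) :
    \det (rowsub s B^T) = \det (colsub s B).
  by rewrite -det_tr; congr (\det _); apply/matrixP => i j; rewrite !mxE.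
have termE (s : 'I_k -> 'I_n) (t : 'S_k) :
    \det (colsub (s \o t) A) * \det (colsub (s \o t) B)
    = \det (colsub s A) * \det (colsub s B).
  by rewrite !det_colsub_perm mulrACA -expr2 sqrr_sign mul1r.
have term_ge0 (s : {ffun 'I_k -> 'I_n}) :
    0 <= c * (\det (colsub s A) * \det (rowsub s B^T)).
  rewrite rowT; have [/injectiveP sI|sN] := boolP (injectiveb s); last first.
    by rewrite (det_colsub_ninj _ sN) mul0r mulr0.
  have [t ht] := sort_inj sI.
  rewrite -(termE s t) /c mulrACA mulr_ge0 //; first exact: hA.
  by rewrite ltW // hB.
have e (M : 'M[F]_(k, n)) : colsub [ffun i => s0 i] M = colsub s0 M.
  by apply/matrixP => i j; rewrite !mxE ffunE.
rewrite (bigD1 [ffun i => s0 i]) //= ltr_pwDl ?sumr_ge0 //.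
by rewrite rowT !e -/c -expr2 exprn_even_gt0.
Qed.

Lemma incr_compl r q N (s : 'I_r -> 'I_N) : (r + q)%N = N -> incr s ->
  exists2 u : 'I_q -> 'I_N, incr u & forall i j, s i != u j.
Proof.
move=> eN hs; pose B := ~: (s @: [set: 'I_r]).
have cB : #|B| = q.
  have := cardsC (s @: [set: 'I_r]).
  rewrite card_imset; last exact: incr_inj.
  by rewrite cardsT !card_ord => h; apply: (@addnI r); rewrite h eN.
pose v (j : 'I_q) : 'I_N := enum_val (cast_ord (esym cB) j).
have vI : injective v by move=> i j /enum_val_inj /cast_ord_inj.
have [t ht] := sort_inj vI; exists (v \o t) => // i j /=.
have := enum_valP (cast_ord (esym cB) (t j)); rewrite inE -/(v _).
by apply: contra => /eqP <-; apply/imsetP; exists i.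
Qed.

Definition ord_cat r q n (s : 'I_r -> 'I_n) (u : 'I_q -> 'I_n)
    (x : 'I_(r + q)) : 'I_n :=
  match split x with inl i => s i | inr j => u j end.

Lemma ord_cat_inj r q n (s : 'I_r -> 'I_n) (u : 'I_q -> 'I_n) :
  injective s -> injective u -> (forall i j, s i != u j) ->
  injective (ord_cat s u).
Proof.
move=> sI uI su x y; rewrite /ord_cat -{2}[x]splitK -{2}[y]splitK.
case: (split x) (split y) => [i|j] [i'|j'] //=.
- by move=> /sI ->.
- by move=> e; have := su i j'; rewrite e eqxx.
- by move=> e; have := su i' j; rewrite e eqxx.
- by move=> /uI ->.
Qed.

(** For [f] arbitrary, the determinant of the identity with columns selected by [f] plays the role
    of the sign of [f]; no permutation has to be made out of [f]. *)
Lemma det_colsub_mulr N (A : 'M[F]_N) (f : 'I_N -> 'I_N) :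
  \det (colsub f A) = \det A * \det (colsub f (1%:M : 'M[F]_N)).
Proof.
rewrite -det_mulmx; congr (\det _); apply/matrixP => i j; rewrite !mxE.
under eq_bigr do rewrite !mxE.
rewrite (bigD1 (f j)) //= eqxx mulr1 big1 ?addr0 // => x /negbTE ->.
by rewrite mulr0.
Qed.

Lemma sgr_prod (I : Type) (r : seq I) (P : pred I) (G : I -> F) :
  Num.sg (\prod_(i <- r | P i) G i) = \prod_(i <- r | P i) Num.sg (G i).
Proof. exact: (big_morph _ (@sgrM F) (@sgr1 F)). Qed.

Lemma sg_ord_prod N (x : 'I_N) :
  \prod_(y < N | y != x) Num.sg ((y : nat)%:R - (x : nat)%:R : F) = (-1) ^+ x.
Proof.
rewrite (bigID (fun y : 'I_N => (y < x)%N)) /= [X in _ * X]big1 ?mulr1; last first.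
  move=> y /andP[yx]; rewrite -leqNgt => xy; apply: gtr0_sg.
  by rewrite subr_gt0 ltr_nat ltn_neqAle eq_sym yx.
rewrite (eq_bigr (fun=> -1)); last first.
  by move=> y /andP[_ yx]; apply: ltr0_sg; rewrite subr_lt0 ltr_nat.
rewrite (eq_bigl (fun y : 'I_N => (y < x)%N)); last first.
  by move=> y /=; rewrite andb_idl // => yx; rewrite neq_ltn yx.
rewrite -(big_ord_widen N (fun=> -1)) ?prodr_const ?card_ord //.
exact/ltnW.
Qed.

(** The sign is read off from the Vandermonde determinant at the nodes 0, 1, 2, ..., which is
    positive: selecting its columns by [ord_cat s u] gives one factor -1 per inversion. Only pairs
    [(s i, u j)] can be inverted, and of the [s i] indices below [s i] exactly [i] are values of
    [s]. *)
Lemma sg_shuffle r q (s : 'I_r -> 'I_(r + q)) (u : 'I_q -> 'I_(r + q)) :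
  incr s -> incr u -> (forall i j, s i != u j) ->
  Num.sg (\det (colsub (ord_cat s u) (1%:M : 'M[F]_(r + q)))) =
  \prod_(i < r) ((-1) ^+ s i * (-1) ^+ i).
Proof.
move=> hs hu su; set f := ord_cat s u.
have fI : injective f by apply: ord_cat_inj => //; exact: incr_inj.
pose a : 'rV[F]_(r + q) := \row_x (x : nat)%:R.
have := det_colsub_mulr (Vandermonde (r + q) a) f.
have -> : colsub f (Vandermonde (r + q) a) = Vandermonde (r + q) (colsub f a).
  by apply/matrixP => i j; rewrite !mxE.
rewrite !det_Vandermonde => /(congr1 Num.sg); rewrite sgrM !sgr_prod.
rewrite [X in _ = X * _]big1 ?mul1r; last first.
  move=> i _; rewrite sgr_prod big1 // => j ij; apply: gtr0_sg.
  by rewrite !mxE subr_gt0 ltr_nat.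
move=> <-.
have cross : \prod_(i < r) \prod_(j < q) Num.sg ((u j : nat)%:R - (s i : nat)%:R : F)
    = \prod_(i < r) ((-1) ^+ s i * (-1) ^+ i).
  apply: eq_bigr => i _.
  have fbij : {on [pred y | y != s i], bijective f}.
    by apply: onW_bij; exact: injF_bij.
  have := sg_ord_prod (s i); rewrite (reindex f fbij) /=.
  rewrite big_split_ord /=.
  have -> : \prod_(i0 < q | f (rshift r i0) != s i)
      Num.sg ((f (rshift r i0) : nat)%:R - (s i : nat)%:R : F) =
      \prod_(j < q) Num.sg ((u j : nat)%:R - (s i : nat)%:R : F).
    apply: eq_big => j; rewrite /f /ord_cat (unsplitK (inr j)) //.
    by rewrite eq_sym su.
  have -> : \prod_(i0 < r | f (lshift q i0) != s i)
      Num.sg ((f (lshift q i0) : nat)%:R - (s i : nat)%:R : F) = (-1) ^+ i.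
    rewrite -(sg_ord_prod i); apply: eq_big => j;
      rewrite /f /ord_cat (unsplitK (inl j)).
      by rewrite (inj_eq (incr_inj hs)).
    move=> _; case: (ltngtP j i) => [ji|ij|/val_inj ->].
    - by rewrite !ltr0_sg // subr_lt0 ltr_nat // hs.
    - by rewrite !gtr0_sg // subr_gt0 ltr_nat // hs.
    - by rewrite !subrr.
  by move=> <-; rewrite [RHS]mulrAC -expr2 sqrr_sign mul1r.
rewrite -cross big_split_ord /= [X in _ * X]big1 ?mulr1; last first.
  move=> j _; rewrite sgr_prod big_split_ord /= [X in X * _]big1 ?mul1r.
    apply: big1 => j' jj'; rewrite !mxE /f /ord_cat !(unsplitK (inr _)).
    by apply: gtr0_sg; rewrite subr_gt0 ltr_nat hu //; rewrite ltn_add2l in jj'.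
  by move=> i /=; rewrite ltnNge ltnW // ltn_addr.
apply: eq_bigr => i _; rewrite sgr_prod big_split_ord /= [X in X * _]big1 ?mul1r.
  apply: eq_big => [j|j _]; first by rewrite ltn_addr.
  by rewrite !mxE /f /ord_cat (unsplitK (inl _)) (unsplitK (inr _)).
move=> i' ii'; rewrite !mxE /f /ord_cat !(unsplitK (inl _)).
by apply: gtr0_sg; rewrite subr_gt0 ltr_nat hs.
Qed.

Definition alt k n (A : 'M[F]_(k, n)) : 'M[F]_(k, n) :=
  \matrix_(i, j) ((-1) ^+ j * A i j).

Lemma altK k n : involutive (@alt k n).
Proof. by move=> A; apply/matrixP => i j; rewrite !mxE mulrA -expr2 sqrr_sign mul1r. Qed.

Lemma altM k n (g : 'M[F]_k) (A : 'M[F]_(k, n)) : alt (g *m A) = g *m alt A.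
Proof.
apply/matrixP => i j; rewrite !mxE mulr_sumr; apply: eq_bigr => x _.
by rewrite mxE mulrCA.
Qed.

Lemma det_colsub_alt k n (A : 'M[F]_(k, n)) (s : 'I_k -> 'I_n) :
  \det (colsub s (alt A)) = (\prod_i (-1) ^+ s i) * \det (colsub s A).
Proof.
rewrite [colsub _ _](_ : _ = colsub s A *m diag_mx (\row_i (-1) ^+ s i)).
  by rewrite det_mulmx det_diag mulrC; under [in LHS]eq_bigr do rewrite mxE.
by rewrite mul_mx_diag; apply/matrixP => i j; rewrite !mxE mulrC.
Qed.

Lemma row_free_gram r n (A : 'M[F]_(r, n)) :
  row_free A -> A *m A^T \in unitmx.
Proof.
move=> fA; rewrite -row_free_unit -kermx_eq0; apply/rowV0P => v /sub_kermxP.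
rewrite mulmxA => vAA.
have vA : v *m A = 0.
  have : (v *m A) *m (v *m A)^T = 0 by rewrite trmx_mul mulmxA vAA mul0mx.
  move: (v *m A) => w /matrixP /(_ 0 0); rewrite !mxE => h.
  apply/rowP => j; rewrite [RHS]mxE.
  have h2 : \sum_j w 0 j ^+ 2 = 0.
    by rewrite -[RHS]h; apply: eq_bigr => i _; rewrite mxE -expr2.
  have /(_ j) := psumr_eq0P (fun i _ => sqr_ge0 (w 0 i)) h2.
  by move=> /(_ isT) /eqP; rewrite sqrf_eq0 => /eqP.
by apply: (row_free_inj fA); rewrite vA mul0mx.
Qed.

(** Jacobi's complementary minor identity. Let [E] consist of the unit columns selected by [u]; the
    product of [col_mx Z W] with [row_mx Z^T E] is block triangular by orthogonality, with diagonal
    blocks [Z *m Z^T] and [colsub u W]. *)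
Lemma det_dual r q (Z : 'M[F]_(r, r + q)) (W : 'M[F]_(q, r + q))
    (s : 'I_r -> 'I_(r + q)) (u : 'I_q -> 'I_(r + q)) :
  W *m Z^T = 0 -> injective u -> (forall i j, s i != u j) ->
  \det (col_mx Z W) * \det (colsub s Z) =
  \det (Z *m Z^T) * \det (colsub u W) *
    \det (colsub (ord_cat s u) (1%:M : 'M[F]_(r + q))).
Proof.
move=> WZ uI su; pose E : 'M[F]_(r + q, q) := colsub u 1%:M.
have colsubE p (A : 'M[F]_(p, r + q)) : A *m E = colsub u A.
  apply/matrixP => i j; rewrite !mxE (bigD1 (u j)) //= !mxE eqxx mulr1.
  by rewrite big1 ?addr0 // => x; rewrite !mxE => /negbTE ->; rewrite mulr0.
have -> : \det (colsub s Z) = \det (row_mx Z^T E) *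
    \det (colsub (ord_cat s u) (1%:M : 'M[F]_(r + q))).
  rewrite -[\det (row_mx _ _)]det_tr tr_row_mx trmxK -det_colsub_mulr.
  rewrite [X in _ = \det X](_ : _ = block_mx (colsub s Z) (colsub u Z) 0 1%:M).
    by rewrite det_ublock det1 mulr1.
  apply/matrixP => i j; rewrite mxE /ord_cat.
  case: (split_ordP i) => i' ->; case: (split_ordP j) => j' ->;
    rewrite ?(unsplitK (inl _)) ?(unsplitK (inr _)) ?block_mxEul ?block_mxEur
      ?block_mxEdl ?block_mxEdr ?col_mxEu ?col_mxEd !mxE //.
    by rewrite (negbTE (su _ _)).
  by rewrite (inj_eq uI) eq_sym.
rewrite mulrA -det_mulmx mul_col_row WZ !colsubE det_ublock.
by [].
Qed.

(** Since [s] and [u] partition the columns, the product of all [(-1) ^+ s i] and all [(-1) ^+ u j]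
    is a constant. So the part of the shuffle sign that depends on [s] becomes the alternation of
    the columns of [W], and the rest goes into [c]. *)
Lemma sg_dual r q (Z : 'M[F]_(r, r + q)) (W : 'M[F]_(q, r + q)) :
  W *m Z^T = 0 -> row_free Z -> row_free W ->
  exists2 c : F, c != 0 & forall s u, incr s -> incr u ->
    (forall i j, s i != u j) ->
    Num.sg (\det (colsub s Z)) = c * Num.sg (\det (colsub u (alt W))).
Proof.
move=> WZ fZ fW.
pose T := col_mx Z W.
have dT : \det T != 0.
  have : \det (T *m T^T) != 0.
    rewrite tr_col_mx mul_col_row WZ det_ublock mulf_neq0 // -unitfE -unitmxE;
    exact: row_free_gram.
  by rewrite det_mulmx det_tr mulf_eq0 orbb.
have dZ : \det (Z *m Z^T) != 0 by rewrite -unitfE -unitmxE row_free_gram.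
pose C : F := (\prod_(i < r) (-1) ^+ i) * (\prod_(x < r + q) (-1) ^+ x).
exists (Num.sg (\det T) * Num.sg (\det (Z *m Z^T)) * C).
  by rewrite !mulf_neq0 ?sgr_eq0 // prodf_seq_neq0; apply/allP => x _;
    rewrite signr_eq0.
move=> s u hs hu su.
have := congr1 (@Num.sg F) (det_dual WZ (incr_inj hu) su); rewrite !sgrM -/T.
rewrite sg_shuffle // det_colsub_alt sgrM sgr_prod.
rewrite (eq_bigr (fun i => (-1) ^+ u i)); last first.
  by move=> i _; rewrite sgrX sgrN1.
have -> : C = (\prod_(i < r) ((-1) ^+ s i * (-1) ^+ i)) * \prod_(i < q) (-1) ^+ u i.
  rewrite /C big_split /= mulrAC mulrC; congr (_ * _).
  rewrite (reindex (ord_cat s u)) /=; last first.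
    by apply: onW_bij; apply: injF_bij; apply: ord_cat_inj => //; exact: incr_inj.
  rewrite big_split_ord /=; congr (_ * _); apply: eq_bigr => i _;
  by rewrite /ord_cat ?(unsplitK (inl _)) ?(unsplitK (inr _)).
set p := \prod_(i < q) _; have pp : p * p = 1.
  by rewrite /p -big_split big1 //= => i _; rewrite -expr2 sqrr_sign.
move=> h; have sT : Num.sg (\det T) * Num.sg (\det T) = 1.
  by rewrite -sgrM gtr0_sg // -expr2 exprn_even_gt0.
transitivity (Num.sg (\det T) * (Num.sg (\det T) * Num.sg (\det (colsub s Z)))).
  by rewrite mulrA sT mul1r.
rewrite h; set a := Num.sg (\det T); set b := Num.sg (\det (Z *m _)).
set d := Num.sg (\det (colsub u W)); set e := \prod_(i < r) _.
transitivity (a * b * e * d * (p * p)); last by lra.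
by rewrite pp; lra.
Qed.

Lemma tpos_sg k n (A : 'M[F]_(k, n)) :
  tpos A <-> forall s s', incr s -> incr s' ->
    Num.sg (\det (colsub s A)) * Num.sg (\det (colsub s' A)) = 1.
Proof.
split=> h s s' hs hs'; first by rewrite -sgrM gtr0_sg ?h.
by rewrite -sgr_gt0 sgrM h.
Qed.

Lemma tpos_dual r q n (Z : 'M[F]_(r, n)) (W : 'M[F]_(q, n)) : (r + q)%N = n ->
  W *m Z^T = 0 -> row_free Z -> row_free W -> tpos Z <-> tpos (alt W).
Proof.
move=> en; subst n => WZ fZ fW; have [c c0 H] := sg_dual WZ fZ fW.
(* [sg_dual] gives only [c != 0]; squaring its identity at one pair of nonvanishing minors gives
   [c * c = 1]. *)
have key (s0 : 'I_r -> 'I_(r + q)) (u0 : 'I_q -> 'I_(r + q)) :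
    incr s0 -> incr u0 -> (forall i j, s0 i != u0 j) ->
    tpos Z \/ tpos (alt W) -> c * c = 1.
  move=> h0 g0 d0 hT; have e := H _ _ h0 g0 d0.
  have nz : \det (colsub s0 Z) != 0 /\ \det (colsub u0 (alt W)) != 0.
    case: hT => h.
      have d := tpos_neq0 h h0; split=> //; apply: contraNneq d => z0.
      by rewrite -sgr_eq0 e z0 sgr0 mulr0.
    have d := tpos_neq0 h g0; split; last exact: d.
    by rewrite -sgr_eq0 e mulf_neq0 // sgr_eq0.
  have := congr1 (fun x => x ^+ 2) e; rewrite /= exprMn !sqr_sg nz.1 nz.2.
  by rewrite mulr1 expr2 => <-.
split=> hT; apply/tpos_sg => s s' hs hs'.
  have [u hu du] := incr_compl (addnC q r) hs.
  have [u' hu' du'] := incr_compl (addnC q r) hs'.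
  have d i j : u i != s j by rewrite eq_sym du.
  have d' i j : u' i != s' j by rewrite eq_sym du'.
  have cc := key _ _ hu hs d (or_introl hT).
  move/tpos_sg: hT => /(_ _ _ hu hu').
  by rewrite (H _ _ hu hs d) (H _ _ hu' hs' d') mulrACA cc mul1r.
have [u hu du] := incr_compl erefl hs.
have [u' hu' du'] := incr_compl erefl hs'.
have cc := key _ _ hs hu du (or_intror hT).
move/tpos_sg: hT => /(_ _ _ hu hu').
by rewrite (H _ _ hs hu du) (H _ _ hs' hu' du') mulrACA cc mul1r.
Qed.

End SameSign.

(** * Invertibility of stacked square matrices *)

Section Stack.
Variable F : realFieldType.

Lemma det_minor_row_free k n (A : 'M[F]_(k, n)) s :
  \det (colsub s A) != 0 -> row_free A.
Proof.
rewrite -unitfE -unitmxE -row_free_unit /row_free => /eqP e.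
rewrite eqn_leq rank_leq_row -[X in (X <= _)%N]e.
have -> : colsub s A = A *m colsub s 1%:M by rewrite mulmx_colsub mulmx1.
exact: mxrankM_maxl.
Qed.

Lemma row_free_det_minor k n (A : 'M[F]_(k, n)) : row_free A ->
  exists2 s : 'I_k -> 'I_n, incr s & \det (colsub s A) != 0.
Proof.
move=> fA; have fAT : row_full A^T by rewrite /row_full mxrank_tr.
pose f := fullrankfun fAT; have fI : injective f by exact: fullrankfun_inj.
have [t ht] := sort_inj fI; exists (f \o t) => //.
rewrite det_colsub_perm mulf_neq0 ?signr_eq0 //.
have := fullrowsub_unit fAT; rewrite unitmxE unitfE -det_tr.
by congr (\det _ != 0); apply/matrixP => i j; rewrite !mxE.
Qed.

Lemma perp_exists q r n (W : 'M[F]_(q, n)) : (r + q)%N = n -> row_free W ->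
  exists2 Z : 'M[F]_(r, n), row_free Z & W *m Z^T = 0.
Proof.
move=> en /eqP fW; have e : \rank (kermx W^T) = r.
  by rewrite mxrank_ker mxrank_tr fW -en addnK.
subst r; exists (row_base (kermx W^T)); first exact: row_base_free.
apply: trmx_inj; rewrite trmx_mul trmxK trmx0; apply/sub_kermxP.
by rewrite eq_row_base.
Qed.

Lemma tpos_row_free k n (A : 'M[F]_(k, n)) : (k <= n)%N -> tpos A -> row_free A.
Proof.
move=> kn hA; have hs : incr (widen_ord kn) by [].
exact: det_minor_row_free (tpos_neq0 hA hs).
Qed.

Lemma row_free_alt k n (A : 'M[F]_(k, n)) : row_free (alt A) -> row_free A.
Proof.
case/row_free_det_minor => s _; rewrite det_colsub_alt mulf_eq0 negb_or.
by case/andP => _ /det_minor_row_free.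
Qed.

(** With [Z] spanning the orthogonal complement of [W], multiplication by [row_mx Z^T W^T] makes the
    stack block triangular with diagonal blocks [V *m Z^T] and [W *m W^T]. The first is invertible
    because [Z] is totally positive by duality. *)
Lemma stack_unit k l (V : 'M[F]_(k, k + l)) (W : 'M[F]_(l, k + l)) :
  tnn V -> row_free V -> tpos (alt W) -> col_mx V W \in unitmx.
Proof.
move=> hV fV hW; have fW : row_free W.
  by apply/row_free_alt/tpos_row_free => //; exact: leq_addl.
have [Z fZ WZ] := perp_exists erefl fW.
have hZ : tpos Z by apply/(tpos_dual erefl WZ fZ fW).
have := det_mulmx_same_sign hV hZ (row_free_det_minor fV).
have := row_free_gram fW; rewrite unitmxE unitfE => dW dV.
rewrite unitmxE unitfE.
have : \det (col_mx V W *m row_mx Z^T W^T) != 0.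
  by rewrite mul_col_row WZ det_ublock mulf_neq0.
by rewrite det_mulmx mulf_eq0 negb_or => /andP[].
Qed.

End Stack.

(** * Periodic families of columns *)

Section Family.
Variable F : realFieldType.

Definition win k (A : int -> 'cV[F]_k) (a : int) m : 'M[F]_(k, m) :=
  \matrix_(i, j) A (a + (j : nat)%:Z) i 0.

Definition qper n (c : F) k (A : int -> 'cV[F]_k) :=
  forall j, A (j + n%:Z) = c *: A j.

Definition fcons p (T : Type) (x : T) (u : 'I_p -> T) (j : 'I_p.+1) : T :=
  if unlift ord0 j is Some i then u i else x.

Lemma fcons0 p T (x : T) (u : 'I_p -> T) : fcons x u ord0 = x.
Proof. by rewrite /fcons unlift_none. Qed.

Lemma fconsS p T (x : T) (u : 'I_p -> T) i : fcons x u (lift ord0 i) = u i.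
Proof. by rewrite /fcons liftK. Qed.

Lemma fcons_lift p T (s : 'I_p.+1 -> T) (q : 'I_p.+1) :
  fcons (s q) (s \o lift q) =1 s \o lift_perm ord0 q 1%g.
Proof.
move=> j; case: (unliftP ord0 j) => [i|] -> /=.
  by rewrite fconsS lift_perm_lift perm1.
by rewrite fcons0 lift_perm_id.
Qed.

Lemma det_colsub_fcons p n (M : 'M[F]_(p.+1, n)) (s : 'I_p.+1 -> 'I_n)
    (q : 'I_p.+1) :
  \det (colsub (fcons (s q) (s \o lift q)) M) = (-1) ^+ q * \det (colsub s M).
Proof.
rewrite (eq_colsub _ (fcons_lift _ _)) det_colsub_perm odd_lift_perm odd_perm1.
by rewrite addbF /= signr_odd.
Qed.

Lemma det_fcons_lin p n m (M : 'M[F]_(p.+1, n)) (c : 'I_n) (u : 'I_p -> 'I_n)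
    (x : 'I_m -> 'I_n) (mu : 'I_m -> F) :
  col c M = \sum_i mu i *: col (x i) M ->
  \det (colsub (fcons c u) M) = \sum_i mu i * \det (colsub (fcons (x i) u) M).
Proof.
move=> e.
have E y : \det (colsub (fcons y u) M) =
   \sum_i M i y * ((-1) ^+ (i + 0) * \det (row' i (colsub u M))).
  rewrite (expand_det_col _ ord0); apply: eq_bigr => i _.
  rewrite mxE fcons0 /cofactor; congr (_ * (_ * \det _)).
  by apply/matrixP => i1 j1; rewrite !mxE fconsS.
rewrite E; under [RHS]eq_bigr do rewrite E mulr_sumr.
rewrite exchange_big /=; apply: eq_bigr => i _.
under eq_bigr do rewrite mulrA.
rewrite -mulr_suml; congr (_ * _).
have /colP /(_ i) := e; rewrite mxE summxE => ->.
by apply: eq_bigr => j _; rewrite !mxE.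
Qed.

Lemma det_fcons_mem p n (M : 'M[F]_(p.+1, n)) (c : 'I_n) (u : 'I_p -> 'I_n) j :
  c = u j -> \det (colsub (fcons c u) M) = 0.
Proof.
move=> e; apply: det_colsub_ninj; apply/injectivePn.
by exists ord0, (lift ord0 j) => //; rewrite fcons0 fconsS.
Qed.

(* If [c] depends on a block of [p] consecutive columns, moving [c] into the
   two cyclically consecutive minors that contain the block changes their signs
   in opposite ways. *)
Lemma tnn_block_dep p n (M : 'M[F]_(p.+1, n.+1)) (c : 'I_n.+1) (mu : 'I_p -> F)
    (p0 : (0 < p)%N) (pn : (p <= n)%N) :
  tnn M ->
  \det (colsub (fun j : 'I_p.+1 => inord j) M) != 0 ->
  \det (colsub (fun j : 'I_p.+1 => inord (if (j < p)%N then j : nat else n)) M) != 0 ->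
  col c M = \sum_(i < p) mu i *: col (inord i) M ->
  (forall i : 'I_p, (c <= i)%N -> mu i = 0) ->
  mu (Ordinal p0) = 0.
Proof.
move=> tM d0 d3 e muc.
have lt_n (i : nat) : (i <= p)%N -> (i < n.+1)%N by move=> h; rewrite ltnS (leq_trans h).
have zero (s : 'I_p.+1 -> 'I_n.+1) (q : 'I_p.+1) : s q = c ->
    (forall i : 'I_p, mu i != 0 -> exists2 j, j != q & s j = inord i) ->
    \det (colsub s M) = 0.
  move=> sq H; apply/eqP; suff : (-1) ^+ q * \det (colsub s M) == 0.
    by rewrite mulf_eq0 signr_eq0.
  apply/eqP; rewrite -det_colsub_fcons sq (det_fcons_lin _ e) big1 // => i _.
  have [->|/H[j jq sj]] := eqVneq (mu i) 0; first by rewrite mul0r.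
  case: (unliftP q j) jq => [j' ej|->]; last by rewrite eqxx.
  by rewrite (@det_fcons_mem _ _ _ _ _ j') ?mulr0 //= -ej sj.
(* [c] lies in neither block minor: such a minor would contain [c] together with all columns on
   which it depends, and would vanish. *)
have c_big : (p < c)%N.
  rewrite ltnNge; apply/negP => cp; move/eqP: d0; apply.
  apply: (zero _ (inord c)); first by rewrite inordK // inord_val.
  move=> i mui; exists (inord i); last by rewrite inordK // ltnS ltnW.
  apply: contraNneq mui => /(congr1 val); rewrite /= !inordK ?ltnS //; last exact: ltnW.
  by move=> h; rewrite muc // h.
have c_small : (c < n)%N.
  rewrite ltn_neqAle -ltnS ltn_ord andbT; apply/negP => /eqP cn.
  move/eqP: d3; apply; apply: (zero _ ord_max).
    by rewrite /= ltnn; apply: val_inj; rewrite /= inordK // cn.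
  move=> i mui; exists (inord i).
    by apply/eqP => /(congr1 val); rewrite /= inordK ?ltnS 1?ltnW // => h;
      have := ltn_ord i; rewrite h ltnn.
  by rewrite inordK ?ltn_ord // ltnS ltnW.
have main (s : 'I_p.+1 -> 'I_n.+1) (t : 'I_p.+1 -> 'I_n.+1) (q : 'I_p.+1) :
    s q = c ->
    (forall i : 'I_p, (0 < i)%N -> exists2 j, j != q & s j = inord i) ->
    t =1 fcons (inord 0) (s \o lift q) ->
    (-1) ^+ q * \det (colsub s M) = mu (Ordinal p0) * \det (colsub t M).
  move=> sq H tE; rewrite -det_colsub_fcons sq (det_fcons_lin _ e).
  rewrite (bigD1 (Ordinal p0)) //= big1 ?addr0 => [|i i0].
    by rewrite (eq_colsub _ tE).
  have {i0} : (0 < i)%N by rewrite lt0n.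
  case/H => j jq sj; case: (unliftP q j) jq => [j' ej|->]; last by rewrite eqxx.
  by rewrite (@det_fcons_mem _ _ _ _ _ j') ?mulr0 //= -ej sj.
(* [s1] and [s2] arise from [s0] (columns 0, ..., p) and [s3] (columns 0, ..., p - 1, n) by putting
   [c] in place of column 0. As p < c < n, sorting moves [c] to position p in [s1] and to position p
   - 1 in [s2], whence the opposite signs. *)
pose s0 := fun j : 'I_p.+1 => inord j : 'I_n.+1.
have hs0 : incr s0.
  by move=> i j ij; rewrite /s0 !inordK //; apply: lt_n; rewrite -ltnS.
pose s1 := fun j : 'I_p.+1 => inord (if (j < p)%N then j.+1 else c) : 'I_n.+1.
have hs1 : incr s1.
  move=> i j ij; have ip : (i < p)%N by apply: leq_trans ij _; rewrite -ltnS.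
  rewrite /s1 ip inordK; last exact: lt_n.
  by case: ifP => jp; rewrite inordK ?ltnS //; lia.
pose s2 := fun j : 'I_p.+1 =>
  inord (if (j < p.-1)%N then j.+1 else if (j < p)%N then c : nat else n) : 'I_n.+1.
have hs2 : incr s2.
  move=> i j ij; have jp : (j <= p)%N by rewrite -ltnS.
  have ip : (i < p)%N by apply: leq_trans ij _.
  rewrite /s2 ip; case: ifP => i1; case: ifP => j1.
  - by rewrite !inordK ?ltnS //; lia.
  - by case: ifP => j2; rewrite !inordK ?ltnS //; lia.
  - lia.
  - by case: ifP => j2; rewrite !inordK ?ltnS //; lia.
pose s3 := fun j : 'I_p.+1 => inord (if (j < p)%N then j : nat else n) : 'I_n.+1.
have hs3 : incr s3.
  move=> i j ij; have jp : (j <= p)%N by rewrite -ltnS.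
  have ip : (i < p)%N by apply: leq_trans ij _.
  by rewrite /s3 ip; case: ifP => j1; rewrite !inordK ?ltnS //; lia.
have E1 : (-1) ^+ p * \det (colsub s1 M) = mu (Ordinal p0) * \det (colsub s0 M).
  have qE : (ord_max : 'I_p.+1) = p :> nat by [].
  rewrite -{1}qE; apply: (main s1 s0 ord_max).
  - by rewrite /s1 /= ltnn inord_val.
  - move=> i i0; exists (inord i.-1).
      by apply/eqP => /(congr1 val); rewrite /= inordK; have := ltn_ord i; lia.
    rewrite /s1 inordK; last by have := ltn_ord i; lia.
    by rewrite ifT ?prednK //; have := ltn_ord i; lia.
  - move=> j; case: (unliftP ord0 j) => [i|] ->; last by rewrite fcons0.
    have ip := ltn_ord i; rewrite fconsS /s0 /s1 /= /bump /= (leqNgt p i) ip.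
    by rewrite add0n ip add1n.
have E2 : (-1) ^+ p.-1 * \det (colsub s2 M) = mu (Ordinal p0) * \det (colsub s3 M).
  have qE : (inord p.-1 : 'I_p.+1) = p.-1 :> nat by rewrite inordK; lia.
  rewrite -{1}qE; apply: (main s2 s3 (inord p.-1)).
  - by rewrite /s2 qE ltnn prednK // leqnn inord_val.
  - move=> i i0; exists (inord i.-1).
      by apply/eqP => /(congr1 val); rewrite /= !inordK; have := ltn_ord i; lia.
    rewrite /s2 inordK; last by have := ltn_ord i; lia.
    by rewrite ifT ?prednK //; have := ltn_ord i; lia.
  - move=> j; case: (unliftP ord0 j) => [i|] ->; last by rewrite fcons0 /s3 /= p0.
    rewrite fconsS /s3 /s2 /= qE /bump /= add1n.
    have := ltn_ord i; case: (leqP p.-1 i) => ip hi; rewrite /= ?add1n ?add0n.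
      have -> : (i : nat) = p.-1 by lia.
      by rewrite prednK // ltnn ifF //; lia.
    by rewrite !ifT // -ltn_predRL.
have p1 := tM _ _ hs1 hs0; have p2 := tM _ _ hs2 hs3.
have sgn (q : nat) D D' : (-1) ^+ q * D = mu (Ordinal p0) * D' -> D' != 0 ->
    0 <= D * D' -> 0 <= mu (Ordinal p0) * (-1) ^+ q.
  move=> eD D0 DD; rewrite -(pmulr_lge0 _ (_ : 0 < D' ^+ 2)) ?exprn_even_gt0 //.
  have -> : mu (Ordinal p0) * (-1) ^+ q * D' ^+ 2 =
      (mu (Ordinal p0) * D') * ((-1) ^+ q * D') by lra.
  by rewrite -eD mulrACA -expr2 sqrr_sign mul1r.
have := sgn _ _ _ E1 d0 p1; have := sgn _ _ _ E2 d3 p2.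
rewrite -{4}(prednK p0) exprS mulN1r mulrN oppr_ge0 => h1 h2.
have /eqP : mu (Ordinal p0) * (-1) ^+ p.-1 = 0 by apply/le_anti; rewrite h1 h2.
by rewrite mulf_eq0 signr_eq0 orbF => /eqP.
Qed.

Lemma qper_nat n c k (A : int -> 'cV[F]_k) (t : nat) j : qper n c A ->
  A (j + t%:Z * n%:Z) = c ^+ t *: A j.
Proof.
move=> h; elim: t => [|t IH]; first by rewrite mul0r addr0 expr0 scale1r.
by rewrite -[in LHS]addn1 PoszD mulrDl mul1r addrA h IH scalerA -exprS.
Qed.

Lemma win_qper n c k (A : int -> 'cV[F]_k) a m : qper n c A ->
  win A (a + n%:Z) m = c *: win A a m.
Proof. by move=> h; apply/matrixP => i j; rewrite !mxE addrAC h mxE. Qed.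

Lemma tnnZ k n (c : F) (A : 'M[F]_(k, n)) : tnn A -> tnn (c *: A).
Proof. by rewrite -mul_scalar_mx; exact: tnn_mull. Qed.

Lemma tposZ k n (c : F) (A : 'M[F]_(k, n)) : c != 0 -> tpos A -> tpos (c *: A).
Proof.
move=> c0; rewrite -mul_scalar_mx; apply: tpos_mull.
by rewrite unitmxE det_scalar unitfE expf_neq0.
Qed.

(** If the last column of the shifted window is selected, it is the first column of the old window
    times the quasi-period. Moving it to the front is a k-cycle, of sign [(-1) ^+ k.-1], and the
    quasi-period cancels this sign. *)
Lemma win_rot k n (A : int -> 'cV[F]_k) a (s : 'I_k -> 'I_n) :
  qper n ((-1) ^+ k.+1) A -> incr s ->
  exists2 s' : 'I_k -> 'I_n, incr s' &
    \det (colsub s (win A (a + 1) n)) = \det (colsub s' (win A a n)).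
Proof.
case: k => [|p] in A s *; first by move=> _ hs; exists s => //; rewrite !det_mx00.
case: n => [|n] in s *; first by case: (s ord0).
move=> hA hs; have [smax|smax] := eqVneq (s ord_max) ord_max; last first.
  have sn j : (s j < n)%N.
    have [jm|jm] := eqVneq j ord_max.
      by rewrite jm ltn_neqAle -ltnS ltn_ord andbT.
    have : (s j < s ord_max)%N by apply: hs; rewrite ltn_neqAle -ltnS ltn_ord andbT.
    by move=> h; rewrite (leq_trans h) // -ltnS.
  exists (fun j => inord (s j).+1).
    by move=> i j ij; rewrite !inordK ?ltnS ?sn // hs.
  congr (\det _); apply/matrixP => i j; rewrite !mxE inordK ?ltnS //.
  by rewrite intS addrA.
have sn j : (s (lift ord_max j) < n)%N.
  have : (s (lift ord_max j) < s ord_max)%N.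
    by apply: hs; rewrite /= /bump (leqNgt p j) ltn_ord add0n.
  by rewrite smax.
exists (fcons ord0 (fun j => inord (s (lift ord_max j)).+1)).
  move=> i j; case: (unliftP ord0 j) => [j'|] ->; last by rewrite ltn0.
  rewrite fconsS inordK ?ltnS //; case: (unliftP ord0 i) => [i'|] -> ij.
    rewrite fconsS inordK ?ltnS //; apply: hs; move: ij.
    by rewrite /= /bump (leqNgt p i') (leqNgt p j') !ltn_ord !add0n !add1n.
  by rewrite fcons0.
have sg2 : (-1) ^+ p * (-1) ^+ p = 1 :> F by rewrite -expr2 sqrr_sign.
rewrite -[LHS]mul1r -sg2 -mulrA -[p in X in _ * X]/((ord_max : 'I_p.+1) : nat).
rewrite -det_colsub_fcons.
pose d : 'rV[F]_p.+1 := \row_j (if j == ord0 then (-1) ^+ p else 1).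
rewrite (_ : colsub _ _ = colsub (fcons ord0 (fun j => inord (s (lift ord_max j)).+1))
    (win A a n.+1) *m diag_mx d).
  rewrite det_mulmx det_diag big_ord_recl mxE eqxx big1 ?mulr1.
    by rewrite mulrC -mulrA sg2 mulr1.
  by move=> i _; rewrite mxE.
rewrite mul_mx_diag; apply/matrixP => i j; rewrite !mxE.
case: (unliftP ord0 j) => [j'|] ->.
  rewrite !fconsS eq_sym (negbTE (neq_lift _ _)) mulr1 inordK ?ltnS //=.
  by rewrite intS addrA.
rewrite !fcons0 eqxx smax /= addr0 -addrA -PoszD add1n hA mxE mulrC.
by rewrite !exprS !mulN1r opprK.
Qed.

(** Single forward steps are enough: going back by whole periods only multiplies the window by a
    sign. *)
Lemma win_ind k n (A : int -> 'cV[F]_k) (P : 'M[F]_(k, n) -> Prop) a b :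
  (0 < n)%N -> qper n ((-1) ^+ k.+1) A ->
  (forall c, P (win A c n) -> P (win A (c + 1) n)) ->
  (forall M, P M -> P ((-1) ^+ k.+1 *: M)) ->
  P (win A a n) -> P (win A b n).
Proof.
move=> n0 hA step scal.
have steps c (m : nat) : P (win A c n) -> P (win A (c + m%:Z) n).
  elim: m => [|m IH]; first by rewrite addr0.
  by move=> /IH /step; rewrite -addrA -PoszD addn1.
have back c : P (win A c n) -> P (win A (c - n%:Z) n).
  move=> /scal; rewrite -[c in X in P X -> _](subrK n%:Z) (win_qper _ _ hA).
  by rewrite scalerA -expr2 sqrr_sign scale1r.
have backs c (m : nat) : P (win A c n) -> P (win A (c - m%:Z * n%:Z) n).
  elim: m => [|m IH]; first by rewrite mul0r subr0.
  by move=> /IH /back; rewrite -[m.+1]addn1 PoszD mulrDl mul1r opprD addrA.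
move=> /(backs _ `|a - b|%N) /(steps _ `|(b - (a - `|a - b|%N%:Z * n%:Z))%R|%N).
by congr (P (win A _ n)); nia.
Qed.

Lemma tnn_win k n (A : int -> 'cV[F]_k) a b : (0 < n)%N ->
  qper n ((-1) ^+ k.+1) A -> tnn (win A a n) -> tnn (win A b n).
Proof.
move=> n0 hA; apply: win_ind => //; last by move=> M; exact: tnnZ.
move=> c h s s' hs hs'.
have [t ht ->] := win_rot c hA hs; have [t' ht' ->] := win_rot c hA hs'.
exact: h.
Qed.

Lemma tpos_win k n (A : int -> 'cV[F]_k) a b : (0 < n)%N ->
  qper n ((-1) ^+ k.+1) A -> tpos (win A a n) -> tpos (win A b n).
Proof.
move=> n0 hA; apply: win_ind => //; last first.
  by move=> M; apply: tposZ; rewrite signr_eq0.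
move=> c h s s' hs hs'.
have [t ht ->] := win_rot c hA hs; have [t' ht' ->] := win_rot c hA hs'.
exact: h.
Qed.
End Family.

(** * Consecutive minors of totally nonnegative families *)

Section Consecutive.
Variable F : realFieldType.

Lemma qper_int n (c : F) k (A : int -> 'cV[F]_k) (t : int) j :
  c != 0 -> qper n c A -> A (j + t * n%:Z) = c ^ t *: A j.
Proof.
move=> c0 h; case: (intP t) => [|m|m].
- by rewrite mul0r addr0 expr0z scale1r.
- exact: qper_nat.
have := qper_nat m.+1 (j - m.+1%:Z * n%:Z) h; rewrite subrK => ->.
by rewrite scalerA mulNr -invr_expz -exprnP mulVf ?expf_neq0 // scale1r.
Qed.

Lemma win_mulmx k (A : int -> 'cV[F]_k) a m (v : 'cV[F]_m) :
  win A a m *m v = \sum_j v j 0 *: A (a + (j : nat)%:Z).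
Proof.
apply/colP => i; rewrite mxE summxE; apply: eq_bigr => j _.
by rewrite !mxE mulrC.
Qed.

Lemma unitmx_kerP k (M : 'M[F]_k) :
  (forall v : 'cV[F]_k, M *m v = 0 -> v = 0) -> M \in unitmx.
Proof.
move=> h; rewrite -unitmx_tr -row_free_unit -kermx_eq0; apply/rowV0P => v.
move=> /sub_kermxP vM; apply: trmx_inj; rewrite trmx0; apply: h.
by apply: trmx_inj; rewrite trmx_mul trmxK trmx0.
Qed.

Lemma unitmx_ker k (M : 'M[F]_k) (v : 'cV[F]_k) :
  M \in unitmx -> M *m v = 0 -> v = 0.
Proof. by move=> uM Mv; rewrite -[v](mulKmx uM) Mv mulmx0. Qed.

Lemma win_unit_neq0 p (A : int -> 'cV[F]_p.+1) a :
  win A a p.+1 \in unitmx -> A a != 0.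
Proof.
move=> u; apply/eqP => A0.
have : delta_mx 0 0 = 0 :> 'cV[F]_p.+1.
  apply: (unitmx_ker u); rewrite win_mulmx big_ord_recl /= addr0 A0 scaler0 add0r.
  by rewrite big1 // => i _; rewrite mxE scale0r.
by move=> /colP /(_ 0) /eqP; rewrite !mxE !eqxx oner_eq0.
Qed.

(** The window is restarted at [x0], the first index with nonzero coefficient, and the coefficients
    are padded by zeros to a block of the same length. Then the first coefficient of the block is
    nonzero, against [tnn_block_dep]. *)
Lemma no_block_dep p n (A : int -> 'cV[F]_p.+1) a (c : int) (lam : 'I_p -> F) :
  qper n ((-1) ^+ p.+2) A -> (forall b, tnn (win A b n)) ->
  (forall b, win A b p.+1 \in unitmx) ->
  a + p%:Z <= c < a + n%:Z ->
  A c <> \sum_i lam i *: A (a + (i : nat)%:Z).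
Proof.
move=> hA tA uA hc e.
have [i0 li0] : exists i, lam i != 0.
  apply/existsP; apply: contraTT (win_unit_neq0 (uA c)) => /existsPn h.
  rewrite negbK e big1 // => i _; have /negPn/eqP -> := h i.
  by rewrite scale0r.
case: p => [|p] in A hA tA uA lam e hc i0 li0 *; first by case: i0 li0.
case: n hc hA tA => [|n] hc hA tA; first by lia.
have pn : (p.+1 <= n)%N by lia.
pose x0 := [arg min_(i < i0 | lam i != 0) (i : nat)].
have [lx0 x0min] : lam x0 != 0 /\ forall i, lam i != 0 -> (x0 <= i)%N.
  by rewrite /x0; case: arg_minnP.
pose L (x : nat) := if (x < p.+1)%N then lam (inord x) else 0.
pose G (x : nat) := L x *: A (a + x%:Z).
pose a' := a + (x0 : nat)%:Z.
have cg : (`|c - a'| < n.+1)%N by rewrite /a'; have := ltn_ord x0; lia.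
pose g := Ordinal cg.
have ag : a' + `|c - a'|%N%:Z = c by rewrite /a'; have := ltn_ord x0; lia.
pose M := win A a' n.+1.
have colM (x : nat) : (x < n.+1)%N -> col (inord x) M = A (a' + x%:Z).
  by move=> xn; apply/colP => i; rewrite !mxE inordK.
pose mu (i : 'I_p.+1) := L (x0 + i)%N.
suff : mu (Ordinal (ltn0Sn p)) = 0.
  by move/eqP; rewrite /mu /L addn0 ltn_ord inord_val (negbTE lx0).
apply: (@tnn_block_dep _ _ _ M g mu).
- exact: pn.
- exact: tA.
- rewrite (_ : colsub _ _ = win A a' p.+2).
    by rewrite -unitfE -unitmxE.
  apply/matrixP => i j; rewrite !mxE inordK //.
  by rewrite (leq_trans (ltn_ord _)).
(* The last column of the period is, up to sign, the one just before [a'], so this minor is that of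
   the window starting at [a' - 1]. *)
- pose s := fun j : 'I_p.+2 =>
    inord (if (j < p.+1)%N then j : nat else n) : 'I_n.+1.
  rewrite -/s.
  suff : (-1) ^+ p.+1 * \det (colsub s M) != 0.
    by rewrite mulf_eq0 negb_or => /andP[].
  rewrite -[p.+1 in X in X * _]/((ord_max : 'I_p.+2) : nat) -det_colsub_fcons.
  pose d : 'rV[F]_p.+2 := \row_j (if j == ord0 then (-1) ^+ p.+3 else 1).
  rewrite (_ : colsub _ _ = win A (a' - 1) p.+2 *m diag_mx d).
    rewrite det_mulmx det_diag mulf_neq0 //; first by rewrite -unitfE -unitmxE.
    rewrite prodf_seq_neq0; apply/allP => x _; rewrite mxE.
    by case: ifP => _; rewrite ?signr_eq0 ?oner_eq0.
  rewrite mul_mx_diag; apply/matrixP => i j; rewrite !mxE.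
  case: (unliftP ord0 j) => [j'|] ->.
    rewrite fconsS eq_sym (negbTE (neq_lift _ _)) mulr1 /s /= /bump.
    rewrite (leqNgt p.+1) ltn_ord add0n ltn_ord inordK; last first.
      by rewrite ltnS (leq_trans _ pn) // ltnW.
    by rewrite intS addrA subrK.
  rewrite fcons0 eqxx /s /= ltnn inordK // addr0.
  have -> : a' + n%:Z = a' - 1 + n.+1%:Z by rewrite intS addrA subrK.
  by rewrite hA mxE mulrC.
- have -> : col g M = A c.
    by apply/colP => i; rewrite !mxE /= ag.
  rewrite e; transitivity (\sum_(0 <= x < p.+1) G x).
    rewrite big_mkord; apply: eq_bigr => i _.
    by rewrite /G /L ltn_ord inord_val.
  have tail : \sum_(p.+1 <= x < x0 + p.+1) G x = 0.
    rewrite big_nat_cond big1 // => x /andP[/andP[px _] _].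
    by rewrite /G /L ltnNge px scale0r.
  have head : \sum_(0 <= x < x0) G x = 0.
    rewrite big_nat_cond big1 // => x /andP[/andP[_ px] _].
    rewrite /G /L; case: ifP => xp; rewrite ?scale0r //.
    have [->|/x0min] := eqVneq (lam (inord x)) 0; first by rewrite scale0r.
    by rewrite inordK // leqNgt px.
  transitivity (\sum_(x0 <= x < x0 + p.+1) G x).
    transitivity (\sum_(0 <= x < x0 + p.+1) G x).
      by rewrite [RHS](big_cat_nat _ (n := p.+1)) ?leq_addl //= tail addr0.
    by rewrite (big_cat_nat _ (n := x0)) ?leq_addr //= head add0r.
  rewrite -{1}[x0 : nat]add0n big_addn addKn big_mkord.
  apply: eq_bigr => i _; rewrite colM; last first.
    by rewrite ltnS (leq_trans _ pn) // ltnW.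
  by rewrite /G /mu addnC PoszD /a' addrA.
- move=> i /= gi; rewrite /mu /L ifF //; apply/negbTE; rewrite -leqNgt.
  by move: gi; rewrite /a'; have := ltn_ord x0; lia.
Qed.

(* Contracting the column of index [a]: [B] is the family of the columns other
   than the multiples of that one, projected along it. *)
Lemma tnn_consecutive_tpos k n (A : int -> 'cV[F]_k) :
  (0 < n)%N -> qper n ((-1) ^+ k.+1) A -> tnn (win A 0 n) ->
  (forall a, win A a k \in unitmx) -> tpos (win A 0 n).
Proof.
elim: k n A => [|p IH] n A n0 hA tA0 uA.
  by move=> s s' _ _; rewrite !det_mx00 mulr1.
have tA b : tnn (win A b n) by exact: tnn_win tA0.
apply: tnn_tpos => // s hs.
case: p => [|q] in IH A hA tA0 tA uA s hs *.
  have := uA (s ord0 : nat)%:Z; rewrite unitmxE unitfE.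
  congr (\det _ != 0); apply/matrixP => i j; rewrite !mxE [j]ord1.
  by rewrite addr0 add0r.
set p := q.+1 in IH A hA tA0 tA uA s hs *.
case: n => [|n] // in n0 hA tA0 tA s hs *.
have pn : (p <= n)%N.
  have sI := incr_inj hs; have := leq_card s sI; rewrite !card_ord ltnS.
  by [].
have n1 : (0 < n)%N by apply: leq_trans pn.
have nZ : n%:Z != 0 by rewrite eqz_nat -lt0n.
(* The contracted column is the first one of the minor to be shown nonzero; that minor then becomes,
   up to the factor [\det g], a minor of the contracted family. *)
pose a : int := (s ord0 : nat)%:Z.
pose g := invmx (win A a p.+1).
have ug : g \in unitmx by rewrite unitmx_inv uA.
have ga : g *m A a = delta_mx 0 0.
  rewrite (_ : A a = win A a p.+1 *m delta_mx 0 0); first by rewrite mulKmx.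
  rewrite win_mulmx (bigD1 ord0) //= big1 ?addr0.
    by rewrite mxE !eqxx scale1r ?addr0.
  by move=> i /negbTE i0; rewrite mxE i0 scale0r.
pose pr (y : 'cV[F]_p.+1) : 'cV[F]_p := dsubmx (g *m y : 'cV_(1 + p)).
have pr_ker y : pr y = 0 -> exists c, y = c *: A a.
  move=> py; exists ((g *m y) 0 0); rewrite -[LHS](mulKmx ug).
  rewrite -[A a](mulKmx ug) ga scalemxAr; congr (_ *m _).
  apply/colP => i; rewrite !mxE; have [i0|i0] := eqVneq i 0.
    by rewrite mulr1 i0.
  rewrite mulr0; move: py => /colP; case: (unliftP ord0 i) i0 => [i'|] -> // _.
  move=> /(_ i'); rewrite !mxE => h; rewrite -[RHS]h; apply: eq_bigr => j _.
  by congr (g _ _ * _); apply: val_inj.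
(* Adding [j %/ n] to the index skips the contracted column once in each period of [n + 1] columns;
   the sign turns the quasi-period of [A] into [(-1) ^+ p.+1], the one that belongs to [p] rows. *)
pose B (j : int) := (-1) ^ (j %/ n%:Z)%Z *: pr (A (a + 1 + j + (j %/ n%:Z)%Z)).
have prZ c y : pr (c *: y) = c *: pr y by rewrite /pr -scalemxAr linearZ.
have prD : {morph pr : y z / y + z} by move=> y z; rewrite /pr mulmxDr linearD.
have pr0 : pr 0 = 0 by rewrite /pr mulmx0 linear0.
have hB : qper n ((-1) ^+ p.+1) B.
  move=> j; rewrite /B divzDr ?dvdzz // divzz nZ.
  have -> : a + 1 + (j + n%:Z) + ((j %/ n%:Z)%Z + 1) =
            a + 1 + j + (j %/ n%:Z)%Z + n.+1%:Z by lia.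
  rewrite hA prZ !scalerA; congr (_ *: _).
  rewrite exprzDr ?unitrN1 // expr1z (exprS _ p.+1).
  by lra.
have B0 (x : nat) : (x < n)%N -> B x%:Z = pr (A (a + 1 + x%:Z)).
  by move=> xn; rewrite /B divz_small ?expr0z ?scale1r ?addr0.
have l0 (x : 'I_1) : lshift p x = ord0 :> 'I_p.+1.
  by apply: val_inj; rewrite [x]ord1.
have r0 (x : 'I_p) : rshift 1 x = lift ord0 x :> 'I_p.+1 by apply: val_inj.
have detB (t : 'I_p -> 'I_n) : \det (colsub t (win B 0 n)) = \det g *
    \det (colsub (fcons ord0 (fun i => inord (t i).+1)) (win A a n.+1)).
  rewrite -det_mulmx.
  pose T : 'M[F]_(1 + p) := g *m colsub (fcons ord0 (fun i => inord (t i).+1)) (win A a n.+1).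
  have e : T = block_mx 1 (ursubmx T) 0 (colsub t (win B 0 n)).
    rewrite -[LHS](submxK (T : 'M[F]_(1 + p, 1 + p))).
    have c0 (x : 'I_p.+1) (y : 'I_1) : T x (lshift p y) = (x == ord0)%:R.
      move/colP: ga => /(_ x); rewrite [RHS]mxE andbT => <-.
      rewrite !mxE; apply: eq_bigr => j _.
      by rewrite !mxE l0 fcons0 ?addr0.
    congr block_mx.
    - apply/matrixP => i j; transitivity (T (lshift p i) (lshift p j)).
        by rewrite [LHS]mxE mxE.
      by rewrite c0 l0 [i]ord1 [j]ord1 mxE.
    - apply/matrixP => i j; transitivity (T (rshift 1 i) (lshift p j)).
        by rewrite [LHS]mxE mxE.
      by rewrite c0 r0 mxE.
    - apply/matrixP => i j; rewrite [RHS]mxE [RHS]mxE add0r B0 // !mxE; apply: eq_bigr => x _.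
      by rewrite !mxE !r0 fconsS inordK ?ltnS // intS addrA.
  by move: (congr1 (fun M : 'M_(1 + p) => \det M) e); rewrite /= det_ublock det1 mul1r => <-.
have incrB (t : 'I_p -> 'I_n) : incr t ->
    incr (fcons ord0 (fun i => inord (t i).+1) : 'I_p.+1 -> 'I_n.+1).
  move=> ht i j; case: (unliftP ord0 j) => [j'|] ->; last by rewrite ltn0.
  rewrite fconsS inordK ?ltnS //; case: (unliftP ord0 i) => [i'|] -> ij.
    by rewrite fconsS inordK ?ltnS //; exact: ht.
  by rewrite fcons0.
have tB : tnn (win B 0 n).
  move=> t t' ht ht'; rewrite !detB mulrACA mulr_ge0 //.
    by rewrite -expr2 sqr_ge0.
  by apply: tA; exact: incrB.
have B1 (x : nat) : (x < n)%N -> B (x + n)%N%:Z = - pr (A (a + 1 + (x + n).+1%:Z)).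
  move=> xn; rewrite PoszD hB B0 // (_ : a + 1 + (x + n).+1%:Z = a + 1 + x%:Z + n.+1%:Z).
    by rewrite hA prZ -scaleNr (exprS _ p.+1) mulN1r opprK.
  by lia.
clearbody B.
have uB b : win B b p \in unitmx.
  rewrite [b](divz_eq _ n%:Z) addrC.
  have -> : win B ((b %% n%:Z)%Z + (b %/ n%:Z)%Z * n%:Z) p =
            ((-1) ^+ p.+1) ^ (b %/ n%:Z)%Z *: win B (b %% n%:Z)%Z p.
    apply/matrixP => i j; rewrite !mxE addrAC (qper_int _ _ _ hB) ?signr_eq0 //.
    by rewrite mxE.
  rewrite unitmxZ ?unitfE ?expfz_neq0 ?signr_eq0 //.
  have [b0 bn] : (0 <= (b %% n%:Z)%Z) /\ ((b %% n%:Z)%Z < n%:Z).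
    by split; [exact: modz_ge0 | rewrite ltz_pmod].
  case: (b %% n%:Z)%Z b0 bn => // {}b _; rewrite ltz_nat => bn.
  apply: unitmx_kerP => v; rewrite win_mulmx => vB.
  (* The window does not pass the contracted column. A relation between its columns lifts to a
     combination equal to [c *: A a]. If [c = 0] it is a relation inside an invertible window of
     [A]; otherwise column [a + n.+1] depends on a block of [p] consecutive columns, which
     [no_block_dep] excludes. *)
  have [bp|bp] := leqP (b + p) n.
    have : pr (\sum_j v j 0 *: A (a + 1 + b%:Z + (j : nat)%:Z)) = 0.
      rewrite -vB (big_morph _ prD pr0); apply: eq_bigr => j _.
      rewrite prZ -PoszD B0 ?PoszD ?addrA //.
      by apply: leq_trans bp; rewrite ltn_add2l.
    case/pr_ker => c ec; have [c0|c0] := eqVneq c 0.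
      pose w : 'cV[F]_p.+1 :=
        \col_i (if unlift ord_max i is Some j then v j 0 else 0).
      have w0 : w = 0.
        apply: (unitmx_ker (uA (a + 1 + b%:Z))); rewrite win_mulmx.
        rewrite (bigD1_ord ord_max) //= mxE unlift_none scale0r add0r.
        rewrite -[RHS](scale0r (A a)) -c0 -ec; apply: eq_bigr => j _.
        by rewrite mxE liftK /bump (leqNgt p) ltn_ord add0n.
      apply/colP => j; move/colP: w0 => /(_ (lift ord_max j)).
      by rewrite !mxE liftK.
    exfalso.
    apply: (@no_block_dep p n.+1 A (a + 1 + b%:Z) (a + n.+1%:Z)
       (fun j => (-1) ^+ p.+2 / c * v j 0) hA tA uA); first by lia.
    rewrite hA; under eq_bigr do rewrite -scalerA.
    by rewrite -scaler_sumr ec scalerA mulfVK.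
  (* Here the window passes the contracted column, at position [n - b]: inserting it completes the
     window to [p.+1] consecutive columns of [A]. The signs [sg] come from the quasi-period of
     [B]. *)
  have dp : (n - b < p.+1)%N by rewrite ltnS leq_subLR ltnW.
  pose d := Ordinal dp.
  pose sg (j : 'I_p) : F := if (n - b <= j)%N then -1 else 1.
  have : pr (\sum_j (sg j * v j 0) *: A (a + 1 + b%:Z + (lift d j : nat)%:Z)) = 0.
    rewrite -[RHS]vB (big_morph _ prD pr0); apply: eq_bigr => j _.
    rewrite prZ -PoszD mulrC -scalerA; congr (_ *: _); rewrite /sg /= /bump.
    have jp := ltn_ord j; case: leqP => dj; last first.
      rewrite scale1r add0n B0 ?PoszD ?addrA //.
      by rewrite -ltn_subRL.
    have -> : (b + j)%N = ((b + j - n) + n)%N by lia.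
    rewrite B1; last by lia.
    rewrite scaleN1r; congr (- pr (A _)).
    by rewrite (_ : (true + j)%N = j.+1) //; lia.
  case/pr_ker => c ec.
  pose w : 'cV[F]_p.+1 :=
    \col_i (if unlift d i is Some j then sg j * v j 0 else - (-1) ^+ p.+2 * c).
  have w0 : w = 0.
    apply: (unitmx_ker (uA (a + 1 + b%:Z))); rewrite win_mulmx.
    rewrite (bigD1_ord d) //= mxE unlift_none.
    rewrite [X in _ + X](_ : _ = c *: A a); last first.
      by rewrite -ec; apply: eq_bigr => j _; rewrite mxE liftK.
    have -> : a + 1 + b%:Z + (n - b)%N%:Z = a + n.+1%:Z by lia.
    rewrite hA scalerA mulrAC mulNr -expr2 sqrr_sign mulN1r scaleNr.
    by rewrite addrC subrr.
  apply/colP => j; move/colP: w0 => /(_ (lift d j)); rewrite !mxE liftK /sg.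
  by case: ifP => _ /eqP; rewrite ?mulN1r ?mul1r ?oppr_eq0 => /eqP.
have tpB := IH n B n1 hB tB uB.
have sn (i : 'I_p) : (s ord0 < s (lift ord0 i))%N by exact: hs.
have t_lt (i : 'I_p) : ((s (lift ord0 i) - s ord0).-1 < n)%N.
  by have := sn i; have := ltn_ord (s (lift ord0 i)); lia.
pose t (i : 'I_p) : 'I_n := Ordinal (t_lt i).
have ht : incr t.
  move=> i j ij /=; have := sn i; have := sn j.
  by have : (s (lift ord0 i) < s (lift ord0 j))%N by [apply: hs]; lia.
have := tpos_neq0 tpB ht; rewrite detB mulf_eq0 negb_or => /andP[_].
congr (\det _ != 0); apply/matrixP => i j; rewrite !mxE.
congr (A _ i 0); case: (unliftP ord0 j) => [j'|] ->; last first.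
  by rewrite fcons0 addr0 add0r.
rewrite fconsS inordK ?ltnS ?t_lt //= add0r /a -PoszD; congr Posz.
by have := sn j'; lia.
Qed.

End Consecutive.

(** * The twist relation *)

Section Twist.
Variable F : realFieldType.

(** By a dimension count the rows of [A] span the whole left kernel of [B]. The elements of that
    kernel with second block zero form the left kernel of [B1] on one side, and the injective image
    of the kernel of [A2] on the other; comparing dimensions gives the formula. *)
Lemma rank_perp_block k l d e (A1 : 'M[F]_(d, k)) (A2 : 'M[F]_(d, l))
    (B1 : 'M[F]_(k, e)) (B2 : 'M[F]_(l, e)) :
  A1 *m B1 + A2 *m B2 = 0 -> row_free (row_mx A1 A2) ->
  \rank (col_mx B1 B2) = e -> (d + e)%N = (k + l)%N ->
  (\rank A2 + k)%N = (d + \rank B1)%N.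
Proof.
set A := row_mx A1 A2; set B := col_mx B1 B2 => AB fA rB de.
have AB0 : A *m B = 0 by rewrite mul_row_col.
have kerB : (kermx B <= A)%MS.
  have sAB : (A <= kermx B)%MS by apply/sub_kermxP.
  rewrite -(mxrank_leqif_sup sAB) mxrank_ker rB (eqP fA).
  by apply/eqP; lia.
have e1 : (kermx A2 *m A1 :=: kermx B1)%MS.
  apply/eqmxP/andP; split.
    apply/sub_kermxP; rewrite -mulmxA.
    move/eqP: AB; rewrite addr_eq0 => /eqP ->.
    by rewrite mulmxN mulmxA mulmx_ker mul0mx oppr0.
  apply/rV_subP => y /sub_kermxP yB1.
  have : (row_mx y (0 : 'rV_l) <= A)%MS.
    apply: submx_trans kerB; apply/sub_kermxP.
    by rewrite mul_row_col yB1 mul0mx addr0.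
  case/submxP => x; rewrite mul_mx_row => /eq_row_mx[-> /esym xA2].
  by apply: submxMr; apply/sub_kermxP.
have e2 : \rank (kermx A2 *m A1) = \rank (kermx A2).
  by rewrite -[RHS](mxrankMfree (kermx A2) fA) mul_mx_row mulmx_ker rank_row_mx0.
have := mxrank_ker A2; rewrite -e2 e1 mxrank_ker.
have := rank_leq_row A2; have := rank_leq_row B1; lia.
Qed.

(* The range of [i] is empty when [k = l = 0]. *)
Definition twrel k l (U T : int -> 'cV[F]_(k + l)) :=
  forall j i, j - l%:Z <= i <= j + k%:Z - 1 ->
    ((T j)^T *m U i) 0 0 = if i == j - l%:Z then (-1) ^ j else 0.

Definition uof k l (U : int -> 'cV[F]_(k + l)) j : 'cV_k := usubmx (U j).
Definition dof k l (U : int -> 'cV[F]_(k + l)) j : 'cV_l := dsubmx (U j).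

Lemma win_uof k l (U : int -> 'cV[F]_(k + l)) a m :
  win (uof U) a m = usubmx (win U a m).
Proof. by apply/matrixP => i j; rewrite !mxE. Qed.

Lemma win_dof k l (U : int -> 'cV[F]_(k + l)) a m :
  win (dof U) a m = dsubmx (win U a m).
Proof. by apply/matrixP => i j; rewrite !mxE. Qed.

Lemma win_stack k l (U : int -> 'cV[F]_(k + l)) a m :
  win U a m = col_mx (win (uof U) a m) (win (dof U) a m).
Proof. by rewrite win_uof win_dof vsubmxK. Qed.

Lemma gram_win k (T U : int -> 'cV[F]_k) a b m p (i : 'I_m) (j : 'I_p) :
  ((win T a m)^T *m win U b p) i j =
  ((T (a + (i : nat)%:Z))^T *m U (b + (j : nat)%:Z)) 0 0.
Proof. by rewrite !mxE; apply: eq_bigr => x _; rewrite !mxE. Qed.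

(** The matrix is triangular with signs on the diagonal. Its invertibility gives that of the windows
    of both families at once. *)
Lemma twrel_gram_unit k l (U T : int -> 'cV[F]_(k + l)) a : twrel U T ->
  (win T a (k + l))^T *m win U (a - l%:Z) (k + l) \in unitmx.
Proof.
move=> h; rewrite unitmxE det_trig.
  rewrite unitfE prodf_seq_neq0; apply/allP => i _ /=; rewrite gram_win.
  rewrite h; last by have := ltn_ord i; lia.
  by rewrite addrAC eqxx expfz_neq0 // oppr_eq0 oner_eq0.
apply/is_trig_mxP => i j ij; rewrite gram_win h.
  by rewrite ifF //; apply/eqP; lia.
by have := ltn_ord i; have := ltn_ord j; lia.
Qed.

Lemma twrel_unitl k l (U T : int -> 'cV[F]_(k + l)) a : twrel U T ->
  win U a (k + l) \in unitmx.
Proof.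
move=> /(twrel_gram_unit (a + l%:Z)); rewrite addrK.
by rewrite unitmx_mul => /andP[].
Qed.

Lemma twrel_unitr k l (U T : int -> 'cV[F]_(k + l)) a : twrel U T ->
  win T a (k + l) \in unitmx.
Proof.
by move=> /(twrel_gram_unit a); rewrite unitmx_mul unitmx_tr => /andP[].
Qed.

Lemma win_unit_free k (U : int -> 'cV[F]_k) a m : (m <= k)%N ->
  win U a k \in unitmx -> row_free (win U a m)^T.
Proof.
move=> mk; rewrite -unitmx_tr -row_free_unit => fU.
have -> : (win U a m)^T = rowsub (widen_ord mk) 1%:M *m (win U a k)^T.
  by rewrite mul_rowsub_mx mul1mx; apply/matrixP => i j; rewrite !mxE.
rewrite /row_free mxrankMfree //.
have f1 : row_free (rowsub (widen_ord mk) (1%:M : 'M[F]_k)).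
  apply/row_freeP; exists (rowsub (widen_ord mk) 1%:M)^T.
  rewrite mul_rowsub_mx mul1mx; apply/matrixP => i j; rewrite !mxE.
  by rewrite -!(inj_eq val_inj) /= eq_sym.
exact: f1.
Qed.

Lemma twrel_perp k l (U T : int -> 'cV[F]_(k + l)) a d : twrel U T ->
  (d <= k + l)%N ->
  (win T a d)^T *m win U (a + d%:Z - l%:Z) (k + l - d) = 0.
Proof.
move=> h dk; apply/matrixP => i j; rewrite gram_win [RHS]mxE h.
  by rewrite ifF //; apply/eqP; have := ltn_ord i; lia.
by have := ltn_ord i; have := ltn_ord j; lia.
Qed.

(** The columns of [U] that the relation makes orthogonal to each of [d] consecutive columns of [T]
    form a window of the complementary size [k + l - d], so [rank_perp_block] applies; the second
    formula is the same with the two blocks exchanged. *)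
Lemma twrel_rank k l (U T : int -> 'cV[F]_(k + l)) a d : twrel U T ->
  (d <= k + l)%N ->
  (\rank (win (dof T) a d) + k =
     d + \rank (win (uof U) (a + d%:Z - l%:Z) (k + l - d)))%N /\
  (\rank (win (uof T) a d) + l =
     d + \rank (win (dof U) (a + d%:Z - l%:Z) (k + l - d)))%N.
Proof.
move=> h dk; have := twrel_perp a h dk.
have fT := win_unit_free dk (twrel_unitr a h).
have fU := win_unit_free (leq_subr d (k + l)) (twrel_unitl (a + d%:Z - l%:Z) h).
have e : (d + (k + l - d))%N = (k + l)%N by rewrite subnKC.
move: fT fU; rewrite !(win_stack T) !(win_stack U) !tr_col_mx mul_row_col.
set A1 := (win (uof T) _ _)^T; set A2 := (win (dof T) _ _)^T.
set B1 := win (uof U) _ _; set B2 := win (dof U) _ _ => fA fB AB.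
have rB : \rank (col_mx B1 B2) = (k + l - d)%N.
  by rewrite -mxrank_tr tr_col_mx (eqP fB).
rewrite -(mxrank_tr (win (dof T) _ _)) -(mxrank_tr (win (uof T) _ _)) -/A1 -/A2.
split; first exact: (rank_perp_block AB fA rB e).
have AB' : A2 *m B2 + A1 *m B1 = 0 by rewrite addrC.
apply: (rank_perp_block AB'); last by rewrite e addnC.
  rewrite /row_free -mxrank_tr tr_row_mx -addsmxE addsmxC addsmxE -tr_row_mx.
  by rewrite mxrank_tr; exact: fA.
by rewrite -addsmxE addsmxC addsmxE.
Qed.

Lemma sgzN (a : int) : (-1) ^ (- a) = (-1) ^ a :> F.
Proof. by rewrite -exprz_inv invrN1. Qed.

Lemma sgz_sqr (a : int) : (-1) ^ a * (-1) ^ a = 1 :> F.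
Proof. by rewrite -{2}sgzN -exprzDr ?unitrN1 // subrr expr0z. Qed.

Definition falt k (A : int -> 'cV[F]_k) (j : int) := (-1) ^ j *: A j.

Lemma faltK k (A : int -> 'cV[F]_k) j : falt (falt A) j = A j.
Proof.
by rewrite /falt scalerA sgz_sqr scale1r.
Qed.

Lemma win_falt k (A : int -> 'cV[F]_k) a m :
  win (falt A) a m = (-1) ^ a *: alt (win A a m).
Proof.
apply/matrixP => i j; rewrite !mxE exprzDr ?unitrN1 //.
by rewrite -mulrA.
Qed.

Lemma sgz_neq0 (a : int) : (-1) ^ a != 0 :> F.
Proof. by rewrite expfz_neq0 // oppr_eq0 oner_eq0. Qed.

Lemma tpos_alt_win k (A : int -> 'cV[F]_k) a m :
  tpos (win (falt A) a m) -> tpos (alt (win A a m)).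
Proof.
move=> /(tposZ (sgz_neq0 (- a))); rewrite win_falt scalerA -exprzDr ?unitrN1 //.
by rewrite addNr expr0z scale1r.
Qed.

Lemma win_widen k (A : int -> 'cV[F]_k) a m n (mn : (m <= n)%N) :
  win A a m = colsub (widen_ord mn) (win A a n).
Proof. by apply/matrixP => i j; rewrite !mxE. Qed.

Lemma tnn_widen k (A : int -> 'cV[F]_k) a m n : (m <= n)%N ->
  tnn (win A a n) -> tnn (win A a m).
Proof.
move=> mn h s s' hs hs'; rewrite (win_widen A a mn).
by rewrite -!colsub_comp; apply: h; exact: incr_comp.
Qed.

Lemma tpos_widen k (A : int -> 'cV[F]_k) a m n : (m <= n)%N ->
  tpos (win A a n) -> tpos (win A a m).
Proof.
move=> mn h s s' hs hs'; rewrite (win_widen A a mn).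
by rewrite -!colsub_comp; apply: h; exact: incr_comp.
Qed.

Lemma tpos_win_unit k (A : int -> 'cV[F]_k) a n : (k <= n)%N ->
  tpos (win A a n) -> win A a k \in unitmx.
Proof.
move=> kn /(tpos_widen kn) /(tpos_row_free (leqnn k)).
by rewrite row_free_unit.
Qed.

Lemma falt_win_unit k (A : int -> 'cV[F]_k) a :
  win (falt A) a k \in unitmx -> win A a k \in unitmx.
Proof.
rewrite win_falt unitmxZ ?unitfE ?sgz_neq0 //.
by rewrite -!row_free_unit; exact: row_free_alt.
Qed.

Lemma falt_unit_win k (A : int -> 'cV[F]_k) a :
  win A a k \in unitmx -> win (falt A) a k \in unitmx.
Proof.
move=> u; apply: falt_win_unit; rewrite (_ : win _ _ _ = win A a k) //.
by apply/matrixP => i j; rewrite [LHS]mxE [RHS]mxE faltK.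
Qed.

Lemma stack_win_unit k l n (U : int -> 'cV[F]_(k + l)) a : (k + l <= n)%N ->
  tnn (win (uof U) a n) -> row_free (win (uof U) a (k + l)) ->
  tpos (win (falt (dof U)) a n) -> win U a (k + l) \in unitmx.
Proof.
move=> kn hV fV hW; rewrite win_stack; apply: stack_unit => //.
  exact: tnn_widen hV.
exact/tpos_alt_win/(tpos_widen kn).
Qed.

Lemma twrel_uniqr k l (U T T' : int -> 'cV[F]_(k + l)) :
  twrel U T -> twrel U T' -> T =1 T'.
Proof.
move=> h h' j; have u := twrel_unitl (j - l%:Z) h; apply: trmx_inj.
suff e S : twrel U S -> (S j)^T *m win U (j - l%:Z) (k + l) =
    \row_i (if i == 0%N :> nat then (-1) ^ j else 0).
  by rewrite -[(T j)^T](mulmxK u) (e _ h) -(e _ h') mulmxK.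
move=> hS; apply/rowP => i; rewrite mxE [RHS]mxE.
transitivity (((S j)^T *m U (j - l%:Z + (i : nat)%:Z)) 0 0).
  by rewrite [RHS]mxE; apply: eq_bigr => x _; rewrite !mxE.
rewrite hS; last by have := ltn_ord i; lia.
by congr (if _ then _ else _); apply/eqP/eqP; lia.
Qed.

Definition swap k l (u : 'cV[F]_(k + l)) : 'cV[F]_(l + k) :=
  col_mx (dsubmx u) (usubmx u).

Lemma swapK k l : cancel (@swap k l) (@swap l k).
Proof. by move=> u; rewrite /swap col_mxKd col_mxKu vsubmxK. Qed.

Lemma swap_inner k l (u v : 'cV[F]_(k + l)) : (swap u)^T *m swap v = u^T *m v.
Proof.
rewrite -{2}(vsubmxK u) -{2}(vsubmxK v) /swap !tr_col_mx !mul_row_col.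
by rewrite addrC.
Qed.

Lemma inner_sym k (u v : 'cV[F]_k) : (u^T *m v) 0 0 = (v^T *m u) 0 0.
Proof. by rewrite !mxE; apply: eq_bigr => i _; rewrite !mxE mulrC. Qed.

(** Seen from [U i], the pairing with [T j] is prescribed for [j] from [i - k + 1] to [i + l] and is
    nonzero at the last of these. Reflecting the indices brings this into the form of the relation
    with [k] and [l] exchanged, up to a shift by [k - l] and a sign. *)
Lemma twrel_rev k l (U T : int -> 'cV[F]_(k + l)) : twrel U T ->
  twrel (fun j => swap (T (- j)))
        (fun j => (-1) ^ k%:Z *: swap (U (k%:Z - l%:Z - j))).
Proof.
move=> h j i hi; rewrite linearZ /= -scalemxAl mxE swap_inner inner_sym h; last lia.
have -> : (k%:Z - l%:Z - j == - i - l%:Z) = (i == j - k%:Z) by apply/eqP/eqP; lia.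
case: eqP => [->|_]; last by rewrite mulr0.
by rewrite sgzN -exprzDr ?unitrN1 // addrC subrK.
Qed.

Definition frev k (b : int) (A : int -> 'cV[F]_k) (j : int) := A (b - j).

Lemma win_frev k b (A : int -> 'cV[F]_k) a n :
  win (frev b A) a n = colsub (@rev_ord n) (win A (b - a - n%:Z + 1) n).
Proof.
apply/matrixP => i j; rewrite !mxE /frev; congr (A _ i 0).
by rewrite /=; have := ltn_ord j; lia.
Qed.

(** Reversing the columns multiplies all minors by one and the same sign, that of the
    order-reversing permutation of ['I_k]. *)
Lemma det_colsub_rev k n (s : 'I_k -> 'I_n) : incr s ->
  exists2 t : 'I_k -> 'I_n, incr t & forall A : 'M[F]_(k, n),
   \det (colsub s (colsub (@rev_ord n) A)) =
     (-1) ^+ perm (@rev_ord_inj k) * \det (colsub t A).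
Proof.
move=> hs; pose t := @rev_ord n \o s \o @rev_ord k.
exists t.
  move=> i j ij; have := hs (rev_ord j) (rev_ord i).
  rewrite /= => /(_ _); have := ltn_ord i; have := ltn_ord j.
  have := ltn_ord (s (rev_ord i)); have := ltn_ord (s (rev_ord j)).
  by move=> ? ? ? ? /(_ ltac:(lia)); lia.
move=> A; rewrite -det_colsub_perm -colsub_comp.
by congr (\det _); apply/matrixP => i j; rewrite !mxE /t /= permE rev_ordK.
Qed.

Lemma tnn_frev k b (A : int -> 'cV[F]_k) a n :
  tnn (win A (b - a - n%:Z + 1) n) -> tnn (win (frev b A) a n).
Proof.
move=> h s s' /det_colsub_rev[t ht e] /det_colsub_rev[t' ht' e'].
by rewrite win_frev e e' mulrACA -expr2 sqrr_sign mul1r; exact: h.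
Qed.

Lemma tpos_frev k b (A : int -> 'cV[F]_k) a n :
  tpos (win A (b - a - n%:Z + 1) n) -> tpos (win (frev b A) a n).
Proof.
move=> h s s' /det_colsub_rev[t ht e] /det_colsub_rev[t' ht' e'].
by rewrite win_frev e e' mulrACA -expr2 sqrr_sign mul1r; exact: h.
Qed.

Lemma qper_frev n m k b (A : int -> 'cV[F]_k) :
  qper n ((-1) ^+ m) A -> qper n ((-1) ^+ m) (frev b A).
Proof.
move=> h j; rewrite /frev; have := h (b - (j + n%:Z)).
rewrite opprD addrA subrK => ->.
by rewrite scalerA -expr2 sqrr_sign scale1r.
Qed.

Lemma qper_falt n m k (A : int -> 'cV[F]_k) :
  qper n ((-1) ^+ m) A -> qper n ((-1) ^+ (m + n)) (falt A).
Proof.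
move=> h j; rewrite /falt h !scalerA exprzDr ?unitrN1 // exprD; congr (_ *: _).
by rewrite -exprnP; lra.
Qed.

End Twist.

From mathcomp Require Import all_classical all_reals.
From mathcomp Require Import topology normedtype derive trigo.
Import numFieldNormedType.Exports.

Local Open Scope classical_set_scope.
Local Open Scope ring_scope.

(** * Continuous and smooth functions *)

Section FunctionClass.
Variable R : realType.

(* A common abstraction of continuous and of smooth functions on [O]. *)
Record fun_class (X : Type) (O : set X) (S : set (X -> R)) : Prop := FunClass {
  fc_cst : forall c : R, S (fun=> c);
  fc_add : forall f g, S f -> S g -> S (fun x => f x + g x);
  fc_mul : forall f g, S f -> S g -> S (fun x => f x * g x);
  fc_inv : forall f, (forall x, O x -> f x != 0) -> S f ->
     S (fun x => (f x)^-1);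
  fc_ext : forall f g, (forall x, O x -> f x = g x) -> S f -> S g }.

Definition mx_class (X : Type) (S : set (X -> R)) m n (f : X -> 'M[R]_(m, n)) :=
  forall i j, S (fun x => f x i j).

Section Closure.
Variables (X : Type) (O : set X) (S : set (X -> R)).
Hypothesis SC : fun_class O S.

Lemma fc_sum (I : Type) (r : seq I) (P : pred I) (f : I -> X -> R) :
  (forall i, P i -> S (f i)) -> S (fun x => \sum_(i <- r | P i) f i x).
Proof.
move=> h; elim: r => [|i r IH].
  by apply: (fc_ext SC _ (fc_cst SC 0)) => x _; rewrite big_nil.
have [Pi|Pi] := boolP (P i); last first.
  by apply: (fc_ext SC _ IH) => x _; rewrite big_cons (negbTE Pi).
by apply: (fc_ext SC _ (fc_add SC (h _ Pi) IH)) => x _; rewrite big_cons Pi.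
Qed.

Lemma fc_prod (I : Type) (r : seq I) (P : pred I) (f : I -> X -> R) :
  (forall i, P i -> S (f i)) -> S (fun x => \prod_(i <- r | P i) f i x).
Proof.
move=> h; elim: r => [|i r IH].
  by apply: (fc_ext SC _ (fc_cst SC 1)) => x _; rewrite big_nil.
have [Pi|Pi] := boolP (P i); last first.
  by apply: (fc_ext SC _ IH) => x _; rewrite big_cons (negbTE Pi).
by apply: (fc_ext SC _ (fc_mul SC (h _ Pi) IH)) => x _; rewrite big_cons Pi.
Qed.

Lemma mc_cst m n (A : 'M[R]_(m, n)) : mx_class S (fun=> A).
Proof. by move=> i j; exact: (fc_cst SC). Qed.

Lemma mc_mul m n p (f : X -> 'M[R]_(m, n)) (g : X -> 'M[R]_(n, p)) :
  mx_class S f -> mx_class S g -> mx_class S (fun x => f x *m g x).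
Proof.
move=> hf hg i j.
have h : S (fun x => \sum_y f x i y * g x y j).
  by apply: fc_sum => y _; exact: (fc_mul SC).
by apply: (fc_ext SC _ h) => x _; rewrite mxE.
Qed.

Lemma mc_sub m n m' n' (s : 'I_m' -> 'I_m) (t : 'I_n' -> 'I_n)
    (f : X -> 'M[R]_(m, n)) :
  mx_class S f -> mx_class S (fun x => mxsub s t (f x)).
Proof.
move=> hf i j; apply: (fc_ext SC _ (hf (s i) (t j))) => x _; by rewrite mxE.
Qed.

Lemma mc_col m n p (f : X -> 'M[R]_(m, n)) (g : X -> 'M[R]_(p, n)) :
  mx_class S f -> mx_class S g -> mx_class S (fun x => col_mx (f x) (g x)).
Proof.
move=> hf hg i j; case: (split_ordP i) => y ->.
  by apply: (fc_ext SC _ (hf y j)) => x _; rewrite col_mxEu.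
by apply: (fc_ext SC _ (hg y j)) => x _; rewrite col_mxEd.
Qed.

Lemma fc_det n (f : X -> 'M[R]_n) : mx_class S f -> S (fun x => \det (f x)).
Proof.
move=> hf; apply: fc_sum => s _; apply: (fc_mul SC) => //; first exact: (fc_cst SC).
by apply: fc_prod.
Qed.

Lemma mc_inv n (f : X -> 'M[R]_n) : (forall x, O x -> f x \in unitmx) ->
  mx_class S f -> mx_class S (fun x => invmx (f x)).
Proof.
move=> uf hf i j.
have d : S (fun x => (\det (f x))^-1 * (\adj (f x)) i j).
  apply: (fc_mul SC) => //.
    apply: (fc_inv SC) => //; last exact: fc_det.
    by move=> x Ox; rewrite -unitfE -unitmxE uf.
  have h : S (fun x => (-1) ^+ (j + i) * \det (row' j (col' i (f x)))).
    apply: (fc_mul SC) => //; first exact: (fc_cst SC).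
    apply: fc_det => a b.
    by apply: (fc_ext SC _ (hf (lift j a) (lift i b))) => x _; rewrite !mxE.
  by apply: (fc_ext SC _ h) => x _; rewrite mxE.
by apply: (fc_ext SC _ d) => x Ox; rewrite /invmx uf // [RHS]mxE.
Qed.

End Closure.
End FunctionClass.

Section Continuity.
Variable R : realType.

Definition cont_on (X : topologicalType) (O : set X) : set (X -> R) :=
  [set f | forall x, O x -> {for x, continuous f}].

Lemma open_near_eq (X : topologicalType) (Y : Type) (O : set X) (f g : X -> Y) x :
  open O -> O x -> (forall x, O x -> f x = g x) -> \near x, f x = g x.
Proof. by move=> oO Ox e; near=> y; apply: e; near: y; exact: open_nbhs_nbhs.
Unshelve. all: by end_near. Qed.

Lemma cont_ext (X Y : topologicalType) (O : set X) (f g : X -> Y) :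
  open O -> (forall x, O x -> f x = g x) ->
  (forall x, O x -> {for x, continuous f}) ->
  (forall x, O x -> {for x, continuous g}).
Proof.
move=> oO e h x Ox; have := h x Ox; rewrite /prop_for /continuous_at -e //.
apply: cvg_trans; apply: near_eq_cvg.
by apply: (open_near_eq oO Ox) => y Oy; rewrite e.
Qed.

Lemma cont_class (X : topologicalType) (O : set X) :
  open O -> fun_class O (cont_on O).
Proof.
move=> oO; split.
- by move=> c x _; exact: cvg_cst.
- by move=> f g hf hg x Ox; apply: continuousD; [exact: hf|exact: hg].
- by move=> f g hf hg x Ox; apply: continuousM; [exact: hf|exact: hg].
- by move=> f f0 hf x Ox; apply: continuousV; [exact: f0|exact: hf].
- by move=> f g e hf; exact: (cont_ext oO e).
Qed.

Lemma mx_continuous (X : topologicalType) m n (f : X -> 'M[R]_(m, n)) x :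
  (forall i j, {for x, continuous (fun y => f y i j)}) -> {for x, continuous f}.
Proof.
move=> h A [P hP sA]; apply: (@filterS _ _ _ [set y | forall i j, P i j (f y i j)]).
  by move=> y hy; exact: sA.
apply: filter_forall => i; apply: filter_forall => j.
exact: h.
Qed.

Lemma mx_class_cont (X : topologicalType) (O : set X) m n (f : X -> 'M[R]_(m, n)) :
  mx_class (cont_on O) f -> forall x, O x -> {for x, continuous f}.
Proof. by move=> h x Ox; apply: mx_continuous => i j; exact: h. Qed.

Lemma cont_gt0 (X : topologicalType) (f : X -> R) x :
  {for x, continuous f} -> 0 < f x -> \forall y \near x, 0 < f y.
Proof. by move=> hf fx; exact: (@cvgr_gt _ _ _ _ _ _ hf). Qed.

Lemma cont_lt0 (X : topologicalType) (f : X -> R) x :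
  {for x, continuous f} -> f x < 0 -> \forall y \near x, f y < 0.
Proof. by move=> hf fx; exact: (@cvgr_lt _ _ _ _ _ _ hf). Qed.

Lemma cont_neq0 (X : topologicalType) (f : X -> R) x :
  {for x, continuous f} -> f x != 0 -> \forall y \near x, f y != 0.
Proof.
move=> hf; rewrite neq_lt => /orP[fx|fx].
  by apply: filterS (cont_lt0 hf fx) => y /ltr0_neq0.
by apply: filterS (cont_gt0 hf fx) => y /lt0r_neq0.
Qed.

Lemma mc_id p q (O : set 'M[R]_(p, q)) :
  mx_class (cont_on O) (fun A : 'M[R]_(p, q) => A).
Proof. by move=> i j x _; exact: coord_continuous. Qed.

Lemma open_neq0 (X : topologicalType) (O : set X) (f : X -> R) :
  open O -> cont_on O f -> open (O `&` [set x | f x != 0]).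
Proof.
move=> oO hf; rewrite openE => y [Oy fy]; apply: filterI; first exact: open_nbhs_nbhs.
exact: cont_neq0 (hf y Oy) fy.
Qed.

Lemma open_preim (X Y : topologicalType) (O : set X) (f : X -> Y) (D : set Y) :
  open O -> (forall x, O x -> {for x, continuous f}) -> open D ->
  open (O `&` [set x | D (f x)]).
Proof.
move=> oO hf oD; rewrite openE => y [Oy Dy]; apply: filterI; first exact: open_nbhs_nbhs.
by apply: (hf y Oy); exact: open_nbhs_nbhs.
Qed.

End Continuity.

Section Smooth.
Variable R : realType.

Lemma CkS (E F : normedModType R) d (O : set E) (f : E -> F) :
  Ck_on d.+1 O f -> Ck_on d O f.
Proof.
elim: d f => [|d IH] f [h1 h2]; first by split.
by split=> // v; have [hv hv'] := h2 v; split=> //; exact: IH.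
Qed.

Lemma Ck_cont (E F : normedModType R) d (O : set E) (f : E -> F) :
  Ck_on d O f -> forall x, O x -> {for x, continuous f}.
Proof. by case: d => [[]|d []]. Qed.

Lemma Ck_ext (E F : normedModType R) d (O : set E) (f g : E -> F) :
  open O -> (forall x, O x -> f x = g x) -> Ck_on d O f -> Ck_on d O g.
Proof.
move=> oO; elim: d f g => [|d IH] f g e h.
  by split=> //; apply: (cont_ext oO e); exact: Ck_cont h.
split; first by apply: (cont_ext oO e); exact: Ck_cont h.
move=> v; have [_ /(_ v)[hv hv']] := h; split.
  by move=> x Ox; apply: near_eq_derivable (hv x Ox); exact: (open_near_eq oO Ox e).
by apply: IH hv' => x Ox; apply: near_eq_derive; exact: (open_near_eq oO Ox e).
Qed.

Lemma Ck_cst (E F : normedModType R) d (O : set E) (c : F) :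
  open O -> Ck_on d O (fun=> c).
Proof.
move=> oO; elim: d c => [|d IH] c; first by split=> // x _; exact: cvg_cst.
split=> [x _|v]; first exact: cvg_cst.
split=> [x _|]; first exact: derivable_cst.
by apply: (Ck_ext oO _ (IH 0)) => x _; rewrite derive_cst.
Qed.

Lemma Ck_add (E F : normedModType R) d (O : set E) (f g : E -> F) :
  open O -> Ck_on d O f -> Ck_on d O g -> Ck_on d O (fun x => f x + g x).
Proof.
move=> oO; elim: d f g => [|d IH] f g hf hg.
  split=> // x Ox; apply: (@continuousD _ _ _ f g); [exact: Ck_cont hf _ _|exact: Ck_cont hg _ _].
split.
  by move=> x Ox; apply: (@continuousD _ _ _ f g); [exact: Ck_cont hf _ _|exact: Ck_cont hg _ _].
move=> v; have [_ /(_ v)[df hf']] := hf; have [_ /(_ v)[dg hg']] := hg.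
split=> [x Ox|]; first by apply: derivableD; [exact: df|exact: dg].
apply: (Ck_ext oO _ (IH _ _ hf' hg')) => x Ox.
by rewrite [RHS]deriveD //; [exact: df|exact: dg].
Qed.

Lemma Ck_mul (E : normedModType R) d (O : set E) (f g : E -> R) :
  open O -> Ck_on d O f -> Ck_on d O g -> Ck_on d O (fun x => f x * g x).
Proof.
move=> oO; elim: d f g => [|d IH] f g hf hg.
  split=> // x Ox; apply: (@continuousM _ _ f g); [exact: Ck_cont hf _ _|exact: Ck_cont hg _ _].
split.
  by move=> x Ox; apply: (@continuousM _ _ f g); [exact: Ck_cont hf _ _|exact: Ck_cont hg _ _].
move=> v; have [_ /(_ v)[df hf']] := hf; have [_ /(_ v)[dg hg']] := hg.
split=> [x Ox|]; first by apply: derivableM; [exact: df|exact: dg].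
have h := Ck_add oO (IH _ _ (CkS hf) hg') (IH _ _ (CkS hg) hf').
apply: (Ck_ext oO _ h) => x Ox.
by rewrite [RHS]deriveM //; [exact: df|exact: dg].
Qed.

Lemma Ck_inv (E : normedModType R) d (O : set E) (f : E -> R) :
  open O -> (forall x, O x -> f x != 0) -> Ck_on d O f ->
  Ck_on d O (fun x => (f x)^-1).
Proof.
move=> oO f0; elim: d => [|d IH] hf.
  by split=> // x Ox; apply: (@continuousV _ _ f); [exact: f0|exact: Ck_cont hf _ _].
split.
  by move=> x Ox; apply: (@continuousV _ _ f); [exact: f0|exact: Ck_cont hf _ _].
move=> v; have [_ /(_ v)[df hf']] := hf.
split=> [x Ox|]; first by apply: derivableV; [exact: f0|exact: df].
have h1 := IH (CkS hf).
have h := Ck_mul oO (Ck_mul oO (Ck_cst d (-1 : R) oO) (Ck_mul oO h1 h1)) hf'.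
apply: (Ck_ext oO _ h) => x Ox; rewrite [RHS]deriveV; last 2 first.
- exact: f0.
- exact: df.
by rewrite mulN1r -expr2 exprVn.
Qed.

Lemma smooth_class (E : normedModType R) (O : set E) :
  open O -> fun_class O [set f : E -> R | smooth_on O f].
Proof.
move=> oO; split.
- by move=> c d; exact: Ck_cst.
- by move=> f g hf hg d; exact: Ck_add.
- by move=> f g hf hg d; exact: Ck_mul.
- by move=> f f0 hf d; exact: Ck_inv.
- by move=> f g e hf d; exact: (Ck_ext oO e (hf d)).
Qed.

Lemma Ck_scale (E F : normedModType R) d (O : set E) (f : E -> R) (w : F) :
  open O -> Ck_on d O f -> Ck_on d O (fun x => f x *: w).
Proof.
move=> oO.
have cw (g : E -> R) x : {for x, continuous g} -> {for x, continuous (fun y => g y *: w)}.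
  by move=> h; apply: cvgZr_tmp.
have dw (g : E -> R) x v : derivable g x v ->
    (fun h : R => h^-1 *: ((fun y => g y *: w) (h *: v + x) - (fun y => g y *: w) x)) @ 0^'
      --> 'D_v g x *: w.
  move=> h; under eq_fun do rewrite -scalerBl scalerA.
  by apply: cvgZr_tmp.
elim: d f => [|d IH] f hf.
  by split=> // x Ox; apply: cw; exact: Ck_cont hf _ _.
split; first by move=> x Ox; apply: cw; exact: Ck_cont hf _ _.
move=> v; have [_ /(_ v)[df hf']] := hf.
split=> [x Ox|].
  by apply/cvg_ex; exists ('D_v f x *: w); apply: dw; exact: df.
apply: (Ck_ext oO _ (IH _ hf')) => x Ox; symmetry.
by apply: cvg_lim => //; apply: dw; exact: df.
Qed.

Lemma Ck_linear (E : normedModType R) d (O : set E) (f : E -> R) :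
  open O -> (forall c x y, f (c *: x + y) = c * f x + f y) -> (forall x, {for x, continuous f}) -> Ck_on d O f.
Proof.
move=> oO lf cf.
have dL x v : (fun h : R => h^-1 *: (f (h *: v + x) - f x)) @ 0^' --> f v.
  apply: cvg_near_cst.
  near=> h; rewrite lf addrK -[_ *: _]/(_ * _) mulrA mulVf ?mul1r //.
  by near: h; exact: nbhs_dnbhs_neq.
case: d => [|d]; first by split=> [y _|]; [exact: cf|].
split=> [x _|v]; first exact: cf.
split=> [x _|]; first by apply/cvg_ex; exists (f v); exact: dL.
apply: (Ck_ext oO _ (Ck_cst d (f v) oO)) => x _; symmetry.
by apply: cvg_lim => //; exact: dL.
Unshelve. all: by end_near. Qed.

Lemma smooth_sum (E F : normedModType R) (O : set E) (I : Type) (r : seq I)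
    (P : pred I) (f : I -> E -> F) : open O ->
  (forall i, P i -> smooth_on O (f i)) -> smooth_on O (fun x => \sum_(i <- r | P i) f i x).
Proof.
move=> oO h d; elim: r => [|i r IH].
  by apply: (Ck_ext oO _ (Ck_cst d 0 oO)) => x _; rewrite big_nil.
have [Pi|Pi] := boolP (P i); last first.
  by apply: (Ck_ext oO _ IH) => x _; rewrite big_cons (negbTE Pi).
by apply: (Ck_ext oO _ (Ck_add oO (h _ Pi d) IH)) => x _; rewrite big_cons Pi.
Qed.

End Smooth.

(** * Periodic extension of matrices and the twist as a matrix formula *)

Section Extcol.
Variable R : realType.

Lemma extcolE p n (c : R) (U : 'M[R]_(p, n)) (i : 'I_n) (t : int) :
  extcol c U (1 + (i : nat)%:Z + t * n%:Z) = c ^ t *: col i U.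
Proof.
have n0 : n%:Z != 0 by rewrite eqz_nat -lt0n (leq_ltn_trans _ (ltn_ord i)).
rewrite /extcol (_ : _ - 1 = t * n%:Z + (i : nat)%:Z); last by lia.
have -> : ((t * n%:Z + (i : nat)%:Z) %% n%:Z)%Z = (i : nat)%:Z.
  by rewrite modzMDl modz_small //= ltz_nat ltn_ord.
rewrite divzMDl // divz_small ?ltz_nat ?ltn_ord // addr0 /=.
by rewrite valK.
Qed.

Lemma int_split n (j : int) : (0 < n)%N ->
  exists (i : 'I_n) (t : int), j = 1 + (i : nat)%:Z + t * n%:Z.
Proof.
move=> n0; have nz : n%:Z != 0 by rewrite eqz_nat -lt0n.
have h0 := modz_ge0 (j - 1) nz; have h1 : ((j - 1) %% n%:Z)%Z < n%:Z by rewrite ltz_pmod.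
have hi : (`|((j - 1)%R %% n%:Z)%Z| < n)%N by lia.
exists (Ordinal hi), ((j - 1) %/ n%:Z)%Z => /=.
by have := divz_eq (j - 1) n%:Z; lia.
Qed.

Lemma extcol_nat p n (c : R) (U : 'M[R]_(p, n)) (i : 'I_n) :
  extcol c U (1 + (i : nat)%:Z) = col i U.
Proof. by rewrite -[X in extcol c U X]addr0 -[0](mul0r n%:Z) extcolE expr0z scale1r. Qed.

Lemma extcol_qper p n (c : R) (U : 'M[R]_(p, n)) : (0 < n)%N -> c != 0 ->
  qper n c (extcol c U).
Proof.
move=> n0 c0 j; have [i [t ->]] := int_split j n0.
have -> : 1 + (i : nat)%:Z + t * n%:Z + n%:Z = 1 + (i : nat)%:Z + (t + 1) * n%:Z by lia.
by rewrite !extcolE scalerA exprzDr ?unitfE // expr1z mulrC.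
Qed.

Lemma win_extcol p n (c : R) (U : 'M[R]_(p, n)) : win (extcol c U) 1 n = U.
Proof. by apply/matrixP => i j; rewrite mxE extcol_nat mxE. Qed.

Lemma extcol_win p n (c : R) (A : int -> 'cV[R]_p) : (0 < n)%N -> c != 0 ->
  qper n c A -> extcol c (win A 1 n) =1 A.
Proof.
move=> n0 c0 hA j; have [i [t ->]] := int_split j n0.
rewrite extcolE (qper_int _ _ c0 hA); congr (_ *: _).
by apply/colP => x; rewrite !mxE.
Qed.

Lemma extcolM p q n (c : R) (g : 'M[R]_(q, p)) (U : 'M[R]_(p, n)) j : (0 < n)%N ->
  extcol c (g *m U) j = g *m extcol c U j.
Proof.
move=> n0; have [i [t ->]] := int_split j n0; rewrite !extcolE -scalemxAr.
congr (_ *: _); apply/colP => x; rewrite !mxE; apply: eq_bigr => y _.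
by rewrite !mxE.
Qed.

Lemma win_extcolM p q n (c : R) (g : 'M[R]_(q, p)) (U : 'M[R]_(p, n)) a m :
  (0 < n)%N -> win (extcol c (g *m U)) a m = g *m win (extcol c U) a m.
Proof.
move=> n0; apply/matrixP => i j; rewrite mxE extcolM // !mxE.
by apply: eq_bigr => x _; rewrite !mxE.
Qed.

Lemma uof_extcol k l n (c : R) (U : 'M[R]_(k + l, n)) : (0 < n)%N ->
  uof (extcol c U) =1 extcol c (usubmx U).
Proof.
move=> n0 j; have [i [t ->]] := int_split j n0; rewrite /uof !extcolE.
by apply/colP => x; rewrite !mxE.
Qed.

Lemma dof_extcol k l n (c : R) (U : 'M[R]_(k + l, n)) : (0 < n)%N ->
  dof (extcol c U) =1 extcol c (dsubmx U).
Proof.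
move=> n0 j; have [i [t ->]] := int_split j n0; rewrite /dof !extcolE.
by apply/colP => x; rewrite !mxE.
Qed.

Lemma eq_win k (A B : int -> 'cV[R]_k) a m : A =1 B -> win A a m = win B a m.
Proof. by move=> e; apply/matrixP => i j; rewrite !mxE e. Qed.

Lemma eq_qper n c k (A B : int -> 'cV[R]_k) : A =1 B -> qper n c A -> qper n c B.
Proof. by move=> e h j; rewrite -!e. Qed.

(* The stacked twist map is the case (w0, q, eta) = (-l, 0, (-1)^j), and its
   inverse the case (1 - k, k + l - 1, (-1)^(j+l)). *)
Definition gtwist p n (c : R) (w0 : int) (q : nat) (eta : int -> R)
    (U : 'M[R]_(p, n)) : 'M[R]_(p, n) :=
  \matrix_(i, j) (eta (1 + (j : nat)%:Z) *
    \sum_(x < p) ((x : nat) == q)%:R *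
       (invmx (win (extcol c U) (1 + (j : nat)%:Z + w0) p)) x i).

(** Up to the factor [eta j], [T j] is the element of index [q] of the basis dual to the window of
    [U] starting at [j + w0]. *)
Definition grel p (w0 : int) (q : nat) (eta : int -> R) (U T : int -> 'cV[R]_p) :=
  forall j (x : nat), (x < p)%N ->
    ((T j)^T *m U (j + w0 + x%:Z)) 0 0 = (x == q)%:R * eta j.

(** A shift by one period multiplies the pairing by [c] through [U] and by [c'] through [T], which
    is why [eta] must be multiplied by [c * c']. *)
Lemma gtwist_grel p n c c' w0 q eta (U : 'M[R]_(p, n)) : (0 < n)%N ->
  c != 0 -> c' != 0 ->
  (forall j t, eta (j + t * n%:Z) = (c * c') ^ t * eta j) ->
  (forall a, win (extcol c U) a p \in unitmx) ->
  grel w0 q eta (extcol c U) (extcol c' (gtwist c w0 q eta U)).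
Proof.
move=> n0 c0 c'0 he uU j x xp; have [i [t ->]] := int_split j n0.
rewrite extcolE linearZ /= -scalemxAl mxE.
have -> : 1 + (i : nat)%:Z + t * n%:Z + w0 + x%:Z =
   1 + (i : nat)%:Z + w0 + x%:Z + t * n%:Z by lia.
rewrite (qper_int _ _ c0 (extcol_qper U n0 c0)) -scalemxAr mxE he.
set a := 1 + (i : nat)%:Z; set B := win (extcol c U) (a + w0) p.
have -> : ((col i (gtwist c w0 q eta U))^T *m extcol c U (a + w0 + x%:Z)) 0 0 =
    eta a * (x == q)%:R.
  rewrite mxE.
  under eq_bigr => y _.
    rewrite mxE mxE mxE -/a -/B -mulrA mulr_suml.
    over.
  rewrite -mulr_sumr exchange_big /=; congr (_ * _).
  transitivity (\sum_(z < p) ((z : nat) == q)%:R * (invmx B *m B) z (Ordinal xp)).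
    apply: eq_bigr => z _; rewrite mxE mulr_sumr; apply: eq_bigr => y _.
    by rewrite mulrA [B y _]mxE.
  rewrite mulVmx ?uU // (bigD1 (Ordinal xp)) //= mxE eqxx mulr1 big1 ?addr0 //.
  by move=> z zx; rewrite mxE (negbTE zx) mulr0.
by rewrite expfzMl; lra.
Qed.

Lemma twrel_grel k l (U T : int -> 'cV[R]_(k + l)) :
  twrel U T <-> grel (- l%:Z) 0 (fun j => (-1) ^ j) U T.
Proof.
split=> h j x hx.
  rewrite h; last by lia.
  rewrite (_ : (j - l%:Z + x%:Z == j - l%:Z) = (x == 0%N)); last by apply/eqP/eqP; lia.
  by case: eqP => _; rewrite ?mul1r ?mul0r.
have xn : (`|(x - (j - l%:Z))%R| < k + l)%N by lia.
have := h j _ xn; rewrite (_ : j - l%:Z + _ = x); last by lia.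
move=> ->; rewrite (_ : (`|(x - (j - l%:Z))%R|%N == 0%N) = (x == j - l%:Z)).
  by case: eqP => _; rewrite ?mul1r ?mul0r.
by apply/eqP/eqP; lia.
Qed.

(** The columns of [T] paired with [U j] start at [j + 1 - k] and end at [j + l], index [(k + l).-1]
    of the window. Only the last pairing is nonzero, and its value is the sign of the index
    [j + l]. *)
Lemma twrel_grel_inv k l (U T : int -> 'cV[R]_(k + l)) :
  twrel U T <-> grel (1 - k%:Z) (k + l).-1 (fun j => (-1) ^ (j + l%:Z)) T U.
Proof.
split=> h j x hx.
  rewrite inner_sym h; last by lia.
  rewrite (_ : (j == _) = (x == (k + l).-1)); last by apply/eqP/eqP; lia.
  case: eqP => xk; rewrite ?mul1r ?mul0r //; congr (_ ^ _); lia.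
have xn : (`|(j - (x + 1 - k%:Z))%R| < k + l)%N by lia.
have := h x _ xn; rewrite (_ : x + (1 - k%:Z) + _ = j); last by lia.
rewrite inner_sym => ->.
rewrite (_ : (`|(j - (x + 1 - k%:Z))%R|%N == (k + l).-1) = (x == j - l%:Z)).
  by case: eqP => [->|_]; rewrite ?mul1r ?mul0r ?subrK.
by apply/eqP/eqP; lia.
Qed.

Lemma sgn_int k : (-1) ^ (k%:Z - 1) = (-1) ^+ k.+1 :> R.
Proof.
rewrite exprzDr ?unitrN1 // sgzN exprS -exprnP [X in _ * X]/=.
by rewrite expr1z mulrC.
Qed.

Lemma sgz_mul_int (n : nat) (t : int) : (-1) ^ (t * n%:Z) = ((-1) ^+ n) ^ t :> R.
Proof. by rewrite mulrC -exprz_exp. Qed.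

End Extcol.

(** * Density and connectedness of total positivity *)

Section Moves.
Variable R : realType.

Definition minors_ge0 k n (A : 'M[R]_(k, n)) :=
  forall s : 'I_k -> 'I_n, incr s -> 0 <= \det (colsub s A).

Definition minors_gt0 k n (A : 'M[R]_(k, n)) :=
  forall s : 'I_k -> 'I_n, incr s -> 0 < \det (colsub s A).

Definition adjacent n (i j : 'I_n) := (i.+1 == j :> nat) || (j.+1 == i :> nat).

Definition upd k n (s : 'I_k -> 'I_n) (p : 'I_k) (i : 'I_n) (x : 'I_k) : 'I_n :=
  if x == p then i else s x.

(** For adjacent [i], [j] and [t >= 0] these are Chevalley generators of the totally nonnegative
    matrices. *)
Definition elem n (i j : 'I_n) (t : R) : 'M[R]_n := 1%:M + t *: delta_mx i j.

Lemma mulmx_elem k n (A : 'M[R]_(k, n)) i j t x y :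
  (A *m elem i j t) x y = A x y + (if y == j then t * A x i else 0).
Proof.
rewrite mulmxDr mulmx1 -scalemxAr !mxE; congr (_ + _).
rewrite (bigD1 i) //= big1 ?addr0 => [|z /negbTE zi].
  by rewrite mxE eqxx /=; case: eqP; rewrite ?mulr1 ?mulr0.
by rewrite mxE zi mulr0.
Qed.

Lemma det_upd k n (A B : 'M[R]_(k, n)) (s : 'I_k -> 'I_n) (p : 'I_k) i (t : R) :
  (forall x y, y != p -> B x (s y) = A x (s y)) ->
  (forall x, B x (s p) = A x (s p) + t * A x i) ->
  \det (colsub s B) = \det (colsub s A) + t * \det (colsub (upd s p i) A).
Proof.
move=> hB hp; rewrite !(expand_det_col _ p) mulr_sumr -big_split /=.
apply: eq_bigr => x _.
have e (C : 'M[R]_k) : (forall x y, y != p -> C x y = A x (s y)) ->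
    cofactor C x p = cofactor (colsub s A) x p.
  move=> h; rewrite /cofactor; congr (_ * \det _); apply/matrixP => a b.
  by rewrite !mxE h // eq_sym neq_lift.
rewrite (e (colsub s B)); last by move=> a b bp; rewrite mxE hB.
rewrite (e (colsub (upd s p i) A)); last first.
  by move=> a b bp; rewrite mxE /upd (negbTE bp).
by move: (cofactor _ _ _) => c; rewrite !mxE hp /upd eqxx; lra.
Qed.

Lemma det_elem k n (A : 'M[R]_(k, n)) (s : 'I_k -> 'I_n) i j t : injective s ->
  (forall p, s p != j) /\ \det (colsub s (A *m elem i j t)) = \det (colsub s A) \/
  exists2 p, s p = j & \det (colsub s (A *m elem i j t)) =
     \det (colsub s A) + t * \det (colsub (upd s p i) A).
Proof.
move=> sI; have [[p /eqP sp]|no] := pselect (exists p, s p == j).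
  right; exists p => //; apply: det_upd => [x y yp|x]; rewrite mulmx_elem.
    by rewrite -sp (inj_eq sI) (negbTE yp) addr0.
  by rewrite sp eqxx.
left; have no' p : s p != j by apply/negP => sp; apply: no; exists p.
split=> //; congr (\det _); apply/matrixP => x y.
by rewrite mxE mulmx_elem (negbTE (no' y)) addr0 mxE.
Qed.

Lemma incr_upd k n (s : 'I_k -> 'I_n) p i : incr s -> adjacent i (s p) ->
  (forall x, s x != i) -> incr (upd s p i).
Proof.
move=> hs ad no x y xy; rewrite /upd.
have nx (z : 'I_k) : s z <> i :> nat by move=> /val_inj/eqP; apply/negP.
case: eqP => [ex|_]; case: eqP => [ey|_] //.
- by move: xy; rewrite ex ey ltnn.
- move: xy; rewrite ex => /hs; have := nx y; move: ad => /orP[]/eqP; lia.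
- move: xy; rewrite ey => /hs; have := nx x; move: ad => /orP[]/eqP; lia.
- exact: hs.
Qed.

Lemma det_upd_mem k n (A : 'M[R]_(k, n)) (s : 'I_k -> 'I_n) p i x :
  s x = i -> s p != i -> \det (colsub (upd s p i) A) = 0.
Proof.
move=> sx sp; apply: det_colsub_ninj; apply/injectivePn.
have xp : x != p by apply: contra_neq sp => <-.
by exists x, p => //; rewrite /upd eqxx (negbTE xp).
Qed.

Lemma adjacent_neq n (i j : 'I_n) : adjacent i j -> j != i.
Proof. by move=> h; apply/eqP => e; move: h; rewrite e /adjacent => /orP[]/eqP; lia. Qed.

(** A minor that uses column [j] grows by [t] times the minor with [i] in its place. Either [i] was
    already selected and that minor is zero, or adjacency keeps the selection increasing and that
    minor is nonnegative. *)
Lemma elem_det_ge k n (A : 'M[R]_(k, n)) s i j t : minors_ge0 A -> incr s ->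
  adjacent i j -> 0 <= t ->
  \det (colsub s A) <= \det (colsub s (A *m elem i j t)).
Proof.
move=> hA hs ad t0; have [[_ ->] //|[p sp ->]] := det_elem A i j t (incr_inj hs).
rewrite lerDl mulr_ge0 //.
have [[x /eqP sx]|no] := pselect (exists x, s x == i).
  by rewrite (det_upd_mem _ sx) // sp adjacent_neq.
apply: hA; apply: incr_upd; rewrite ?sp // => x.
by apply/negP => sx; apply: no; exists x.
Qed.

Lemma elem_ge0 k n (A : 'M[R]_(k, n)) i j t : minors_ge0 A ->
  adjacent i j -> 0 <= t -> minors_ge0 (A *m elem i j t).
Proof.
by move=> hA ad t0 s hs; apply: le_trans (hA _ hs) _; exact: elem_det_ge.
Qed.

Lemma minors_gt0W k n (A : 'M[R]_(k, n)) : minors_gt0 A -> minors_ge0 A.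
Proof. by move=> h s hs; exact/ltW/h. Qed.

Lemma elem_gt0 k n (A : 'M[R]_(k, n)) i j t : minors_gt0 A ->
  adjacent i j -> 0 <= t -> minors_gt0 (A *m elem i j t).
Proof.
move=> hA ad t0 s hs; apply: lt_le_trans (hA _ hs) _.
by apply: elem_det_ge => //; exact: minors_gt0W.
Qed.

Lemma incr_ge k n (s : 'I_k -> 'I_n) (p : 'I_k) : incr s -> (p <= s p)%N.
Proof.
move=> hs; case: p => p; elim: p => [|p IH] hp //=.
have hp' := ltnW hp; apply: leq_ltn_trans (IH hp') _.
exact: hs.
Qed.

(** The first displaced index is lowered by one; by minimality its new value is not yet selected.
    Repeating this connects every increasing selection to the initial one. *)
Lemma incr_dec k n (s : 'I_k -> 'I_n) : incr s ->
  ~ (forall p, s p = p :> nat) ->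
  exists p i, [/\ adjacent (s p) i, i.+1 = s p, incr (upd s p i) &
     (\sum_x (upd s p i x : nat) < \sum_x (s x : nat))%N].
Proof.
move=> hs hne; have [p0 sp0] : exists p, s p != p :> nat.
  apply: contrapT => no; apply: hne => p; apply/eqP; apply: contrapT => /negP h.
  by apply: no; exists p.
pose p := [arg min_(p < p0 | s p != p :> nat) (p : nat)].
have [sp pmin] : s p != p :> nat /\ forall x, s x != x :> nat -> (p <= x)%N.
  by rewrite /p; case: arg_minnP.
have psp : (p < s p)%N by rewrite ltn_neqAle eq_sym sp incr_ge.
have hi : ((s p).-1 < n)%N by have := ltn_ord (s p); lia.
have ei : (Ordinal hi).+1 = s p by rewrite /=; lia.
have ad : adjacent (Ordinal hi) (s p) by rewrite /adjacent ei eqxx.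
exists p, (Ordinal hi); split=> //.
- by rewrite /adjacent ei eqxx orbT.
- apply: incr_upd => // x; apply/eqP => sx.
  have sxp : (s x < s p)%N by rewrite -ei sx.
  have xp : (x < p)%N.
    by rewrite ltnNge leq_eqVlt; apply/negP => /orP[/eqP/val_inj e|/hs]; [move: sxp; rewrite e|]; lia.
  have := pmin x; case: eqP => [e _|_ /(_ isT)]; last by lia.
  by have := congr1 val sx; rewrite /=; lia.
- rewrite (bigD1 p) //= [X in (_ < X)%N](bigD1 p) //= {1}/upd eqxx.
  rewrite -addSn ei leq_add2l; apply: eq_leq; apply: eq_bigr => x xp.
  by rewrite /upd (negbTE xp).
Qed.

(** Otherwise nonvanishing would pass along every move in both directions. Moves connect all
    increasing selections through the initial one, so the minors of [s0] and [s1] would vanish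
    together. *)
Lemma exists_move k n (A : 'M[R]_(k, n)) (s0 s1 : 'I_k -> 'I_n) :
  incr s0 -> incr s1 -> \det (colsub s0 A) != 0 -> \det (colsub s1 A) = 0 ->
  exists (s : 'I_k -> 'I_n) p i, [/\ incr s, \det (colsub s A) = 0,
    adjacent i (s p), incr (upd s p i) & \det (colsub (upd s p i) A) != 0].
Proof.
move=> h0 h1 d0 d1; apply: contrapT => none.
have closed (s : 'I_k -> 'I_n) p i : incr s -> adjacent i (s p) ->
    incr (upd s p i) -> \det (colsub (upd s p i) A) != 0 -> \det (colsub s A) != 0.
  move=> hs ad hu du; apply/eqP => ds; apply: none.
  by exists s, p, i; split.
have adC (i j : 'I_n) : adjacent i j = adjacent j i by rewrite /adjacent orbC.
have updK (s : 'I_k -> 'I_n) p i : upd (upd s p i) p (s p) =1 s.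
  by move=> x; rewrite /upd; case: eqP => // ->.
have base N (s : 'I_k -> 'I_n) : (\sum_x (s x : nat) <= N)%N -> incr s ->
    exists2 c : 'I_k -> 'I_n, (forall p, c p = p :> nat) &
      (\det (colsub s A) != 0 <-> \det (colsub c A) != 0).
  elim: N s => [|N IH] s sN hs.
    exists s => // p; apply/eqP; rewrite eqn_leq incr_ge // andbT.
    have : (s p <= 0)%N; last by lia.
    by apply: leq_trans sN; rewrite (bigD1 p) //= leq_addr.
  have [e|ne] := pselect (forall p, s p = p :> nat); first by exists s.
  have [p [i [ad ei hu su]]] := incr_dec hs ne.
  have [|c hc dc] := IH (upd s p i) _ hu; first by lia.
  exists c => //; rewrite -dc; split=> d.
    apply: (closed _ p (s p) hu).
    - by rewrite [X in adjacent _ X]/upd eqxx.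
    - by move=> x y xy; rewrite !updK; exact: hs.
    - by rewrite (eq_colsub _ (updK s p i)).
  by apply: (closed s p i hs _ hu d); rewrite adC.
have [c hc dc] := base _ _ (leqnn _) h0.
have [c' hc' dc'] := base _ _ (leqnn _) h1.
have cc : c =1 c' by move=> x; apply: val_inj; rewrite /= hc hc'.
by move: d0; rewrite dc (eq_colsub _ cc) -dc' d1 eqxx.
Qed.

(** Products are kept as lists of factors, so that a path from [A] to [A *m G] can be drawn one
    factor at a time. *)
Inductive elem_prod n : 'M[R]_n -> Prop :=
| ElemProd1 : elem_prod 1%:M
| ElemProdM i j t G : adjacent i j -> 0 <= t -> elem_prod G ->
    elem_prod (elem i j t *m G).

Lemma elem_prod_gt0 k n (A : 'M[R]_(k, n)) G : minors_gt0 A -> elem_prod G ->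
  minors_gt0 (A *m G).
Proof.
move=> hA hG; elim: hG A hA => [|i j t {}G ad t0 _ IH] A hA; first by rewrite mulmx1.
by rewrite mulmxA; apply: IH; exact: elem_gt0.
Qed.

Lemma affine_continuous k n (A B : 'M[R]_(k, n)) (t : R) :
  {for t, continuous (fun t : R => A + t *: B)}.
Proof.
apply: mx_continuous => i j.
have h : {for t, continuous (fun t : R => A i j + t * B i j)}.
  apply: continuousD; first exact: cvg_cst.
  apply: continuousM; [exact: cvg_id | exact: cvg_cst].
rewrite (_ : (fun y => _) = (fun t : R => A i j + t * B i j)) //.
by apply/funext => y; rewrite !mxE.
Qed.

Lemma mulmx_elemE k n (A : 'M[R]_(k, n)) i j t :
  A *m elem i j t = A + t *: (A *m delta_mx i j).
Proof. by rewrite /elem mulmxDr mulmx1 scalemxAr. Qed.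

(** Induction on the number of vanishing minors: [exists_move] finds a vanishing minor next to a
    nonvanishing one, and the corresponding elementary factor with small [t > 0] makes it positive.
    By monotonicity no other minor becomes zero. *)
Lemma minors_gt0_dense k n (A : 'M[R]_(k, n)) (O : set 'M[R]_(k, n)) :
  minors_ge0 A -> (exists2 s, incr s & 0 < \det (colsub s A)) ->
  open O -> O A ->
  exists2 G, elem_prod G & minors_gt0 (A *m G) /\ O (A *m G).
Proof.
move=> hA hs0 oO OA.
pose Z (B : 'M[R]_(k, n)) : {set {ffun 'I_k -> 'I_n}} :=
  [set s : {ffun 'I_k -> 'I_n} | `[< incr s >] && (\det (colsub s B) == 0)]%SET.
have [N] := ubnP #|Z A|; elim: N A hA hs0 OA => // N IH A hA [s0 hs0 ds0] OA ZN.
have [all|[s1 [hs1 ds1]]] : minors_gt0 A \/ exists s1, incr s1 /\ \det (colsub s1 A) = 0.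
  have [|no] := pselect (exists s1, incr s1 /\ \det (colsub s1 A) = 0); first by right.
  left=> s hs; rewrite lt_def hA // andbT; apply/eqP => d.
  by apply: no; exists s.
  by exists 1%:M; [exact: ElemProd1 | rewrite mulmx1].
have [s [p [i [hs ds ad hu du]]]] := exists_move hs0 hs1 (lt0r_neq0 ds0) ds1.
have nearO : \forall t \near (0 : R), O (A *m elem i (s p) t).
  have h : \forall t \near (0 : R), O (A + t *: (A *m delta_mx i (s p))).
    apply: (@affine_continuous _ _ A (A *m delta_mx i (s p)) 0 O).
    by rewrite /= scale0r addr0; exact: open_nbhs_nbhs.
  by apply: filterS h => t; rewrite mulmx_elemE.
move/nbhs_ballP: nearO => [e /= e0 he].
pose t := e / 2; have t0 : 0 < t by rewrite divr_gt0.
have Ot : O (A *m elem i (s p) t).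
  by apply: he; rewrite /ball /= sub0r normrN gtr0_norm // /t; lra.
have hA' := elem_ge0 hA ad (ltW t0).
have [||G hG [gG OG]] := IH (A *m elem i (s p) t) hA' _ Ot.
- exists s0 => //; apply: lt_le_trans ds0 _; apply: elem_det_ge => //; exact: ltW.
- rewrite -ltnS; apply: leq_trans ZN; rewrite ltnS; apply: proper_card.
  apply/fintype.properP; split.
    apply/fintype.subsetP => u; rewrite !inE => /andP[/asboolP hu' /eqP d0].
    rewrite asboolT //= eq_le hA // andbT -d0 elem_det_ge //; exact: ltW.
  exists [ffun x => s x]; rewrite !inE.
    rewrite asboolT /=; last by move=> x y xy; rewrite !ffunE; exact: hs.
    by rewrite -ds; apply/eqP; congr (\det _); apply/matrixP => x y; rewrite !mxE ffunE.
  apply/negP => /andP[_ /eqP].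
  rewrite (_ : colsub _ _ = colsub s (A *m elem i (s p) t)); last first.
    by apply/matrixP => x y; rewrite [LHS]mxE [RHS]mxE ffunE.
  have [[no _]|[p' sp' ->]] := det_elem A i (s p) t (incr_inj hs).
    by have := no p; rewrite eqxx.
  have -> : p' = p by exact: (incr_inj hs).
  rewrite ds add0r => /eqP; rewrite mulf_eq0 (negbTE du) orbF => /eqP t00.
  by move: t0; rewrite t00 ltxx.
exists (elem i (s p) t *m G); last by rewrite mulmxA.
by apply: ElemProdM => //; exact: ltW.
Qed.

Lemma path_const (X : topologicalType) (D Q : set X) (g : R -> X) a b :
  (forall x, D x -> \forall y \near x, D y -> (Q y <-> Q x)) ->
  (forall t, {for t, continuous g}) -> a <= b ->
  (forall t, a <= t <= b -> D (g t)) -> Q (g a) <-> Q (g b).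
Proof.
move=> loc cg ab Dg.
have locg t : a <= t <= b -> \forall u \near t, a <= u <= b -> (Q (g u) <-> Q (g t)).
  move=> tab.
  have h : \forall u \near t, D (g u) -> (Q (g u) <-> Q (g t)).
    exact: (cg t _ (loc _ (Dg t tab))).
  by apply: filterS h => u hu uab; exact: hu (Dg u uab).
pose B := [set t | a <= t <= b /\ (Q (g t) <-> Q (g a))].
have itvE t : (`[a, b]%classic) t <-> a <= t <= b by rewrite /= in_itv.
suff e : B = (`[a, b]%classic).
  have : (`[a, b]%classic) b by rewrite /= in_itv /= ab lexx.
  by rewrite -e => -[_ h]; split=> ?; apply/h.
apply: (@segment_connected R a b).
- by exists a; split; rewrite ?lexx.
- exists (interior [set t | a <= t <= b -> (Q (g t) <-> Q (g a))]); first exact: open_interior.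
  apply/seteqP; split=> t.
    move=> [tab ht]; split; first exact/itvE.
    by apply: filterS (locg t tab) => u hu uab; rewrite hu.
  by move=> [/itvE tab ti]; split=> //; exact: (nbhs_singleton ti).
- exists (~` (interior [set t | a <= t <= b -> ~ (Q (g t) <-> Q (g a))])).
    by apply: open_closedC; exact: open_interior.
  apply/seteqP; split=> t.
    move=> [tab ht]; split; first exact/itvE.
    by move=> ti; exact: (nbhs_singleton ti tab).
  move=> [/itvE tab ti]; split=> //; apply: contrapT => h; apply: ti.
  by apply: filterS (locg t tab) => u hu uab; rewrite hu.
Qed.

Lemma minors_gt0_mull k n (g : 'M[R]_k) (A : 'M[R]_(k, n)) :
  0 < \det g -> minors_gt0 A -> minors_gt0 (g *m A).
Proof. by move=> hg hA s hs; rewrite det_colsub_mull mulr_gt0 // hA. Qed.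

(** Every point is joined to [C *m G], where [C] is the identity followed by zero columns and [G]
    makes it totally positive. Up to an invertible factor [A] is [g 1], where [g t] scales the last
    [q] columns by [t]. First [g 1] is joined to [g 1 *m G] through the factors of [G], then [t]
    goes down to 0; the factor [G] keeps the end of this path positive although [C] need not be. *)
Lemma minors_gt0_connected k q (Q : set 'M[R]_(k, k + q)) :
  (forall A, minors_gt0 A -> \forall B \near A, minors_gt0 B -> (Q B <-> Q A)) ->
  (forall (g : 'M_k) A, g \in unitmx -> Q (g *m A) <-> Q A) ->
  forall A B, minors_gt0 A -> minors_gt0 B -> Q A <-> Q B.
Proof.
move=> loc inv.
pose C : 'M[R]_(k, k + q) := row_mx 1%:M 0.
have C0 : minors_ge0 C.
  move=> s hs; have [sid|/existsNP[p sp]] := pselect (forall p, s p = p :> nat).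
    rewrite (_ : colsub s C = 1%:M) ?det1 //; apply/matrixP => i j; rewrite !mxE.
    have -> : s j = lshift q j by apply: val_inj; rewrite /= sid.
    by rewrite (unsplitK (inl _)) mxE.
  (* Otherwise [s] takes values in the first [k] indices, and [incr_ge] for [s] and for its reversal
     forces [s p = p]. *)
  have [x kx] : exists x, (k <= s x)%N.
    apply: contrapT => /forallNP no; apply: sp.
    have sk x : (s x < k)%N by rewrite ltnNge; apply/negP/no.
    pose t x := rev_ord (Ordinal (sk (rev_ord x))).
    have ht : incr t.
      move=> i j ij; have := hs (rev_ord j) (rev_ord i).
      have := sk (rev_ord i); have := sk (rev_ord j); have := ltn_ord j.
      by rewrite /= => ? ? ? /(_ ltac:(lia)); lia.
    have := incr_ge (rev_ord p) ht; rewrite /t rev_ordK /=.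
    by have := incr_ge p hs; have := sk p; have := ltn_ord p; lia.
  rewrite (expand_det_col _ x) big1 // => i _; rewrite !mxE.
  case: (split_ordP (s x)) kx => y -> /=; last by rewrite mxE mul0r.
  by rewrite leqNgt ltn_ord.
have [G hG [GC _]] : exists2 G, elem_prod G & minors_gt0 (C *m G) /\ setT (C *m G).
  apply: minors_gt0_dense => //; last exact: openT.
  exists (lshift q) => //; rewrite (_ : colsub _ _ = 1%:M) ?det1 //.
  by apply/matrixP => i j; rewrite !mxE (unsplitK (inl _)) mxE.
have loc' A' : minors_gt0 A' -> \forall B \near A', minors_gt0 B -> (Q B <-> Q A') by exact: loc.
suff key A : minors_gt0 A -> Q A <-> Q (C *m G).
  by move=> A B hA hB; rewrite (key _ hA) (key _ hB).
have path := path_const loc.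
have Gpath G' B : elem_prod G' -> minors_gt0 B -> Q B <-> Q (B *m G').
  move=> hG'; elim: hG' B => [|i j t {}G' ad t0 _ IH] B hB; first by rewrite mulmx1.
  rewrite mulmxA -IH; last exact: elem_gt0.
  have := path (fun u => B + u *: (B *m delta_mx i j)) 0 t
    (fun u => @affine_continuous _ _ _ _ u) t0.
  rewrite scale0r addr0 -mulmx_elemE; apply=> u /andP[u0 _].
  by rewrite -mulmx_elemE; exact: elem_gt0.
move=> hA; have hl : incr (lshift q : 'I_k -> 'I_(k + q)) by [].
pose A1 := lsubmx A; have A1s : colsub (lshift q) A = A1.
  by apply/matrixP => i j; rewrite !mxE.
have dA1 : 0 < \det A1 by rewrite -A1s hA.
have uA1 : A1 \in unitmx by rewrite unitmxE unitfE gt_eqF.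
pose X := invmx A1 *m rsubmx A.
pose g (t : R) : 'M[R]_(k, k + q) := C + t *: row_mx 0 X.
have gE t : g t = row_mx 1%:M (t *: X).
  by rewrite /g scale_row_mx scaler0 add_row_mx add0r addr0.
have A1g : A = A1 *m g 1.
  by rewrite gE scale1r mul_mx_row mulmx1 mulKVmx // hsubmxK.
have g1 : minors_gt0 (g 1).
  rewrite -[g 1](mulKmx uA1) -A1g; apply: minors_gt0_mull => //.
  by rewrite det_inv invr_gt0.
have gt t : 0 < t -> minors_gt0 (g t).
  move=> t0 s hs; pose d : 'rV[R]_(k + q) := row_mx (const_mx 1) (const_mx t).
  have -> : colsub s (g t) = colsub s (g 1) *m diag_mx (\row_j d 0 (s j)).
    rewrite mul_mx_diag !gE scale1r; apply/matrixP => i j; rewrite !mxE.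
    by case: (fintype.split (s j)) => x; rewrite !mxE ?mulr1 // mulrC.
  rewrite det_mulmx det_diag mulr_gt0 ?g1 //; apply: prodr_gt0 => j _.
  by rewrite !mxE; case: (fintype.split (s j)) => x; rewrite mxE.
rewrite A1g inv // (Gpath G) //.
have cgG (t : R) : {for t, continuous (fun t => g t *m G)}.
  rewrite (_ : (fun t => _) = (fun t => C *m G + t *: (row_mx 0 X *m G))).
    exact: affine_continuous.
  by apply/funext => u; rewrite /g mulmxDl scalemxAl.
have near0 : \forall t \near (0 : R), minors_gt0 (g t *m G) -> (Q (g t *m G) <-> Q (C *m G)).
  have e0 : g 0 *m G = C *m G by rewrite /g scale0r addr0.
  have := cgG 0 (fun B => minors_gt0 B -> (Q B <-> Q (C *m G))); apply.
  by rewrite e0; exact: loc.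
move/nbhs_ballP: near0 => [e /= e0 he].
pose t := Num.min (e / 2) 1; have t0 : 0 < t by rewrite lt_min divr_gt0 //= ltr01.
have Gt u : 0 < u -> minors_gt0 (g u *m G) by move=> u0; apply: elem_prod_gt0 => //; exact: gt.
have <- : Q (g t *m G) <-> Q (C *m G).
  apply: he; last exact: Gt.
  rewrite /ball /= sub0r normrN gtr0_norm //.
  by rewrite gt_min; apply/orP; left; lra.
symmetry; apply: (path (fun u => g u *m G) t 1 cgG).
  by rewrite ge_min lexx orbT.
by move=> u /andP[tu _]; apply: Gt; exact: lt_le_trans tu.
Qed.

End Moves.

(** * The cyclically symmetric point *)

Section BasePoint.
Variable R : realType.

(** The Gram matrix [P] of a period satisfies [A *m P *m A^T = P], so [P *m X j] obeys the recursion
    of [V]. As [V 0] is a cyclic vector for [A], the value at 0 is [Q *m V 0] with [Q] a polynomial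
    in [A]. Since [Q] commutes with [A], [P *m X j = Q *m V j] for all [j], and total positivity
    passes from [V] to [X] through invertible matrices. *)
Lemma tpos_cyclic_dual k n (V X : int -> 'cV[R]_k) (A : 'M[R]_k) (c : R) :
  (0 < n)%N -> (k <= n)%N -> c ^+ 2 = 1 -> qper n c V -> (forall b, tpos (win V b n)) ->
  (forall j, V (j + 1) = A *m V j) -> (forall j, X j = A^T *m X (j + 1)) ->
  win X 0 k \in unitmx -> forall a, tpos (win X a n).
Proof.
case: k => [|k] in V X A *; first by move=> *; move=> s s' _ _; rewrite !det_mx00 mulr1.
move=> n0 kn c1 hV tV hA hX uX.
have uV b : win V b k.+1 \in unitmx by exact: tpos_win_unit (tV b).
pose P := win V 0 n *m (win V 0 n)^T.
have uP : P \in unitmx by apply: row_free_gram; exact: tpos_row_free.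
have Psum b : win V b n *m (win V b n)^T = \sum_(j < n) V (b + (j : nat)%:Z) *m (V (b + (j : nat)%:Z))^T.
  apply/matrixP => i i'; rewrite mxE summxE; apply: eq_bigr => j _.
  by rewrite !mxE big_ord1 !mxE.
(* A shift by one step replaces the summand at 0 by the summand at [n], and these agree because
   [c ^+ 2 = 1]. *)
have APA : A *m P *m A^T = P.
  have -> : A *m P *m A^T = win V 1 n *m (win V 1 n)^T.
    have -> : win V 1 n = A *m win V 0 n.
      apply/matrixP => i j; rewrite [LHS]mxE addrC hA !mxE.
      by apply: eq_bigr => x _; rewrite !mxE add0r.
    by rewrite trmx_mul !mulmxA.
  pose f j := V j *m (V j)^T.
  have fn : f n%:Z = f 0.
    rewrite /f -[n%:Z]add0r hV linearZ /= -scalemxAl -scalemxAr scalerA -expr2 c1.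
    by rewrite scale1r.
  rewrite /P !Psum; apply: (@addIr _ (f 0)).
  transitivity (\sum_(j < n.+1) f (j : nat)%:Z).
    rewrite big_ord_recl addrC; apply: (congr1 (fun z => f 0 + z)).
    apply: eq_bigr => i _.
    by rewrite -[RHS]/(f (1 + i)%N%:Z) /f PoszD.
  rewrite big_ord_recr /= fn; apply: (congr1 (fun z => z + f 0)).
  apply: eq_bigr => i _.
  by rewrite add0r.
clearbody P.
have uA : A \in unitmx.
  have : A *m win V 0 k.+1 \in unitmx.
    rewrite (_ : _ *m _ = win V 1 k.+1) //; apply/matrixP => i j.
    rewrite [RHS]mxE [1 + _]addrC hA !mxE.
    by apply: eq_bigr => x _; rewrite !mxE add0r.
  by rewrite unitmx_mul => /andP[].
pose Y j := P *m X j.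
have hY j : Y (j + 1) = A *m Y j.
  by rewrite /Y (hX j) !mulmxA APA.
pose v := invmx (win V 0 k.+1) *m Y 0.
pose Q : 'M[R]_k.+1 := \sum_i v i 0 *: A ^+ i.
have VA (i : nat) j : V (j + i%:Z) = A ^+ i *m V j.
  elim: i => [|i IH]; first by rewrite addr0 expr0 mul1mx.
  by rewrite intS addrA addrAC hA IH exprS mulmxA.
have QA : Q *m A = A *m Q.
  rewrite mulmx_suml mulmx_sumr; apply: eq_bigr => i _.
  by rewrite -scalemxAl -scalemxAr; congr (_ *: _); rewrite -[LHS]exprSr -[RHS]exprS.
have Y0 : Y 0 = Q *m V 0.
  rewrite -[Y 0](mulKVmx (uV 0)) -/v win_mulmx mulmx_suml; apply: eq_bigr => i _.
  by rewrite -scalemxAl VA.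
have YQ j : Y j = Q *m V j.
  have pos (i : nat) : Y i%:Z = Q *m V i%:Z.
    elim: i => // i IH.
    have -> : i.+1%:Z = i%:Z + 1 by lia.
    by rewrite hY hA IH !mulmxA QA.
  have neg (i : nat) : Y (- i%:Z) = Q *m V (- i%:Z).
    elim: i => // i IH; rewrite -[LHS](mulKmx uA) -[RHS](mulKmx uA); congr (_ *m _).
    have e : - i.+1%:Z + 1 = - i%:Z by lia.
    by rewrite -hY mulmxA -QA -mulmxA -hA e.
  by case: (intP j) => [|i|i]; [exact: (pos 0%N) | exact: pos | exact: neg].
have winY a m : win Y a m = Q *m win V a m.
  apply/matrixP => i j; rewrite [LHS]mxE YQ !mxE; apply: eq_bigr => x _.
  by rewrite mxE.
have winX a m : win Y a m = P *m win X a m.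
  by apply/matrixP => i j; rewrite !mxE; apply: eq_bigr => x _; rewrite mxE.
have uQ : Q \in unitmx.
  have : Q *m win V 0 k.+1 \in unitmx by rewrite -winY winX unitmx_mul uP.
  by rewrite unitmx_mul => /andP[].
move=> a; rewrite -[win X a n](mulKmx uP) -winX winY.
by apply: tpos_mull; [rewrite unitmx_inv | apply: tpos_mull].
Qed.

(* Moment curve of homogeneous polynomials of degree [k - 1]. *)
Definition hcurve k (c s : R) : 'cV[R]_k := \col_(a < k) (c ^+ (k.-1 - a) * s ^+ a).

(** The matrix of a plane rotation and scaling on homogeneous polynomials of degree [k - 1]. The
    condition [c != 0] permits the substitution [t = s / c], so that its entries are coefficients of
    polynomials in one variable. *)
Lemma hcurve_rot k (u v : R) : exists A : 'M[R]_k, forall c s, c != 0 ->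
  hcurve k (u * c - v * s) (v * c + u * s) = A *m hcurve k c s.
Proof.
pose P (a : nat) : {poly R} := (u%:P - v *: 'X) ^+ (k.-1 - a) * (v%:P + u *: 'X) ^+ a.
exists (\matrix_(a, b) (P a)`_b) => c s c0; apply/colP => a; rewrite !mxE.
pose t := s / c; have st : s = c * t by rewrite /t mulrCA divff // mulr1.
clearbody t.
have ak : (k.-1 - a + a)%N = k.-1 by have := ltn_ord a; lia.
transitivity (c ^+ k.-1 * (P a).[t]).
  rewrite /P hornerM !horner_exp !(hornerD, hornerN, hornerZ, hornerC, hornerX) st.
  have -> : u * c - v * (c * t) = c * (u - v * t) by lra.
  have -> : v * c + u * (c * t) = c * (v + u * t) by lra.
  have cE : c ^+ k.-1 = c ^+ (k.-1 - a) * c ^+ a by rewrite -exprD ak.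
  by rewrite !exprMn cE; lra.
have sP : (size (P a) <= k)%N.
  have s1 (x y : R) : (size (x%:P + y *: 'X)%R <= 2)%N.
    rewrite (leq_trans (size_polyD _ _)) // geq_max (leq_trans (size_polyC_leq1 _)) //=.
    by rewrite (leq_trans (size_scale_leq _ _)) // size_polyX.
  have s2 (p : {poly R}) m : (size p <= 2)%N -> (size (p ^+ m)%R <= m.+1)%N.
    move=> sp; apply: leq_trans (size_poly_exp_leq _ _) _; rewrite ltnS.
    by case: (size p) sp => [|[|[|]]] //= _; rewrite ?mul0n ?mul1n.
  apply: leq_trans (size_polyMleq _ _) _.
  have h1 := s2 _ (k.-1 - a)%N (s1 u (- v)); have h2 := s2 _ a (s1 v u).
  have gen (x y p q : nat) : (x <= p)%N -> (y <= q)%N -> ((x + y).-1 <= (p + q).-1)%N by lia.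
  rewrite scaleNr in h1; apply: leq_trans (gen _ _ _ _ h1 h2) _.
  by have := ltn_ord a; lia.
rewrite (horner_coef_wide _ sP) mulr_sumr; apply: eq_bigr => b _; rewrite !mxE.
have bk : (k.-1 - b + b)%N = k.-1 by have := ltn_ord b; lia.
have cE : c ^+ k.-1 = c ^+ (k.-1 - b) * c ^+ b by rewrite -exprD bk.
by rewrite st exprMn cE mulrCA -!mulrA.
Qed.

(** Dividing each column by a power of the cosine, positive on this interval, leaves a Vandermonde
    determinant in the tangents, which increase with the angle. *)
Lemma det_hcurve_gt0 k (x : 'I_k -> R) :
  (forall j, - (pi / 2) < x j < pi / 2) ->
  (forall i j : 'I_k, (i < j)%N -> x i < x j) ->
  0 < \det (\matrix_(i < k, j < k) hcurve k (cos (x j)) (sin (x j)) i 0).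
Proof.
move=> hx hlt; have c0 j : 0 < cos (x j) by exact: cos_gt0_pihalf.
pose t : 'rV[R]_k := \row_j (sin (x j) / cos (x j)).
rewrite (_ : (\matrix_(i, j) _) = Vandermonde k t *m diag_mx (\row_j (cos (x j)) ^+ k.-1)).
  rewrite det_mulmx det_diag det_Vandermonde mulr_gt0 //.
    apply: prodr_gt0 => i _; apply: prodr_gt0 => j ij; rewrite !mxE subr_gt0.
    rewrite ltr_pdivrMr // mulrAC ltr_pdivlMr // -subr_gt0.
    have : 0 < sin (x j - x i).
      apply: sin_gt0_pi; have := hx i; have := hx j; have := hlt _ _ ij.
      by move=> ? /andP[? ?] /andP[? ?]; apply/andP; split; lra.
    by rewrite sinB; lra.
  by apply: prodr_gt0 => j _; rewrite mxE exprn_gt0.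
rewrite mul_mx_diag; apply/matrixP => i j; rewrite !mxE.
have ik : (k.-1 - i + i)%N = k.-1 by have := ltn_ord i; lia.
have cE : cos (x j) ^+ k.-1 = cos (x j) ^+ (k.-1 - i) * cos (x j) ^+ i by rewrite -exprD ik.
have ci : cos (x j) ^+ i != 0 by rewrite expf_neq0 // gt_eqF.
by rewrite cE expr_div_n mulrCA mulfVK // mulrC.
Qed.

(** The points of the curve at [n] angles spaced by [pi / n]. One step is a fixed rotation, and a
    whole period adds [pi] to the angle, which multiplies a form of degree [k - 1] by
    [(-1) ^+ k.-1], the required quasi-period. *)
Lemma cyclic_point k n : (0 < n)%N ->
  exists (V : int -> 'cV[R]_k) (A : 'M[R]_k),
    [/\ qper n ((-1) ^+ k.+1) V, tpos (win V 1 n) & forall j, V (j + 1) = A *m V j].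
Proof.
move=> n0; pose al : R := pi / n%:R; have nR : (0 : R) < n%:R by rewrite ltr0n.
pose x (j : nat) : R := al * j%:R + (al - pi) / 2.
pose M : 'M[R]_(k, n) := \matrix_(i, j) hcurve k (cos (x j)) (sin (x j)) i 0.
pose V := extcol ((-1) ^+ k.+1) M.
have hV : qper n ((-1) ^+ k.+1) V by apply: extcol_qper; rewrite ?signr_eq0.
have alpi : al * n%:R = pi by rewrite /al divfK // gt_eqF.
have al0 : 0 < al by rewrite divr_gt0 // pi_gt0.
have xP (j : 'I_n) : - (pi / 2) < x j < pi / 2.
  have hj : (j : nat)%:R + 1 <= n%:R :> R by rewrite natr1 ler_nat.
  have h1 : al * ((j : nat)%:R + 1) <= pi by rewrite -alpi ler_wpM2l // ltW.
  have h2 : 0 <= al * (j : nat)%:R by rewrite mulr_ge0 // ltW.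
  by rewrite /x; apply/andP; split; lra.
have [A hA] := hcurve_rot k (cos al) (sin al).
have step (j : 'I_n) : hcurve k (cos (x j.+1)) (sin (x j.+1)) =
    A *m hcurve k (cos (x j)) (sin (x j)).
  have -> : x j.+1 = al + x j by rewrite /x -natr1; lra.
  by rewrite cosD sinD -hA // gt_eqF // cos_gt0_pihalf.
exists V, A; split=> //.
  rewrite win_extcol; apply/tpos_sg => s s' hs hs'.
  suff h (u : 'I_k -> 'I_n) : incr u -> 0 < \det (colsub u M).
    by rewrite !gtr0_sg ?h ?mulr1.
  move=> hu; rewrite (_ : colsub u M = \matrix_(i < k, j < k)
      hcurve k (cos (x (u j))) (sin (x (u j))) i 0).
    apply: det_hcurve_gt0 => // i j /hu uij.
    by rewrite /x ltrD2r ltr_pM2l // ltr_nat.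
  by apply/matrixP => i j; rewrite !mxE.
move=> j; have [i [t ->]] := int_split j n0.
rewrite addrAC !(qper_int _ _ _ hV) ?signr_eq0 // -scalemxAr; congr (_ *: _).
have V1 (y : 'I_n) : V (1 + (y : nat)%:Z) = hcurve k (cos (x y)) (sin (x y)).
  by rewrite /V extcol_nat; apply/colP => a; rewrite !mxE.
rewrite V1 -step; have [yn|yn] := ltnP i.+1 n.
  have -> : 1 + (i : nat)%:Z + 1 = 1 + (Ordinal yn : nat)%:Z by rewrite /=; lia.
  by rewrite V1.
have ei : i.+1 = n by apply/eqP; rewrite eqn_leq yn ltn_ord.
have -> : 1 + (i : nat)%:Z + 1 = 1 + (Ordinal n0 : nat)%:Z + n%:Z by move: ei => /=; lia.
rewrite hV V1 ei.
have -> : x n = x 0%N + pi by rewrite /x alpi mulr0; lra.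
rewrite cosDpi sinDpi; apply/colP => a; rewrite !mxE.
rewrite [(- cos _) ^+ _]exprNn [(- sin _) ^+ _]exprNn.
have ak : (k.-1 - a + a)%N.+2 = k.+1 by have := ltn_ord a; lia.
by rewrite -ak !exprS exprD; lra.
Qed.

End BasePoint.

(** * Regularity and equivariance of the twist formula *)

Section GtwistClass.
Variables (R : realType) (X : Type) (O : set X) (S : set (X -> R)).
Hypothesis SC : fun_class O S.

Lemma mc_win_extcol p n c a m (f : X -> 'M[R]_(p, n)) :
  mx_class S f -> mx_class S (fun x => win (extcol c (f x)) a m).
Proof.
move=> hf i j; rewrite (_ : (fun x => _) = (fun x => extcol c (f x) (a + (j : nat)%:Z) i 0)).
  2: by apply/funext => x; rewrite mxE.
rewrite /extcol; case: insubP => [i' _ _|_].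
  have h := fc_mul SC (fc_cst SC (c ^ ((a + (j : nat)%:Z - 1) %/ n%:Z)%Z)) (hf i i').
  by apply: (fc_ext SC _ h) => x _; rewrite !mxE.
by apply: (fc_ext SC _ (fc_cst SC 0)) => x _; rewrite mxE.
Qed.

Lemma mc_gtwist p n c w0 q eta (f : X -> 'M[R]_(p, n)) :
  (forall x, O x -> forall j : 'I_n,
     win (extcol c (f x)) (1 + (j : nat)%:Z + w0) p \in unitmx) ->
  mx_class S f -> mx_class S (fun x => gtwist c w0 q eta (f x)).
Proof.
move=> uf hf i j.
have hw := mc_inv SC (fun x Ox => uf x Ox j) (@mc_win_extcol p n c (1 + (j : nat)%:Z + w0) p f hf).
have h : S (fun x => eta (1 + (j : nat)%:Z) * \sum_(y < p) ((y : nat) == q)%:R *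
    (invmx (win (extcol c (f x)) (1 + (j : nat)%:Z + w0) p)) y i).
  apply: (fc_mul SC (fc_cst SC _)); apply: (fc_sum SC) => y _.
  exact: (fc_mul SC (fc_cst SC _)).
by apply: (fc_ext SC _ h) => x _; rewrite mxE.
Qed.

Lemma mc_usub k l n (f : X -> 'M[R]_(k + l, n)) :
  mx_class S f -> mx_class S (fun x => usubmx (f x)).
Proof. by move=> hf i j; apply: (fc_ext SC _ (hf (lshift l i) j)) => x _; rewrite mxE. Qed.

Lemma mc_dsub k l n (f : X -> 'M[R]_(k + l, n)) :
  mx_class S f -> mx_class S (fun x => dsubmx (f x)).
Proof. by move=> hf i j; apply: (fc_ext SC _ (hf (rshift k i) j)) => x _; rewrite mxE. Qed.

Lemma mc_alt k n (f : X -> 'M[R]_(k, n)) :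
  mx_class S f -> mx_class S (fun x => alt (f x)).
Proof.
move=> hf i j; apply: (fc_ext SC _ (fc_mul SC (fc_cst SC ((-1) ^+ j)) (hf i j))) => x _.
by rewrite mxE.
Qed.

End GtwistClass.

Lemma invmx_mul (F : fieldType) p (A B : 'M[F]_p) : A \in unitmx -> B \in unitmx ->
  invmx (A *m B) = invmx B *m invmx A.
Proof.
move=> uA uB; have uAB : A *m B \in unitmx by rewrite unitmx_mul uA uB.
rewrite -[RHS]mul1mx -(mulVmx uAB) -!mulmxA (mulmxA B) (mulmxV uB) mul1mx.
by rewrite (mulmxV uA) mulmx1.
Qed.

Section Gtwist.
Variables (R : realType) (p n : nat) (c : R) (w0 : int) (q : nat) (eta : int -> R).
Hypotheses (n0 : (0 < n)%N) (c0 : c != 0).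

(* One period of windows is enough, which makes this an open condition. *)
Definition gdom : set 'M[R]_(p, n) :=
  [set U | forall j : 'I_n, win (extcol c U) (1 + (j : nat)%:Z + w0) p \in unitmx].

Lemma gdom_win U : gdom U -> forall a, win (extcol c U) a p \in unitmx.
Proof.
move=> hU a; have [j [t e]] := int_split (a - w0) n0.
have -> : win (extcol c U) a p = c ^ t *: win (extcol c U) (1 + (j : nat)%:Z + w0) p.
  apply/matrixP => x y; rewrite !mxE.
  have -> : a + (y : nat)%:Z = 1 + (j : nat)%:Z + w0 + (y : nat)%:Z + t * n%:Z by lia.
  by rewrite (qper_int _ _ c0 (extcol_qper U n0 c0)) mxE.
by rewrite unitmxZ ?unitfE ?expfz_neq0.
Qed.

Lemma open_gdom (X : topologicalType) (O : set X) (f : X -> 'M[R]_(p, n)) :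
  open O -> mx_class (cont_on O) f -> open (O `&` [set x | gdom (f x)]).
Proof.
move=> oO hf; have SC := @cont_class R X O oO.
rewrite openE => y [Oy hy]; apply: filterI; first exact: open_nbhs_nbhs.
apply: filter_forall => j.
have hc := fc_det SC (mc_win_extcol SC c (1 + (j : nat)%:Z + w0) (m := p) hf).
have := hy j; rewrite unitmxE unitfE => d0.
by apply: filterS (cont_neq0 (hc y Oy) d0) => z; rewrite unitmxE unitfE.
Qed.

Lemma gtwist_mull (g : 'M[R]_p) U : g \in unitmx -> gdom U ->
  gdom (g *m U) /\
  gtwist c w0 q eta (g *m U) = (invmx g)^T *m gtwist c w0 q eta U.
Proof.
move=> ug hU; split=> [j|]; first by rewrite win_extcolM // unitmx_mul ug hU.
apply/matrixP => i j; rewrite !mxE.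
rewrite win_extcolM // invmx_mul ?hU //.
under [RHS]eq_bigr do rewrite !mxE mulrCA.
rewrite -mulr_sumr; congr (_ * _).
under [RHS]eq_bigr do rewrite mulr_sumr.
rewrite exchange_big /=; apply: eq_bigr => x _; rewrite mxE mulr_sumr.
by apply: eq_bigr => y _; rewrite [RHS]mulrC -mulrA.
Qed.

End Gtwist.

(** A change of both representing matrices is a block diagonal factor, whose inverse transpose is
    again block diagonal. Hence the row spans of the two blocks of the twist depend only on the row
    spans of [A] and [B]. *)
Lemma gtwist_block (R : realType) k l n (c : R) w0 q eta (g : 'M[R]_k) (h : 'M[R]_l)
    (A : 'M[R]_(k, n)) (B : 'M[R]_(l, n)) : (0 < n)%N ->
  g \in unitmx -> h \in unitmx -> gdom c w0 (col_mx A B) ->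
  gdom c w0 (col_mx (g *m A) (h *m B)) /\
  gtwist c w0 q eta (col_mx (g *m A) (h *m B)) =
    col_mx ((invmx g)^T *m usubmx (gtwist c w0 q eta (col_mx A B)))
           ((invmx h)^T *m dsubmx (gtwist c w0 q eta (col_mx A B))).
Proof.
move=> n0 ug uh uU; have ub : block_mx g 0 0 h \in unitmx.
  by rewrite unitmxE det_ublock unitrM -!unitmxE ug.
have -> : col_mx (g *m A) (h *m B) = block_mx g 0 0 h *m col_mx A B.
  by rewrite mul_block_col !mul0mx addr0 add0r.
have [d e] := gtwist_mull q eta n0 ub uU; split=> //.
rewrite [LHS]e -[gtwist _ _ _ _ _ in LHS]vsubmxK.
rewrite invmx_block_diag // tr_block_mx !trmx0 mul_block_col !mul0mx.
by rewrite addr0 add0r.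
Qed.

(** * Normalising signs of minors; open and closed sign conditions *)

Section MinorSigns.
Variable R : realType.

Lemma tpos_minors_gt0 k n (A : 'M[R]_(k, n)) : (k <= n)%N -> tpos A ->
  exists2 g : 'M[R]_k, g \in unitmx & minors_gt0 (g *m A).
Proof.
case: k A => [|k] A kn hA.
  by exists 1%:M => [|s _]; rewrite ?unitmx1 // det_mx00.
have hs0 : incr (widen_ord kn) by [].
have [d0|d0] := ltP 0 (\det (colsub (widen_ord kn) A)).
  exists 1%:M => [|s hs]; first exact: unitmx1.
  by rewrite mul1mx; have := hA _ _ hs hs0; rewrite pmulr_lgt0.
have d1 : \det (colsub (widen_ord kn) A) < 0.
  by rewrite lt_neqAle d0 andbT tpos_neq0.
have dg : \det (diag_mx (\row_(j < k.+1) (if j == ord0 then -1 else 1 : R))) = -1.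
  rewrite det_diag big_ord_recl mxE eqxx big1 ?mulr1 // => i _.
  by rewrite mxE eq_sym (negbTE (neq_lift _ _)).
exists (diag_mx (\row_(j < k.+1) (if j == ord0 then -1 else 1))) => [|s hs].
  by rewrite unitmxE dg unitrN1.
by rewrite det_colsub_mull dg mulN1r oppr_gt0; have := hA _ _ hs hs0; rewrite nmulr_lgt0.
Qed.

Lemma tnn_minors_ge0 k n (A : 'M[R]_(k, n)) : row_free A -> tnn A ->
  exists2 g : 'M[R]_k, g \in unitmx & minors_ge0 (g *m A) /\
    exists2 s : 'I_k -> 'I_n, incr s & 0 < \det (colsub s (g *m A)).
Proof.
move=> /row_free_det_minor[s0 hs0 d0] hA.
case: k A s0 hs0 d0 hA => [|k] A s0 hs0 d0 hA.
  exists 1%:M; first exact: unitmx1.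
  by split=> [s _|]; [rewrite det_mx00 | exists s0; rewrite ?det_mx00].
have [dp|dn] := ltP 0 (\det (colsub s0 A)).
  exists 1%:M; first exact: unitmx1.
  rewrite mul1mx; split; last by exists s0.
  by move=> s hs; have := hA _ _ hs hs0; rewrite pmulr_lge0.
have d1 : \det (colsub s0 A) < 0 by rewrite lt_neqAle d0 dn.
have dg : \det (diag_mx (\row_(j < k.+1) (if j == ord0 then -1 else 1 : R))) = -1.
  rewrite det_diag big_ord_recl mxE eqxx big1 ?mulr1 // => i _.
  by rewrite mxE eq_sym (negbTE (neq_lift _ _)).
exists (diag_mx (\row_(j < k.+1) (if j == ord0 then -1 else 1))).
  by rewrite unitmxE dg unitrN1.
split; last by exists s0 => //; rewrite det_colsub_mull dg mulN1r oppr_gt0.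
move=> s hs; rewrite det_colsub_mull dg mulN1r oppr_ge0.
by have := hA _ _ hs hs0; rewrite nmulr_lge0.
Qed.

Lemma minors_gt0_tpos k n (A : 'M[R]_(k, n)) : minors_gt0 A -> tpos A.
Proof. by move=> h s s' hs hs'; rewrite mulr_gt0 ?h. Qed.

(** The minors of a [tpos] matrix are all positive or all negative. Invariance of [Q] under matrices
    of negative determinant joins these two cases, each of which is connected. *)
Lemma tpos_connected k n (Q : set 'M[R]_(k, n)) : (k <= n)%N ->
  (forall A, tpos A -> \forall B \near A, tpos B -> (Q B <-> Q A)) ->
  (forall (g : 'M_k) A, g \in unitmx -> Q (g *m A) <-> Q A) ->
  forall A B, tpos A -> tpos B -> Q A -> Q B.
Proof.
move=> kn; have := subnKC kn; move: (n - k)%N => q eq; subst n => loc inv A B hA hB QA.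
have [g ug gA] := tpos_minors_gt0 kn hA; have [h uh hB'] := tpos_minors_gt0 kn hB.
apply/(inv h B uh); have := (inv g A ug).2 QA.
apply: (minors_gt0_connected _ inv gA hB').1 => A' hA'.
have h' := loc A' (minors_gt0_tpos hA').
by apply: filterS h' => B' hh hB1; exact: hh (minors_gt0_tpos hB1).
Qed.

Lemma near_tpos (X : topologicalType) (O : set X) k n (M : X -> 'M[R]_(k, n)) x :
  open O -> mx_class (cont_on O) M -> O x -> tpos (M x) ->
  \forall y \near x, tpos (M y).
Proof.
move=> oO hM Ox tM; have SC := @cont_class R X O oO.
(* The selections are taken as finite functions, which form a finite type, so that finitely many
   neighbourhoods are intersected. *)
have h : \forall y \near x, forall s s' : {ffun 'I_k -> 'I_n}, incr s -> incr s' ->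
    0 < \det (colsub s (M y)) * \det (colsub s' (M y)).
  apply: filter_forall => s; apply: filter_forall => s'.
  have [[hs hs']|no] := pselect (incr s /\ incr s'); last first.
    by apply: nearW => y hs hs'; case: no.
  have cf := fc_mul SC (fc_det SC (mc_sub SC id s hM)) (fc_det SC (mc_sub SC id s' hM)).
  by apply: filterS (cont_gt0 (cf x Ox) (tM _ _ hs hs')) => y hy _ _.
apply: filterS h => y hy s s' hs hs'.
have e u : colsub [ffun i => u i] (M y) = colsub u (M y).
  by apply/matrixP => i j; rewrite !mxE ffunE.
have hf u : incr u -> incr ([ffun i => u i] : {ffun 'I_k -> 'I_n}).
  by move=> hu i j ij; rewrite !ffunE hu.
by have := hy _ _ (hf _ hs) (hf _ hs'); rewrite !e.
Qed.

Lemma near_not_tnn (X : topologicalType) (O : set X) k n (M : X -> 'M[R]_(k, n)) x :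
  open O -> mx_class (cont_on O) M -> O x -> ~ tnn (M x) ->
  \forall y \near x, ~ tnn (M y).
Proof.
move=> oO hM Ox tM; have SC := @cont_class R X O oO.
have [s [s' [hs hs' lt0]]] : exists s s', [/\ incr s, incr s' &
    \det (colsub s (M x)) * \det (colsub s' (M x)) < 0].
  apply: contrapT => no; apply: tM => s s' hs hs'; rewrite leNgt; apply/negP => h.
  by apply: no; exists s, s'; split.
have cf := fc_mul SC (fc_det SC (mc_sub SC id s hM)) (fc_det SC (mc_sub SC id s' hM)).
apply: filterS (cont_lt0 (cf x Ox) lt0) => y hy tMy.
by have := tMy _ _ hs hs'; rewrite leNgt hy.
Qed.

End MinorSigns.

(** * Positivity of the twist *)

Section Core.
Variables (R : realType) (k l m n : nat).
Hypotheses (m_even : ~~ odd m) (klm : (k + l + m)%N = n) (n0 : (0 < n)%N).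

Let c : R := (-1) ^+ k.+1.
Let c' : R := (-1) ^+ l.+1.
Let TT (U : 'M[R]_(k + l, n)) := gtwist c (- l%:Z) 0 (fun j => (-1) ^ j) U.

Let c0 : c != 0. Proof. by rewrite /c signr_eq0. Qed.
Let c'0 : c' != 0. Proof. by rewrite /c' signr_eq0. Qed.

Lemma sgn_parity (a b : nat) : odd a = odd b -> (-1) ^+ a = (-1) ^+ b :> R.
Proof. by move=> e; rewrite -signr_odd e signr_odd. Qed.

Let odd_n : odd n = odd k (+) odd l.
Proof. by rewrite -klm !oddD (negbTE m_even) addbF. Qed.

Let cc' : c * c' = (-1) ^+ n.
Proof. by rewrite /c /c' -exprD; apply: sgn_parity; rewrite oddD odd_n /=; case: odd; case: odd. Qed.

Let kln : (k + l <= n)%N. Proof. by rewrite -klm leq_addr. Qed.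

Lemma qper_falt_flip p (A : int -> 'cV[R]_p) : qper n c A -> qper n c' (falt A).
Proof.
move=> /qper_falt h; rewrite (_ : c' = (-1) ^+ (k.+1 + n)) //.
by apply: sgn_parity; rewrite oddD odd_n /=; case: odd; case: odd.
Qed.

Lemma qper_falt_flip' p (A : int -> 'cV[R]_p) : qper n c' A -> qper n c (falt A).
Proof.
move=> /qper_falt h; rewrite (_ : c = (-1) ^+ (l.+1 + n)) //.
by apply: sgn_parity; rewrite oddD odd_n /=; case: odd; case: odd.
Qed.

Lemma qper_sub (U : int -> 'cV[R]_(k + l)) e : qper n e U ->
  qper n e (uof U) /\ qper n e (dof U).
Proof.
by move=> hU; split=> j; rewrite /uof /dof hU linearZ.
Qed.

Definition nondeg (U : int -> 'cV[R]_(k + l)) :=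
  forall a, win U a (k + l) \in unitmx.

Lemma positive_nondeg (U : int -> 'cV[R]_(k + l)) : qper n c U ->
  tnn (win (uof U) 1 n) -> (forall a, row_free (win (uof U) a (k + l))) ->
  tpos (win (falt (dof U)) 1 n) -> nondeg U.
Proof.
move=> hU tU fU tW a; have [hu hd] := qper_sub hU.
apply: (stack_win_unit kln); last 1 first.
- by apply: tpos_win tW => //; exact: qper_falt_flip.
- by apply: tnn_win tU.
- exact: fU.
Qed.

Lemma TT_twrel U : nondeg (extcol c U) -> twrel (extcol c U) (extcol c' (TT U)).
Proof.
move=> uU; apply/twrel_grel; apply: gtwist_grel => // j t.
by rewrite exprzDr ?unitrN1 // cc' sgz_mul_int mulrC.
Qed.

Lemma twrel_qper (U T : int -> 'cV[R]_(k + l)) : qper n c U -> twrel U T ->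
  qper n c' T.
Proof.
move=> hU hT; have e0 := extcol_win n0 c0 hU.
have uU : nondeg (extcol c (win U 1 n)).
  by move=> a; rewrite (eq_win _ _ e0); exact: twrel_unitl hT.
have h := TT_twrel uU.
have h' : twrel U (extcol c' (TT (win U 1 n))) by move=> j i hi; rewrite -e0 h.
apply: (eq_qper (twrel_uniqr h' hT)); exact: extcol_qper.
Qed.

(** The rank formula with [d = k], where the complementary window of [U] has length [l]. *)
Lemma twrel_uof_unit (U T : int -> 'cV[R]_(k + l)) : twrel U T ->
  (forall a, win (dof U) a l \in unitmx) -> forall a, win (uof T) a k \in unitmx.
Proof.
move=> hT uW a; have [_] := twrel_rank a hT (leq_addr l k).
rewrite addKn (mxrank_unit (uW _)) => /addIn.
by rewrite -row_free_unit /row_free => ->.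
Qed.

Lemma twrel_dof_unit (U T : int -> 'cV[R]_(k + l)) : twrel U T ->
  (forall a, win (uof U) a k \in unitmx) -> forall a, win (dof T) a l \in unitmx.
Proof.
move=> hT uV a; have [+ _] := twrel_rank a hT (leq_addl k l).
rewrite addnK (mxrank_unit (uV _)) => /addIn.
by rewrite -row_free_unit /row_free => ->.
Qed.

Let D (U : int -> 'cV[R]_(k + l)) :=
  tpos (win (uof U) 1 n) /\ tpos (win (falt (dof U)) 1 n).

Let Qn (T : int -> 'cV[R]_(k + l)) :=
  tnn (win (falt (uof T)) 1 n) /\ tnn (win (dof T) 1 n).
Let Qp (T : int -> 'cV[R]_(k + l)) :=
  tpos (win (falt (uof T)) 1 n) /\ tpos (win (dof T) 1 n).

Let D_unit U : qper n c U -> D U ->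
  (forall a, win (uof U) a k \in unitmx) /\ (forall a, win (dof U) a l \in unitmx).
Proof.
move=> hU [hV hW]; have [hu hd] := qper_sub hU; split=> a.
  apply: (@tpos_win_unit _ _ _ _ n); first by rewrite (leq_trans _ kln) // leq_addr.
  exact: tpos_win hV.
apply: falt_win_unit; apply: (@tpos_win_unit _ _ _ _ n).
  by rewrite (leq_trans _ kln) // leq_addl.
by apply: tpos_win hW => //; exact: qper_falt_flip.
Qed.

Let D_nondeg U : qper n c U -> D U -> nondeg U.
Proof.
move=> hU hD; have [uV _] := D_unit hU hD; have [hV hW] := hD.
apply: positive_nondeg => //; first exact: tposW.
move=> a; have [hu _] := qper_sub hU.
have := leq_addr l k => kl.
have s0 : incr (widen_ord kl) by [].
by apply: (@det_minor_row_free _ _ _ _ (widen_ord kl)); rewrite -win_widen -unitfE -unitmxE.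
Qed.

Let F1_u (T : int -> 'cV[R]_(k + l)) : qper n c' T ->
  (forall a, win (uof T) a k \in unitmx) -> tnn (win (falt (uof T)) 1 n) ->
  tpos (win (falt (uof T)) 1 n).
Proof.
move=> hT uT h; have [hu _] := qper_sub hT.
have hf := qper_falt_flip' hu.
apply: (@tpos_win _ _ _ _ 0) => //; apply: tnn_consecutive_tpos => //.
  exact: tnn_win h.
by move=> a; apply: falt_unit_win.
Qed.

(** This makes positivity of the twist a closed condition as well as an open one: the windows of
    both blocks of [T] are invertible by complementarity, so weak signs are already strict. *)
Let Qn_Qp U T : qper n c U -> twrel U T -> D U -> Qn T -> Qp T.
Proof.
move=> hU hT hD [h1 h2]; have [uV uW] := D_unit hU hD.
have qT := twrel_qper hU hT; have [_ hd] := qper_sub qT.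
split; first by apply: F1_u => //; exact: twrel_uof_unit hT _.
apply: (@tpos_win _ _ _ _ 0) => //; apply: tnn_consecutive_tpos => //.
  exact: tnn_win h2.
exact: twrel_dof_unit hT _.
Qed.

Let DM (A : 'M[R]_(k, n)) (B : 'M[R]_(l, n)) := tpos A /\ tpos (alt B).
Let QM A B := tpos (alt (usubmx (TT (col_mx A B)))) /\ tpos (dsubmx (TT (col_mx A B))).
Let QMn A B := tnn (alt (usubmx (TT (col_mx A B)))) /\ tnn (dsubmx (TT (col_mx A B))).

Lemma win_uof_extcol e (U : 'M[R]_(k + l, n)) : win (uof (extcol e U)) 1 n = usubmx U.
Proof. by rewrite win_uof win_extcol. Qed.

Lemma win_dof_extcol e (U : 'M[R]_(k + l, n)) : win (dof (extcol e U)) 1 n = dsubmx U.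
Proof. by rewrite win_dof win_extcol. Qed.

Lemma tpos_falt1 p (A : int -> 'cV[R]_p) :
  tpos (win (falt A) 1 n) <-> tpos (alt (win A 1 n)).
Proof.
split; first exact: tpos_alt_win.
by rewrite win_falt; apply: tposZ; rewrite sgz_neq0.
Qed.

Lemma tnn_falt1 p (A : int -> 'cV[R]_p) :
  tnn (win (falt A) 1 n) <-> tnn (alt (win A 1 n)).
Proof.
rewrite win_falt expr1z; split; last exact: tnnZ.
by move=> /(tnnZ (-1)); rewrite scalerA mulrNN mulr1 scale1r.
Qed.

Let DE A B : DM A B -> D (extcol c (col_mx A B)).
Proof.
move=> [hA hB]; split; first by rewrite win_uof_extcol col_mxKu.
by apply/tpos_falt1; rewrite win_dof_extcol col_mxKd.
Qed.

Let QME A B : Qp (extcol c' (TT (col_mx A B))) -> QM A B.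
Proof.
by move=> [/tpos_falt1]; rewrite win_uof_extcol win_dof_extcol.
Qed.

Let QMnE A B : QMn A B -> Qn (extcol c' (TT (col_mx A B))).
Proof.
by move=> [h1 h2]; split; [apply/tnn_falt1; rewrite win_uof_extcol|rewrite win_dof_extcol].
Qed.

Let QMn_QM A B : DM A B -> QMn A B -> QM A B.
Proof.
move=> /DE hD /QMnE hQ; apply: QME.
have hU := extcol_qper (col_mx A B) n0 c0.
exact: (Qn_Qp hU (TT_twrel (D_nondeg hU hD)) hD hQ).
Qed.

Section Local.
Variables (X : topologicalType) (f : X -> 'M[R]_(k, n)) (h : X -> 'M[R]_(l, n)).
Hypotheses (cf : mx_class (cont_on setT) f) (ch : mx_class (cont_on setT) h).

Let O : set X := setT `&` [set y | gdom c (- l%:Z) (col_mx (f y) (h y))].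

Let oO : open O.
Proof. by apply: (open_gdom _ _ openT); exact: (mc_col (@cont_class R X setT openT) cf ch). Qed.

Let cTT : mx_class (cont_on O) (fun x => TT (col_mx (f x) (h x))).
Proof.
apply: (mc_gtwist (@cont_class R X O oO)) => [x [_ Ox] j|]; first exact: Ox.
by apply: (mc_col (@cont_class R X O oO)) => i j x _; [exact: cf|exact: ch].
Qed.

Let nondegO x : nondeg (extcol c (col_mx (f x) (h x))) -> O x.
Proof. by move=> u; split=> // j; exact: u. Qed.

Lemma near_QMn x : nondeg (extcol c (col_mx (f x) (h x))) -> ~ QMn (f x) (h x) ->
  \forall y \near x, ~ QMn (f y) (h y).
Proof.
move=> /nondegO Ox nQ; have SC := @cont_class R X O oO.
have [n1|n2] : ~ tnn (alt (usubmx (TT (col_mx (f x) (h x))))) \/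
    ~ tnn (dsubmx (TT (col_mx (f x) (h x)))).
- have [t1|] := pselect (tnn (alt (usubmx (TT (col_mx (f x) (h x)))))); last by left.
  by right=> t2; apply: nQ.
- have H := near_not_tnn oO (mc_alt SC (mc_usub SC cTT)) Ox n1.
  by near=> y => -[t1 _]; move: t1; near: y; exact: H.
- have H := near_not_tnn oO (mc_dsub SC cTT) Ox n2.
  by near=> y => -[_ t1]; move: t1; near: y; exact: H.
Unshelve. all: by end_near.
Qed.

(** At a positive point positivity is open. At any other point even the weak condition [QMn] fails,
    by [QMn_QM], and this failure persists nearby. The parameter space [X] is general so that either
    block can be varied with the other one fixed. *)
Lemma QM_local x : DM (f x) (h x) ->
  \forall y \near x, DM (f y) (h y) -> (QM (f y) (h y) <-> QM (f x) (h x)).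
Proof.
move=> hD; have uU := D_nondeg (extcol_qper _ n0 c0) (DE hD).
have Ox := nondegO uU; have SC := @cont_class R X O oO.
have [Q|nQ] := pselect (QM (f x) (h x)).
  have [t1 t2] := Q.
  have h1 := near_tpos oO (mc_alt SC (mc_usub SC cTT)) Ox t1.
  have h2 := near_tpos oO (mc_dsub SC cTT) Ox t2.
  near=> y => _; split=> _; first exact: Q.
  by split; near: y; [exact: h1|exact: h2].
have nQn : ~ QMn (f x) (h x) by move=> /(QMn_QM hD).
have H := near_QMn uU nQn.
have HH : \forall y \near x, ~ QM (f y) (h y).
  by near=> y => -[q1 q2]; have [] : ~ QMn (f y) (h y) by [near: y; exact: H];
    split; exact: tposW.
near=> y => _; have nQy : ~ QM (f y) (h y) by near: y; exact: HH.
by split=> q; [case: (nQy q)|case: (nQ q)].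
Unshelve. all: by end_near.
Qed.

End Local.

Let QM_mull (g : 'M[R]_k) (h : 'M[R]_l) A B : g \in unitmx -> h \in unitmx ->
  nondeg (extcol c (col_mx A B)) -> QM A B -> QM (g *m A) (h *m B).
Proof.
move=> ug uh uU [q1 q2]; rewrite /QM /TT.
have [|_ ->] := @gtwist_block R k l n c (- l%:Z) 0 (fun j => (-1) ^ j) g h A B n0 ug uh.
  by move=> j; exact: uU.
rewrite col_mxKu col_mxKd.
by rewrite altM; split; apply: tpos_mull => //; rewrite unitmx_tr unitmx_inv.
Qed.

Let kn : (k <= n)%N. Proof. by rewrite (leq_trans _ kln) // leq_addr. Qed.
Let ln : (l <= n)%N. Proof. by rewrite (leq_trans _ kln) // leq_addl. Qed.

(** By uniqueness of the twist: with [G] the block diagonal one-step matrix of [U], the family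
    [- (G^T *m T (j + 1))] stands in the same relation to [U]. The minus sign compensates the change
    of [(-1) ^ j]. *)
Let cyclic_twist (U T : int -> 'cV[R]_(k + l)) (A : 'M[R]_k) (B : 'M[R]_l) :
  twrel U T -> (forall j, uof U (j + 1) = A *m uof U j) ->
  (forall j, dof U (j + 1) = - (B *m dof U j)) ->
  (forall j, uof T j = - (A^T *m uof T (j + 1))) /\
  (forall j, dof T j = B^T *m dof T (j + 1)).
Proof.
move=> hT hA hB; pose G := block_mx A 0 0 (- B).
have UG j : U (j + 1) = G *m U j.
  rewrite -[LHS]vsubmxK -/(uof U _) -/(dof U _) hA hB -[U j]vsubmxK.
  by rewrite mul_block_col !mul0mx addr0 add0r mulNmx.
have hT' : twrel U (fun j => - (G^T *m T (j + 1))).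
  move=> j i hi; rewrite linearN /= mulNmx trmx_mul trmxK -mulmxA -UG mxE hT; last by lia.
  rewrite (_ : (i + 1 == j + 1 - l%:Z) = (i == j - l%:Z)); last by apply/eqP/eqP; lia.
  case: eqP => _; last by rewrite oppr0.
  by rewrite exprzDr ?unitrN1 // expr1z mulrN1 opprK.
have e := twrel_uniqr hT hT'.
have GE j : T j = col_mx (- (A^T *m uof T (j + 1))) (B^T *m dof T (j + 1)).
  rewrite e /G tr_block_mx !trmx0 -[T (j + 1)]vsubmxK mul_block_col !mul0mx.
  by rewrite addr0 add0r linearN /= mulNmx opp_col_mx opprK.
by split=> j; [rewrite {1}/uof GE col_mxKu|rewrite {1}/dof GE col_mxKd].
Qed.

(** V is a cyclic point for [k], and W the alternation of a cyclic point for [l]. By [cyclic_twist]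
    the alternated upper block of the twist is dual to the former and the lower block to the latter
    in the sense of [tpos_cyclic_dual]. *)
Let base_point : exists A B, DM A B /\ QM A B.
Proof.
have [V0 [A0 [hV tV hA]]] := cyclic_point R k n0.
have [V1 [A1 [hW tW hB]]] := cyclic_point R l n0.
pose U j : 'cV[R]_(k + l) := col_mx (V0 j) (falt V1 j).
have uU j : uof U j = V0 j by rewrite /uof col_mxKu.
have dU j : dof U j = falt V1 j by rewrite /dof col_mxKd.
have hU : qper n c U.
  by move=> j; rewrite /U hV (qper_falt_flip' hW) scale_col_mx.
have e0 := extcol_win n0 c0 hU.
have wU : win U 1 n = col_mx (win V0 1 n) (win (falt V1) 1 n).
  by rewrite win_stack (eq_win _ _ uU) (eq_win _ _ dU).
have fV : falt (falt V1) =1 V1 by move=> j; exact: faltK.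
have hD : DM (win V0 1 n) (win (falt V1) 1 n).
  split; first exact: tV.
  by apply/tpos_falt1; rewrite (eq_win _ _ fV).
exists (win V0 1 n), (win (falt V1) 1 n); split=> //; apply: QME; rewrite -wU.
have hD' := DE hD; rewrite -wU in hD'.
have nU := D_nondeg (extcol_qper _ n0 c0) hD'.
have hT : twrel U (extcol c' (TT (win U 1 n))).
  by have h := TT_twrel nU; move=> j i hi; rewrite -e0 h.
set T := extcol _ _ in hT *.
have [eu ed] : (forall j, uof T j = - (A0^T *m uof T (j + 1))) /\
  (forall j, dof T j = A1^T *m dof T (j + 1)).
  apply: (cyclic_twist hT) => j; first by rewrite !uU hA.
  rewrite !dU /falt hB exprzDr ?unitrN1 // expr1z mulrN1 scaleNr.
  by rewrite -scalemxAr.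
have hDU : D U by split; [rewrite (eq_win _ _ uU)|apply/tpos_falt1; rewrite (eq_win _ _ dU); case: hD].
have [uV uW] := D_unit hU hDU.
split.
  apply: (tpos_cyclic_dual n0 kn _ hV _ hA (X := falt (uof T)) (A := A0)).
  - by rewrite -exprM muln2 -mul2n exprM sqrrN expr1n expr1n.
  - by move=> b; exact: tpos_win tV.
  - move=> j; rewrite /falt {1}eu exprzDr ?unitrN1 // expr1z mulrN1 -scalemxAr.
    by rewrite scalerN scaleNr.
  - by apply: falt_unit_win; exact: twrel_uof_unit hT uW _.
apply: (tpos_cyclic_dual n0 ln _ hW _ hB (X := dof T) (A := A1)) => //.
- by rewrite -exprM muln2 -mul2n exprM sqrrN expr1n expr1n.
- by move=> b; exact: tpos_win tW.
- exact: twrel_dof_unit hT uV _.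
Qed.

Let DM_nondeg A B : DM A B -> nondeg (extcol c (col_mx A B)).
Proof. by move=> /DE; exact: (D_nondeg (extcol_qper _ n0 c0)). Qed.

(** [DM] is carried along because it makes the stack nondegenerate, and equivariance of the twist
    holds there; the conjunction is then invariant under all invertible matrices. *)
Let QM_iff (g : 'M[R]_k) (h : 'M[R]_l) A B : g \in unitmx -> h \in unitmx ->
  (DM (g *m A) (h *m B) /\ QM (g *m A) (h *m B)) <-> (DM A B /\ QM A B).
Proof.
have one (g' : 'M[R]_k) (h' : 'M[R]_l) A' B' : g' \in unitmx -> h' \in unitmx ->
    DM A' B' /\ QM A' B' -> DM (g' *m A') (h' *m B') /\ QM (g' *m A') (h' *m B').
  move=> ug uh [hD hQ]; split; last exact: QM_mull (DM_nondeg hD) hQ.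
  by case: hD => h1 h2; split; rewrite ?altM; exact: tpos_mull.
move=> ug uh; split; last exact: one.
by move=> /(one (invmx g) (invmx h)); rewrite !mulKmx // !unitmx_inv; apply.
Qed.

(** First V moves with W at the base point, then W moves with V in its final position. W is
    parametrised by its alternation, since that is the matrix that ranges over the connected set. *)
Lemma twist_positive A B : tpos A -> tpos (alt B) ->
  tpos (alt (usubmx (TT (col_mx A B)))) /\ tpos (dsubmx (TT (col_mx A B))).
Proof.
move=> hA hB; have [A0 [B0 [hD hQ]]] := base_point; have [hA0 hB0] := hD.
have [hD1 hQ1] : DM A B0 /\ QM A B0.
  apply: (@tpos_connected R k n (fun A => DM A B0 /\ QM A B0) kn _ _ A0 A hA0 hA); last by split.
    move=> A' hA'; have hD' : DM A' B0 by [].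
    have h := QM_local (@mc_id R k n setT) (mc_cst (@cont_class R 'M[R]_(k, n) setT openT) B0) (x := A') hD'.
    apply: filterS h => A'' hh hA''; have hD'' : DM A'' B0 by [].
    have e := hh hD''; split=> -[_ q]; split; [exact: hD'|exact: e.1 q|exact: hD''|exact: e.2 q].
  move=> g A' ug; have := @QM_iff g 1%:M A' B0 ug (unitmx1 _ _).
  by rewrite mul1mx.
suff [] : DM A (alt (alt B)) /\ QM A (alt (alt B)) by rewrite altK.
apply: (@tpos_connected R l n (fun B => DM A (alt B) /\ QM A (alt B)) ln _ _ (alt B0) (alt B)); last 3 first.
- exact: hB0.
- exact: hB.
- by rewrite altK; split.
- move=> B' hB'; have hD' : DM A (alt B') by split; rewrite ?altK.
  have calt := mc_alt (@cont_class R _ _ (@openT 'M[R]_(l, n))) (@mc_id R l n setT).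
  have h := QM_local (mc_cst (@cont_class R 'M[R]_(l, n) setT openT) A) calt (x := B') hD'.
  apply: filterS h => B'' hh hB''; have hD'' : DM A (alt B'') by split; rewrite ?altK.
  have e := hh hD''; split=> -[_ q]; split; [exact: hD'|exact: e.1 q|exact: hD''|exact: e.2 q].
- move=> h B' uh; have := @QM_iff 1%:M h A (alt B') (unitmx1 _ _) uh.
  by rewrite mul1mx altM.
Qed.

(** A failure of the weak inequalities would persist on a neighbourhood of [A], and that
    neighbourhood contains totally positive matrices; [g] only fixes the sign of the minors of [A].
    Nondegeneracy of the stack makes the twist continuous at [A]. *)
Lemma twist_nonneg A B : tnn A -> row_free A -> nondeg (extcol c (col_mx A B)) ->
  tpos (alt B) ->
  tnn (alt (usubmx (TT (col_mx A B)))) /\ tnn (dsubmx (TT (col_mx A B))).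
Proof.
move=> hA fA uU hB; apply: contrapT => nQ.
have near := near_QMn (@mc_id R k n setT) (mc_cst (@cont_class R 'M[R]_(k, n) setT openT) B) (x := A) uU nQ.
have [g ug [gA [s hs ds]]] := tnn_minors_ge0 fA hA.
pose P := [set A' : 'M[R]_(k, n) | ~ QMn A' B].
have [A' tA' nA'] : exists2 A', tpos A' & P A'.
  have cg : {for g *m A, continuous (fun M : 'M[R]_(k, n) => invmx g *m M)}.
    apply: mx_continuous => i j.
    exact: (mc_mul (@cont_class R _ _ (@openT 'M[R]_(k, n)))
      (mc_cst (@cont_class R _ _ (@openT 'M[R]_(k, n))) (invmx g)) (@mc_id R k n setT)).
  have nearg : \forall M \near g *m A, P (invmx g *m M).
    by apply: cg; rewrite mulKmx.
  have oI := open_interior [set M | P (invmx g *m M)].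
  have [G hG [GA GP]] := minors_gt0_dense gA (ex_intro2 _ _ s hs ds) oI nearg.
  exists (invmx g *m (g *m A *m G)); last exact: (interior_subset GP).
  by apply: tpos_mull; [rewrite unitmx_inv|exact: minors_gt0_tpos].
apply: nA'; have [h1 h2] := twist_positive tA' hB.
by split; exact: tposW.
Qed.

Theorem twrel_positive (U T : int -> 'cV[R]_(k + l)) : qper n c U -> twrel U T ->
  tnn (win (uof U) 1 n) -> row_free (win (uof U) 1 n) ->
  tpos (win (falt (dof U)) 1 n) ->
  tpos (win (falt (uof T)) 1 n) /\ tnn (win (dof T) 1 n).
Proof.
move=> hU hT tU fU tW; have e0 := extcol_win n0 c0 hU.
have uU : nondeg (extcol c (win U 1 n)).
  by move=> a; rewrite (eq_win _ _ e0); exact: twrel_unitl hT.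
have h := TT_twrel uU.
have h' : twrel U (extcol c' (TT (win U 1 n))) by move=> j i hi; rewrite -e0 h.
have eT := twrel_uniqr hT h'.
move: uU; rewrite win_stack => uU.
have tB : tpos (alt (win (dof U) 1 n)) by apply/tpos_falt1.
have /QMnE[q1 q2] := twist_nonneg tU fU uU tB.
have eu : uof T =1 uof (extcol c' (TT (win U 1 n))) by move=> j; rewrite /uof eT.
have ed : dof T =1 dof (extcol c' (TT (win U 1 n))) by move=> j; rewrite /dof eT.
rewrite -win_stack in q1 q2; split; last by rewrite (eq_win _ _ ed).
apply: F1_u; first exact: twrel_qper hU hT.
  apply: (twrel_uof_unit hT) => a; apply: falt_win_unit.
  apply: (tpos_win_unit ln); apply: tpos_win tW => //.
  by apply: qper_falt_flip; case: (qper_sub hU).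
have ef : falt (uof T) =1 falt (uof (extcol c' (TT (win U 1 n)))).
  by move=> j; rewrite /falt eu.
by rewrite (eq_win _ _ ef).
Qed.

End Core.

(** * Affine permutations and ranks *)

Section Counting.
Local Open Scope card_scope.

Lemma cardI_uniq T (A : set T) a b : A #= `I_a -> A #= `I_b -> a = b.
Proof. by move=> ha hb; apply/card_eq_II; rewrite -(card_eql ha). Qed.

Lemma cardI_add (T : choiceType) (A B : set T) a b : A #= `I_a -> B #= `I_b ->
  (forall x, A x -> B x -> False) -> A `|` B #= `I_(a + b).
Proof.
move=> ha hb AB; have fA : finite_set A by apply/finite_setP; exists a.
have fB : finite_set B by apply/finite_setP; exists b.
rewrite -[A](fset_setK fA) -[B](fset_setK fB) -set_fsetU; apply/card_eq_fsetP.
rewrite finmap.cardfsU (card_fset_set ha) (card_fset_set hb).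
rewrite (_ : finmap.fsetI _ _ = finmap.fset0) ?finmap.cardfs0 ?subn0 //.
apply/finmap.fsetP => x; rewrite finmap.in_fsetI !in_fset_set // finmap.in_fset0.
by apply/negP => /andP[]; rewrite !inE => Ax Bx; exact: AB Ax Bx.
Qed.

Lemma cardI_sub T (A B : set T) b : A `<=` B -> B #= `I_b -> exists a, A #= `I_a.
Proof.
move=> AB hB; apply/finite_setP; apply: sub_finite_set AB _.
by apply/finite_setP; exists b.
Qed.

Lemma cardI_itv (x : int) (m : nat) : [set i : int | x <= i < x + m%:Z] #= `I_m.
Proof.
have -> : [set i : int | x <= i < x + m%:Z] = (fun j : nat => x + j%:Z) @` `I_m.
  apply/seteqP; split=> i /=.
    move=> hi; exists `|i - x|%N; lia.
  by move=> [j jm <-]; lia.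
by apply: inj_card_eq => i j _ _ /addrI []; lia.
Qed.

Lemma cardI_eq T (A B : set T) a : (forall x, A x <-> B x) -> A #= `I_a -> B #= `I_a.
Proof. by move=> e; have -> : A = B by apply/seteqP; split=> x /e. Qed.

(** Put [i = f p]. The interval from [a - l] to [b - l] splits into [E1], in bijection with the set
    to be counted, and [H]. The [k] elements counted at [x = b - l] split into the set of size [N]
    and the same [H]. The size of [H] is eliminated. *)
Lemma count_inverse (f g : int -> int) (k l : nat) (a b : int) (N : nat) :
  cancel f g -> cancel g f -> (forall i, i - k%:Z <= f i <= i + l%:Z) ->
  (forall x, [set i | i < x /\ x <= f i + k%:Z] #= `I_k) ->
  a <= b -> b - a <= k%:Z + l%:Z ->
  [set i | i < b - l%:Z /\ b - l%:Z <= f i + k%:Z < a + k%:Z] #= `I_N ->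
  exists2 M, [set i | i < a /\ a <= g i + l%:Z < b] #= `I_M &
    (M + k = `|b - a| + N)%N.
Proof.
move=> fK gK fb hk ab abk hN.
pose I := [set p : int | a - l%:Z <= p < b - l%:Z].
have hI : I #= `I_(`|b - a|%N).
  by have := cardI_itv (a - l%:Z) `|b - a|%N; apply: cardI_eq => i; rewrite /I /=; split=> ?; lia.
pose E1 := [set p : int | a - l%:Z <= p < b - l%:Z /\ f p < a].
pose H := [set p : int | p < b - l%:Z /\ a <= f p].
have [|M hM] := cardI_sub (A := E1) _ hI; first by move=> p [].
have [|h hH] := cardI_sub (A := H) _ hI.
  by move=> p [h1 h2]; rewrite /I /=; have := fb p; lia.
have e1 : (M + h)%N = `|b - a|%N.
  apply: (cardI_uniq (A := I)) => //; apply: (cardI_eq _ (cardI_add hM hH _)) => p.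
    split=> [[[]|[h1 h2]] //|Ip]; rewrite /I /=; first by have := fb p; lia.
    by have [fa|fa] := ltP (f p) a; [left|right; move: Ip; rewrite /I /= => /andP[]].
  by move=> [_ h1] [_ h2]; lia.
have e2 : (N + h)%N = k.
  apply: (cardI_uniq _ (hk (b - l%:Z))).
  apply: (cardI_eq _ (cardI_add hN hH _)) => p /=.
    split=> [[[h1 h2]|[h1 h2]]|[h1 h2]]; first by split=> //; case/andP: h2.
      by split=> //; lia.
    by have [fa|fa] := ltP (f p) a; [left; split=> //; lia|right; split].
  by move=> [_ h1] [_ h2]; lia.
exists M; last by lia.
apply: card_eq_trans hM.
have fI : {in E1 &, injective f} by move=> x y _ _; move=> /(can_inj fK).
apply: card_eq_trans (inj_card_eq fI).
rewrite (_ : [set i | _] = f @` E1) //; apply/seteqP; split=> i /=.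
  move=> [ia gi]; exists (g i); last exact: gK.
  by split; rewrite ?gK //; lia.
by move=> [p [h1 h2] <-]; rewrite fK; split=> //; lia.
Qed.

Lemma affperm_shift n k l f (t : int) i : affperm n k l f ->
  f (i + t * n%:Z) = f i + t * n%:Z.
Proof.
move=> [_ per _ _]; have pos (m : nat) j : f (j + m%:Z * n%:Z) = f j + m%:Z * n%:Z.
  elim: m => [|m IH]; first by rewrite !mul0r !addr0.
  have -> : j + m.+1%:Z * n%:Z = j + m%:Z * n%:Z + n%:Z by lia.
  by rewrite per IH; lia.
case: (intP t) => [|m|m]; first by rewrite !mul0r !addr0.
  exact: pos.
have := pos m.+1 (i - m.+1%:Z * n%:Z); rewrite subrK => e.
by rewrite !mulNr e addrK.
Qed.

(** The displacement [g x - x] depends only on [x] modulo [n], and [f] permutes the residues by [r];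
    so the sum for [g], reindexed by [r], is minus the sum for [f]. *)
Lemma affperm_inv n k l f g : (0 < n)%N -> affperm n k l f -> cancel f g ->
  cancel g f -> affperm n l k g.
Proof.
move=> n0 hf fK gK; have [bf per sf fb] := hf.
have gper i : g (i + n%:Z) = g i + n%:Z.
  by apply: (can_inj fK); rewrite gK per gK.
split=> //.
- by exists f.
- have split1 (x : 'I_n) := int_split (f (1 + (x : nat)%:Z)) n0.
  have [r hr] := choice split1; have [t ht] := choice hr.
  have rI : injective r.
    move=> x y e; have := ht x; rewrite e => ex; have := ht y => ey.
    have : f (1 + (x : nat)%:Z) = f (1 + (y : nat)%:Z + (t x - t y) * n%:Z).
      by rewrite (affperm_shift _ _ hf) ex ey; lia.
    move=> /(can_inj fK) exy; apply: val_inj => /=.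
    have := ltn_ord x; have := ltn_ord y.
    have [t0|t1] := eqVneq (t x - t y) 0; first by move: exy; rewrite t0; lia.
    have : 1 <= t x - t y \/ t x - t y <= -1 by lia.
    by move: (t x - t y) exy {t1} => u exy [h|h] h1 h2; exfalso; nia.
  pose h (x : int) := g x - x.
  have hper (u x : int) : h (x + u * n%:Z) = h x.
    have e : f (g x + u * n%:Z) = x + u * n%:Z by rewrite (affperm_shift _ _ hf) gK.
    by rewrite /h -e fK e; lia.
  have e1 (F : int -> int) : \sum_(1 <= i < n.+1) F i%:Z = \sum_(i < n) F (1 + (i : nat)%:Z).
    by rewrite big_add1 /= big_mkord; apply: eq_bigr => i _; rewrite intS.
  have sf' : \sum_(i < n) (f (1 + (i : nat)%:Z) - (1 + (i : nat)%:Z)) = 0.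
    by rewrite -(e1 (fun i => f i - i)).
  apply: (etrans (e1 (fun i => g i - i))).
  rewrite (reindex_inj rI) /=.
  rewrite (eq_bigr (fun i : 'I_n => - (f (1 + (i : nat)%:Z) - (1 + (i : nat)%:Z)))).
    by rewrite sumrN sf' oppr0.
  move=> i _; have := hper (t i) (1 + (r i : nat)%:Z); rewrite -ht /h fK; lia.
- by move=> i; have := fb (g i); rewrite gK; lia.
Qed.

End Counting.

Section Ranks.
Variable F : realFieldType.
Local Open Scope card_scope.

Lemma rank_win_scale k (A B : int -> 'cV[F]_k) (s : int -> F) a m :
  (forall j, B j = s j *: A j) -> (forall j, s j != 0) ->
  \rank (win B a m) = \rank (win A a m).
Proof.
move=> e s0; have -> : win B a m = win A a m *m diag_mx (\row_j s (a + (j : nat)%:Z)).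
  by rewrite mul_mx_diag; apply/matrixP => i j; rewrite !mxE e mxE mulrC.
apply: mxrankMfree; rewrite row_free_unit unitmxE det_diag unitfE.
by rewrite prodf_seq_neq0; apply/allP => j _; rewrite mxE s0.
Qed.

Lemma rank_win_mono k (A : int -> 'cV[F]_k) a m m' : (m <= m')%N ->
  (\rank (win A a m) <= \rank (win A a m'))%N.
Proof.
move=> mm; rewrite (win_widen A a mm).
have -> : colsub (widen_ord mm) (win A a m') = win A a m' *m colsub (widen_ord mm) 1%:M.
  by rewrite mulmx_colsub mulmx1.
exact: mxrankM_maxl.
Qed.

Definition has_ranks k (A : int -> 'cV[F]_k) (f : int -> int) :=
  forall a b : int, a < b ->
    [set i : int | i < a /\ a <= f i + k%:Z < b] #= `I_(\rank (win A a `|b - a|%N)).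

(** For [i < a] the bound on [f] gives [f i + k < a + k + l], so the rank of a window starting at
    [a] no longer grows beyond length [k + l]; a full period has rank [k]. *)
Lemma has_ranks_window k l n (A : int -> 'cV[F]_k) f : (0 < n)%N -> (k + l <= n)%N ->
  (forall i, i - k%:Z <= f i <= i + l%:Z) -> has_ranks A f ->
  (forall a, row_free (win A a n)) ->
  (forall x, [set i | i < x /\ x <= f i + k%:Z] #= `I_k) /\
  (forall a, row_free (win A a (k + l))).
Proof.
move=> n0 kln fb hA fA.
have hk x : [set i | i < x /\ x <= f i + k%:Z] #= `I_k.
  have := hA x (x + n%:Z); rewrite (_ : `|_ - _|%N = n); last by lia.
  rewrite (eqP (fA x)) => /(_ ltac:(lia)); apply: cardI_eq => i /=.
  by have := fb i; split=> -[h1 h2]; split=> //; lia.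
split=> // a; have [kl0|kl0] := posnP (k + l).
  have k0 : k = 0%N by lia.
  by rewrite /row_free eqn_leq rank_leq_row {1}k0.
apply/eqP; apply: (cardI_uniq _ (hk a)).
have := hA a (a + (k + l)%N%:Z); rewrite (_ : `|_ - _|%N = (k + l)%N); last by lia.
move=> /(_ ltac:(lia)); apply: cardI_eq => i /=.
by have := fb i; split=> -[h1 h2]; split=> //; lia.
Qed.

(** Up to length [k + l] the count of [count_inverse] and the rank formula satisfy the same
    equation; for longer windows both the rank and the count stay equal to [l]. *)
Lemma has_ranks_inverse k l (A : int -> 'cV[F]_k) (B : int -> 'cV[F]_l) f g :
  cancel f g -> cancel g f -> (forall i, i - k%:Z <= f i <= i + l%:Z) ->
  (forall x, [set i | i < x /\ x <= f i + k%:Z] #= `I_k) ->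
  (forall a d, (d <= k + l)%N ->
     (\rank (win B a d) + k = d + \rank (win A (a + d%:Z - l%:Z) (k + l - d)))%N) ->
  has_ranks A f -> has_ranks B g.
Proof.
move=> fK gK fb hk rk hA.
have small a b : a <= b -> b - a <= k%:Z + l%:Z ->
    [set i : int | i < a /\ a <= g i + l%:Z < b] #= `I_(\rank (win B a `|b - a|%N)).
  move=> ab abk; pose d := `|b - a|%N; have dk : (d <= k + l)%N by rewrite /d; lia.
  have hN : [set i | i < b - l%:Z /\ b - l%:Z <= f i + k%:Z < a + k%:Z]
      #= `I_(\rank (win A (b - l%:Z) (k + l - d))).
    have [dlt|dge] := ltnP d (k + l).
      have := hA (b - l%:Z) (a + k%:Z); rewrite (_ : `|_ - _|%N = (k + l - d)%N); last by lia.
      by apply; lia.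
    (* The complementary window is empty, a case that [has_ranks] does not cover; rank and count are
       both zero. *)
    have -> : \rank (win A (b - l%:Z) (k + l - d)) = 0%N.
      by apply/eqP; rewrite -leqn0 (leq_trans (rank_leq_col _)) // leqn0 subn_eq0.
    rewrite (_ : [set i | _] = set0); first by rewrite II0; exact: card_eq00.
    by apply/seteqP; split=> i //= [h1 h2]; lia.
  have [M hM eM] := count_inverse fK gK fb hk ab abk hN.
  have := rk a d dk; rewrite (_ : a + d%:Z - l%:Z = b - l%:Z); last by lia.
  by move=> er; have <- : M = \rank (win B a d) by move: eM er; rewrite -/d; lia.
move=> a b ab; have [abk|abk] := leP (b - a) (k%:Z + l%:Z).
  by apply: small => //; exact: ltW.
have := small a (a + (k + l)%N%:Z); rewrite (_ : `|_ - _|%N = (k + l)%N); last by lia.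
have rB : \rank (win B a (k + l)) = l.
  have := rk a (k + l)%N (leqnn _); rewrite subnn.
  have := rank_leq_col (win A (a + (k + l)%N%:Z - l%:Z) 0); lia.
have -> : \rank (win B a `|b - a|%N) = l.
  apply/eqP; rewrite eqn_leq rank_leq_row -{1}rB rank_win_mono //; lia.
rewrite rB => /(_ ltac:(lia) ltac:(lia)); apply: cardI_eq => i /=.
have := fb (g i); rewrite gK => hgi.
by split=> -[h1 h2]; split=> //; lia.
Qed.

End Ranks.

(** * Grassmannians *)

Section Rowspan.
Variable R : realType.

Lemma mem_rowspan r n (A : 'M[R]_(r, n)) v : (v \in rowspan A) = (v <= A)%MS.
Proof.
apply/idP/idP.
  set X := [seq row i A | i : 'I_r] => vX.
  have /coord_span -> : v \in <<in_tuple X>>%VS by [].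
  apply: summx_sub => i _; apply: scalemx_sub.
  have : X`_i \in X by apply: mem_nth.
  by case/mapP => j _ ->; exact: row_sub.
case/submxP => u ->; rewrite mulmx_sum_row; apply: memv_suml => i _.
by apply: memvZ; apply: memv_span; apply/mapP; exists i => //; rewrite mem_enum.
Qed.

Lemma dim_rowspan r n (A : 'M[R]_(r, n)) : (\dim (rowspan A) == r) = row_free A.
Proof.
have sX : size [seq row i A | i : 'I_r] = r by rewrite size_map size_enum_ord.
have -> : (\dim (rowspan A) == r) = free [seq row i A | i : 'I_r].
  by rewrite /free sX.
apply/idP/idP.
  move=> fX; rewrite -kermx_eq0; apply/rowV0P => v /sub_kermxP vA.
  apply/rowP => i; rewrite [RHS]mxE.
  have e : \sum_(j < r) v 0 j *: [seq row i A | i : 'I_r]`_j = 0.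
    rewrite -[RHS]vA mulmx_sum_row; apply: eq_bigr => j _.
    by rewrite (nth_map j) ?size_enum_ord // nth_ord_enum.
  have e2 : size [seq row i A | i : 'I_r] == r by rewrite sX.
  have fX' : free (Tuple e2) by [].
  exact: (elimT freeP fX' (fun j => v 0 j) e i).
move=> fA; have e2 : size [seq row i A | i : 'I_r] == r by rewrite sX.
have : free (Tuple e2); last by [].
apply/freeP => u e i.
have /(row_free_inj fA) : (\row_j u j) *m A = 0 *m A.
  rewrite mul0mx -[RHS]e mulmx_sum_row; apply: eq_bigr => j _.
  by rewrite mxE (nth_map j) ?size_enum_ord // nth_ord_enum.
by move=> /rowP /(_ i); rewrite !mxE.
Qed.

Lemma eq_rowspan r n (A B : 'M[R]_(r, n)) : rowspan A = rowspan B <-> (A :=: B)%MS.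
Proof.
split=> [e|e].
  apply/eqmxP/andP; split; apply/rV_subP => v; by rewrite -!mem_rowspan e.
by apply/vspaceP => v; rewrite !mem_rowspan e.
Qed.

Lemma rowspan_unit r n (g : 'M[R]_r) (A : 'M[R]_(r, n)) : g \in unitmx ->
  rowspan (g *m A) = rowspan A.
Proof.
by move=> ug; apply/eq_rowspan; apply: eqmxMfull; rewrite row_full_unit.
Qed.

Lemma rowspan_gr_mx r n (V : Gr R r n) : rowspan (gr_mx V) = V.
Proof.
have sV : size (vbasis V) = r by rewrite size_tuple; exact/eqP/gr_dim.
rewrite -[RHS](span_basis (vbasisP V)) /rowspan; congr (<<_>>%VS).
apply: (@eq_from_nth _ 0); first by rewrite size_map size_enum_ord sV.
move=> i; rewrite size_map size_enum_ord => ir.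
rewrite (nth_map (Ordinal ir)) ?size_enum_ord // (nth_ord_enum _ (Ordinal ir)).
by apply/rowP => j; rewrite !mxE.
Qed.

Lemma row_free_gr r n (A : 'M[R]_(r, n)) (V : Gr R r n) : rowspan A = V -> row_free A.
Proof. by move=> e; rewrite -dim_rowspan e; exact: gr_dim. Qed.

Lemma row_free_gr_mx r n (V : Gr R r n) : row_free (gr_mx V).
Proof. exact: row_free_gr (rowspan_gr_mx V). Qed.

Lemma gr_inj r n (V W : Gr R r n) : gr_space V = gr_space W -> V = W.
Proof. by move=> e; apply: val_inj. Qed.

Lemma rowspan_eqP r n (A : 'M[R]_(r, n)) (V : Gr R r n) : rowspan A = V ->
  exists2 g : 'M[R]_r, g \in unitmx & A = g *m gr_mx V.
Proof.
move=> e; have fA := row_free_gr e.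
have /eq_rowspan e' : rowspan A = rowspan (gr_mx V) by rewrite rowspan_gr_mx.
have /submxP[g eg] : (A <= gr_mx V)%MS by rewrite e'.
exists g => //; rewrite -row_free_unit; apply/eqP/anti_leq.
rewrite rank_leq_row -[X in (X <= _)%N](eqP fA) eg; exact: mxrankM_maxl.
Qed.

Lemma insubd_rowspan r n (V0 : Gr R r n) (A : 'M[R]_(r, n)) : row_free A ->
  gr_space (insubd V0 (rowspan A)) = rowspan A.
Proof. by move=> fA; rewrite -[LHS]/(val _) insubdK // -topredE /= dim_rowspan. Qed.

Lemma Gr_ge0_tnn r n (V : Gr R r n) : Gr_ge0 V <-> tnn (gr_mx V).
Proof.
split=> [[A AV hA]|h].
  have [g ug e] := rowspan_eqP AV.
  rewrite -(mulKmx ug (gr_mx V)) -e; apply: tnn_mull => s s' hs hs'.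
  by rewrite mulr_ge0 ?hA.
have [g ug [hg _]] := tnn_minors_ge0 (row_free_gr_mx V) h.
exists (g *m gr_mx V); last exact: hg.
by rewrite rowspan_unit // rowspan_gr_mx.
Qed.

Lemma Gr_gt0_tpos r n (V : Gr R r n) : (r <= n)%N -> Gr_gt0 V <-> tpos (gr_mx V).
Proof.
move=> rn; split=> [[A AV hA]|h].
  have [g ug e] := rowspan_eqP AV.
  rewrite -(mulKmx ug (gr_mx V)) -e; apply: tpos_mull; rewrite ?unitmx_inv //.
  exact: minors_gt0_tpos.
have [g ug hg] := tpos_minors_gt0 rn h.
exists (g *m gr_mx V); last exact: hg.
by rewrite rowspan_unit // rowspan_gr_mx.
Qed.

(** Since [r + q = n], orthogonality of two representing matrices already forces one row space to be
    the full orthogonal complement of the other; the rest is [tpos_dual]. *)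
Lemma Gr_perp_tpos r q n (V : Gr R q n) : (r + q)%N = n ->
  Gr_perp_gt0 r V <-> tpos (alt (gr_mx V)).
Proof.
move=> rqn; have rn : (r <= n)%N by rewrite -rqn leq_addr.
have perp (Z : Gr R r n) : gr_mx V *m (gr_mx Z)^T = 0 <->
    forall v : 'rV[R]_n, v \in gr_space V <->
       (forall z : 'rV[R]_n, z \in gr_space Z -> (v *m z^T) 0 0 = 0).
  split=> [e v|h].
    have kerE : (v *m (gr_mx Z)^T = 0) <-> (v \in gr_space V).
      rewrite -[gr_space V]rowspan_gr_mx mem_rowspan.
      have /eqmxP eK : (gr_mx V == kermx (gr_mx Z)^T)%MS.
        rewrite -mxrank_leqif_eq; last exact/sub_kermxP.
        by rewrite mxrank_ker mxrank_tr (eqP (row_free_gr_mx V)) (eqP (row_free_gr_mx Z))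
          -rqn addKn.
      by rewrite eK; split=> [h|h]; exact/sub_kermxP.
    rewrite -kerE; split=> [h z|h].
      rewrite -[gr_space Z]rowspan_gr_mx mem_rowspan => /submxP[u ->].
      by rewrite trmx_mul mulmxA h mul0mx mxE.
    apply/rowP => i; rewrite [RHS]mxE.
    have := h (row i (gr_mx Z)); rewrite -[gr_space Z]rowspan_gr_mx mem_rowspan row_sub.
    move=> /(_ isT) <-; rewrite !mxE; apply: eq_bigr => x _; by rewrite !mxE.
  apply/matrixP => i j; rewrite [RHS]mxE.
  have /h /(_ (row j (gr_mx Z))) : row i (gr_mx V) \in gr_space V.
    by rewrite -[gr_space V]rowspan_gr_mx mem_rowspan row_sub.
  rewrite -[gr_space Z]rowspan_gr_mx mem_rowspan row_sub => /(_ isT) <-.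
  by rewrite !mxE; apply: eq_bigr => x _; rewrite !mxE.
split=> [[Z /(Gr_gt0_tpos _ rn) tZ /perp VZ]|tV].
  exact/(tpos_dual rqn VZ (row_free_gr_mx Z) (row_free_gr_mx V)).
have [Z fZ VZ] := perp_exists rqn (row_free_gr_mx V).
have dZ : \dim (rowspan Z) == r by rewrite dim_rowspan.
have [g ug eg] := rowspan_eqP (erefl : rowspan Z = MkGr dZ).
have VZ' : gr_mx V *m (gr_mx (MkGr dZ))^T = 0.
  rewrite -(canLR (mulKmx ug) eg).
  by rewrite trmx_mul mulmxA VZ mul0mx.
exists (MkGr dZ); last exact/perp.
apply/(Gr_gt0_tpos _ rn).
by apply/(tpos_dual rqn VZ' (row_free_gr_mx _) (row_free_gr_mx V)).
Qed.

Lemma row_free_extcol r n (c : R) (A : 'M[R]_(r, n)) a : (0 < n)%N -> c != 0 ->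
  row_free A -> row_free (win (extcol c A) a n).
Proof.
move=> n0 c0 fA; rewrite -kermx_eq0; apply/rowV0P => v /sub_kermxP vA.
apply/eqP; rewrite -(mulmx_free_eq0 _ fA); apply/eqP.
apply/rowP => i; rewrite [RHS]mxE.
pose y : int := ((1 + (i : nat)%:Z - a) %% n%:Z)%Z.
have n0' : n%:Z != 0 by rewrite eqz_nat -lt0n.
have y0 := modz_ge0 (1 + (i : nat)%:Z - a) n0'.
have y1 : y < n%:Z by rewrite ltz_pmod.
have yn : (`|y| < n)%N by rewrite /y; lia.
have := congr1 (fun M : 'rV_n => M 0 (Ordinal yn)) vA.
rewrite [X in _ = X]mxE mxE.
have -> : \sum_j v 0 j * win (extcol c A) a n j (Ordinal yn) =
   c ^ (- ((1 + (i : nat)%:Z - a) %/ n%:Z)%Z) * (v *m A) 0 i.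
  rewrite mxE mulr_sumr; apply: eq_bigr => j _; rewrite mxE.
  have -> : a + ((Ordinal yn : nat))%:Z =
      1 + (i : nat)%:Z + (- ((1 + (i : nat)%:Z - a) %/ n%:Z)%Z) * n%:Z.
    have := divz_eq (1 + (i : nat)%:Z - a) n%:Z.
    rewrite -/y /= gez0_abs //; lia.
  by rewrite extcolE !mxE mulrCA.
by move/eqP; rewrite mulf_eq0 expfz_eq0 (negbTE c0) andbF /= => /eqP.
Qed.

(** Cells are defined by the strictly periodic extension of the columns; the extension by [c]
    differs from it by nonzero scalars on columns, which ranks do not see. *)
Lemma positroid_cellE r n (c : R) (V : Gr R r n) f : (0 < n)%N -> c \is a GRing.unit ->
  positroid_cell f V <-> tnn (gr_mx V) /\ has_ranks (extcol c (gr_mx V)) f.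
Proof.
move=> n0 c0; rewrite -Gr_ge0_tnn /positroid_cell /=.
have e a b : \rank (cyclic_cols (gr_mx V) a b) = \rank (win (extcol c (gr_mx V)) a `|b - a|).
  have -> : cyclic_cols (gr_mx V) a b = win (extcol 1 (gr_mx V)) a `|b - a|.
    by apply/matrixP => i j; rewrite !mxE.
  symmetry; apply: (@rank_win_scale _ _ _ _ (fun j => c ^ ((j - 1) %/ n%:Z)%Z)).
    move=> j; rewrite /extcol; case: insubP => [i _ _|_]; last by rewrite scaler0.
    by rewrite exp1rz scale1r.
  by move=> j; rewrite expfz_neq0 // -unitfE.
by split=> -[h1 h2]; split=> // a b /h2; rewrite e.
Qed.

End Rowspan.

(** * The stacked twist of a matrix in terms of the twist relation *)

Section Twist.
Variables (R : realType) (k l n : nat).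

Lemma stackcolE (U : 'M[R]_(k + l, n)) : stackcol U =1 extcol ((-1) ^+ k.+1) U.
Proof. by move=> j; rewrite /stackcol sgn_int. Qed.

Lemma nondeg_Mat_circ (U : 'M[R]_(k + l, n)) :
  (forall a, win (extcol ((-1) ^+ k.+1) U) a (k + l) \in unitmx) -> Mat_circ U.
Proof.
move=> uU j; rewrite basisEdim size_map size_iota dimvf.
have -> : dim 'cV[R]_(k + l) = (k + l)%N by apply: etrans (muln1 _).
rewrite leqnn andbT.
apply/subvP => v _; pose M := win (extcol ((-1) ^+ k.+1) U) (j - l%:Z) (k + l).
rewrite -(mulKVmx (uU (j - l%:Z)) v); set x := invmx _ *m v.
have -> : win (extcol ((-1) ^+ k.+1) U) (j - l%:Z) (k + l) *m x =
   \sum_i x i 0 *: stackcol U (j - l%:Z + (i : nat)%:Z).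
  apply/colP => a; rewrite mxE summxE; apply: eq_bigr => i _.
  by rewrite !mxE stackcolE mulrC.
apply: memv_suml => i _; apply: memvZ; apply: memv_span; apply/mapP.
by exists (i : nat) => //; rewrite mem_iota add0n ltn_ord.
Qed.

(** [T] shows that the set searched by [xget] is nonempty, so the default 0 is not taken, and an
    invertible window of [U] determines its element. *)
Lemma twist_gtwist (U : 'M[R]_(k + l, n)) (T : int -> 'cV[R]_(k + l)) :
  twrel (extcol ((-1) ^+ k.+1) U) T -> twist U = win T 1 n.
Proof.
move=> hT; apply/matrixP => i j; rewrite !mxE -intS.
have kl : (0 < k + l)%N by rewrite (leq_ltn_trans _ (ltn_ord i)).
have hu : is_twist_col U (j.+1)%:Z (T (j.+1)%:Z).
  split; first by rewrite stackcolE hT ?eqxx //; lia.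
  by move=> x hx; rewrite stackcolE hT ?ifF //; first (by apply/eqP; lia); lia.
have [h1 h2] := xgetPex (0 : 'cV[R]_(k + l)) (ex_intro _ _ hu).
congr (fun u : 'cV[R]_(k + l) => u i 0); set u := xget _ _ in h1 h2 *.
apply: trmx_inj; have uU := twrel_unitl ((j.+1)%:Z - l%:Z) hT.
rewrite -[u^T](mulmxK uU) -[RHS](mulmxK uU); congr (_ *m _).
apply/rowP => x; rewrite -[u](_ : win (fun _ => u) 0 1 = u); last first.
  by apply/colP => y; rewrite mxE.
rewrite -[T _](_ : win (fun _ => T (j.+1)%:Z) 0 1 = T (j.+1)%:Z); last first.
  by apply/colP => y; rewrite mxE.
rewrite !gram_win -!stackcolE.
have [x0|x0] := posnP x.
  by rewrite x0 addr0 h1 stackcolE hT ?eqxx //; lia.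
by rewrite h2 ?stackcolE ?hT ?ifF //; first (by apply/eqP; lia); have := ltn_ord x; lia.
Qed.

End Twist.

Lemma row_free_col_mx (F : fieldType) a b n (A : 'M[F]_(a, n)) (B : 'M[F]_(b, n)) :
  row_free (col_mx A B) -> row_free A /\ row_free B.
Proof.
rewrite /row_free -addsmxE => /eqP e.
have := (mxrank_adds_leqif A B).1; rewrite e.
by have := rank_leq_row A; have := rank_leq_row B; lia.
Qed.

(** * Charts and local sections of the Grassmannian *)

Section Charts.
Variables (R : realType) (r n : nat).
Implicit Types (s : 'I_r + 'I_(n - r) -> 'I_n) (V : Gr R r n) (A : 'M[R]_(r, n)).

Lemma chart_rep s V A : rowspan A = V ->
  ((gr_chart R s).1 V <-> colsub (s \o inl) A \in unitmx) /\
  ((gr_chart R s).1 V -> (gr_chart R s).2 V =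
     invmx (colsub (s \o inl) A) *m colsub (s \o inr) A).
Proof.
move=> /rowspan_eqP[g ug ->]; rewrite /gr_chart /= -!mulmx_colsub unitmx_mul ug.
split=> // uA; rewrite invmx_mul // -!mulmxA; congr (_ *m _).
by rewrite mulKmx.
Qed.

(** The reduced representative attached to a chart. It is continuous in [V], a property that the
    basis chosen by [gr_mx] does not provide. *)
Definition sect s V := invmx (colsub (s \o inl) (gr_mx V)) *m gr_mx V.

Lemma rowspan_sect s V : (gr_chart R s).1 V -> rowspan (sect s V) = V.
Proof. by move=> uV; rewrite rowspan_unit ?unitmx_inv // rowspan_gr_mx. Qed.

Lemma sect_rep s V A : (gr_chart R s).1 V -> rowspan A = V ->
  sect s V = invmx (colsub (s \o inl) A) *m A.
Proof.
move=> uV /rowspan_eqP[g ug ->].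
by rewrite /sect -mulmx_colsub invmx_mul // -!mulmxA mulKmx.
Qed.

Lemma open_sect s (D : set 'M[R]_(r, n)) : open D ->
  open [set V | (gr_chart R s).1 V /\ D (sect s V)].
Proof.
move=> oD; pose O1 := [set A : 'M[R]_(r, n) | colsub (s \o inl) A \in unitmx].
have SC := @cont_class R _ _ (@openT 'M[R]_(r, n)).
have oO1 : open O1.
  have -> : O1 = setT `&` [set A | \det (colsub (s \o inl) A) != 0].
    by apply/seteqP; split=> A; rewrite /O1 /= unitmxE unitfE => //; case.
  by apply: open_neq0; [exact: openT|apply: (fc_det SC); apply: (mc_sub SC); exact: mc_id].
have SC1 := @cont_class R _ _ oO1.
have hf : mx_class (cont_on O1) (fun A => invmx (colsub (s \o inl) A) *m A).
  apply: (mc_mul SC1); last exact: mc_id.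
  by apply: (mc_inv SC1) => //; apply: (mc_sub SC1); exact: mc_id.
exists (O1 `&` [set A | D (invmx (colsub (s \o inl) A) *m A)]).
  exact: open_preim (mx_class_cont hf) oD.
move=> A V AV; have [e _] := chart_rep s AV; split=> [[/e h1 h2]|[h1 h2]].
  by split=> //; rewrite (sect_rep h1 AV).
by split; [exact/e|rewrite /= -(sect_rep h1 AV)].
Qed.

Lemma open_chart s : open (gr_chart R s).1.
Proof.
rewrite (_ : (gr_chart R s).1 = [set V | (gr_chart R s).1 V /\ setT (sect s V)]).
  by apply: open_sect; exact: openT.
by apply/seteqP; split=> V //= [].
Qed.

Lemma mc_sect s : mx_class (cont_on (gr_chart R s).1) (sect s).
Proof.
move=> i j V uV A hA; have [B [oB BV] BA] : exists2 B : set R, open_nbhs (sect s V i j) B & B `<=` A.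
  by move: hA; rewrite nbhsE => -[B]; exists B.
have oD : open ((fun M : 'M[R]_(r, n) => M i j) @^-1` B).
  by apply: open_comp => // M _; exact: coord_continuous.
apply: filterS (open_nbhs_nbhs (conj (open_sect s oD) (conj uV BV))).
by move=> W [_ h]; exact: BA.
Qed.

Lemma exists_chart V : exists s (s' : 'I_n -> 'I_r + 'I_(n - r)), [/\ cancel s s', cancel s' s & (gr_chart R s).1 V].
Proof.
have fV := row_free_gr_mx V; have [s0 hs0 d0] := row_free_det_minor fV.
have rn : (r <= n)%N by rewrite -(eqP fV) rank_leq_col.
have [u hu su] := incr_compl (subnKC rn) hs0.
pose s (x : 'I_r + 'I_(n - r)) := match x with inl i => s0 i | inr j => u j end.
have sI : injective s.
  move=> [x|x] [y|y] /= e; first by rewrite (incr_inj hs0 e).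
  - by move: (su x y); rewrite e eqxx.
  - by move: (su y x); rewrite e eqxx.
  - by rewrite (incr_inj hu e).
have [s' sK s'K] : bijective s.
  by apply: inj_card_bij sI _; rewrite card_sum !card_ord subnKC.
exists s, s'; split=> //; rewrite /gr_chart /= unitmxE unitfE.
by rewrite (_ : colsub _ _ = colsub s0 (gr_mx V)) //; apply/matrixP => i j; rewrite !mxE.
Qed.

Definition chart_mx (s' : 'I_n -> 'I_r + 'I_(n - r)) (x : 'M[R]_(r, n - r)) : 'M[R]_(r, n) :=
  \matrix_(i, j) match s' j with inl a => (i == a)%:R | inr b => x i b end.

Lemma sect_chart_mx s (s' : 'I_n -> 'I_r + 'I_(n - r)) V : cancel s' s -> (gr_chart R s).1 V ->
  sect s V = chart_mx s' ((gr_chart R s).2 V).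
Proof.
move=> s'K uV; apply/matrixP => i j; rewrite [RHS]mxE.
case e : (s' j) => [a|b].
  have -> : sect s V i j = colsub (s \o inl) (sect s V) i a by rewrite [RHS]mxE /= -e s'K.
  by rewrite /sect -mulmx_colsub mulVmx // mxE.
by rewrite /= mulmx_colsub [RHS]mxE /= -e s'K.
Qed.

End Charts.

(** The function classes are scalar valued; a pair of matrices is put together as a sum of its
    entries times constant basis vectors. *)
Lemma smooth_pair (R : realType) (E : normedModType R) (O : set E) a b c d
    (f : E -> 'M[R]_(a, b)) (g : E -> 'M[R]_(c, d)) : open O ->
  mx_class [set f : E -> R | smooth_on O f] f ->
  mx_class [set f : E -> R | smooth_on O f] g ->
  smooth_on O (fun x => (f x, g x)).
Proof.
move=> oO hf hg.
have h1 : smooth_on O (fun x => \sum_i \sum_j f x i j *: ((delta_mx i j, 0) : 'M[R]_(a, b) * 'M[R]_(c, d))).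
  by apply: smooth_sum => // i _; apply: smooth_sum => // j _ e; apply: Ck_scale => //; exact: hf.
have h2 : smooth_on O (fun x => \sum_i \sum_j g x i j *: ((0, delta_mx i j) : 'M[R]_(a, b) * 'M[R]_(c, d))).
  by apply: smooth_sum => // i _; apply: smooth_sum => // j _ e; apply: Ck_scale => //; exact: hg.
move=> e; apply: (Ck_ext oO _ (Ck_add oO (h1 e) (h2 e))) => x _.
have m1 (A B : 'M[R]_(a, b)) : (A + B, 0) = (A, 0) + (B, 0) :> 'M[R]_(a, b) * 'M[R]_(c, d).
  by congr pair; rewrite addr0.
have m2 (A B : 'M[R]_(c, d)) : (0, A + B) = (0, A) + (0, B) :> 'M[R]_(a, b) * 'M[R]_(c, d).
  by congr pair; rewrite addr0.
have -> : (f x, g x) = (f x, 0) + (0, g x).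
  by congr pair; rewrite /= ?addr0 ?add0r.
congr (_ + _).
  rewrite [in RHS](matrix_sum_delta (f x)) (big_morph _ m1 erefl); apply: eq_bigr => i _.
  rewrite (big_morph _ m1 erefl); apply: eq_bigr => j _.
  by congr pair; rewrite /= scaler0.
rewrite [in RHS](matrix_sum_delta (g x)) (big_morph _ m2 erefl); apply: eq_bigr => i _.
rewrite (big_morph _ m2 erefl); apply: eq_bigr => j _.
by congr pair; rewrite /= scaler0.
Qed.

(** * Continuity and smoothness of the induced map on pairs of subspaces *)

Section GrMap.
Variables (R : realType) (k l n : nat) (c : R) (w0 : int) (q : nat) (eta : int -> R).
Hypotheses (n0 : (0 < n)%N) (c0 : c != 0).

Let G (U : 'M[R]_(k + l, n)) := gtwist c w0 q eta U.
Let N : set 'M[R]_(k + l, n) := gdom c w0.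
Hypothesis G_free : forall U, N U -> row_free (G U).

Definition gmap (p : Gr R k n * Gr R l n) : Gr R k n * Gr R l n :=
  let U := G (col_mx (gr_mx p.1) (gr_mx p.2)) in
  (insubd p.1 (rowspan (usubmx U)), insubd p.2 (rowspan (dsubmx U))).

Definition gmap_dom : set (Gr R k n * Gr R l n) :=
  [set p | N (col_mx (gr_mx p.1) (gr_mx p.2))].

(** [gmap] may be computed from any representatives, in particular from local sections in place of
    [gr_mx]; continuity and smoothness rest on this. *)
Lemma gmap_rep (p : Gr R k n * Gr R l n) A B : rowspan A = p.1 -> rowspan B = p.2 ->
  (gmap_dom p <-> N (col_mx A B)) /\
  (N (col_mx A B) ->
    rowspan (usubmx (G (col_mx A B))) = (gmap p).1 /\
    rowspan (dsubmx (G (col_mx A B))) = (gmap p).2).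
Proof.
move=> /rowspan_eqP[g ug eA] /rowspan_eqP[h uh eB].
have iN : gmap_dom p <-> N (col_mx A B).
  split=> [d|d]; first by rewrite eA eB; have [] := gtwist_block q eta n0 ug uh d.
  have ug' : invmx g \in unitmx by rewrite unitmx_inv.
  have uh' : invmx h \in unitmx by rewrite unitmx_inv.
  by have [+ _] := gtwist_block q eta n0 ug' uh' d; rewrite eA eB !mulKmx.
split=> // /iN d; rewrite eA eB; have [_ e] := gtwist_block q eta n0 ug uh d.
rewrite [G _]e -/(G _) col_mxKu col_mxKd !rowspan_unit ?unitmx_tr ?unitmx_inv //.
have := G_free d; rewrite -{1}[G _]vsubmxK => /row_free_col_mx[f1 f2].
by rewrite /gmap /= !insubd_rowspan.
Qed.

Lemma mc_gr_stack (O : set (Gr R k n * Gr R l n)) s1 s2 : open O ->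
  (forall p, O p -> (gr_chart R s1).1 p.1 /\ (gr_chart R s2).1 p.2) ->
  mx_class (cont_on O) (fun p : Gr R k n * Gr R l n => col_mx (sect s1 p.1) (sect s2 p.2)).
Proof.
move=> oO hO; have SC := @cont_class R _ _ oO.
apply: (mc_col SC (f := fun p : Gr R k n * Gr R l n => sect s1 p.1)
   (g := fun p : Gr R k n * Gr R l n => sect s2 p.2)) => i j p Op;
  have [h1 h2] := hO p Op.
  apply: (@continuous_comp _ _ _ fst (fun V => sect s1 V i j)).
    exact: cvg_fst.
  exact: mc_sect.
apply: (@continuous_comp _ _ _ snd (fun V => sect s2 V i j)).
  exact: cvg_snd.
exact: mc_sect.
Qed.

Lemma rowspan_near r (Y : topologicalType) (M : Y -> 'M[R]_(r, n)) (V : Y -> Gr R r n) y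
    (A : set (Gr R r n)) :
  {for y, continuous M} -> (\forall z \near y, rowspan (M z) = V z) -> nbhs (V y) A ->
  \forall z \near y, A (V z).
Proof.
move=> cM eM; rewrite nbhsE => -[B [[D oD DB] By] BA].
have Dy : D (M y) by apply/(DB _ (V y)) => //; exact: nbhs_singleton eM.
have := cM D (open_nbhs_nbhs (conj oD Dy)) => hD.
by apply: filterS2 eM hD => z ez /(DB _ _ ez) /BA.
Qed.

Lemma gmap_continuous p : gmap_dom p -> {for p, continuous gmap}.
Proof.
move=> dp; have [s1 [s1' [_ _ c1]]] := exists_chart p.1.
have [s2 [s2' [_ _ c2]]] := exists_chart p.2.
pose O : set (Gr R k n * Gr R l n) := (gr_chart R s1).1 `*` (gr_chart R s2).1.
have oO : open O.
  rewrite openE => -[V W] [hV hW]; exists ((gr_chart R s1).1, (gr_chart R s2).1) => //=.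
  by split; apply: open_nbhs_nbhs; split=> //; exact: open_chart.
have hS : mx_class (cont_on O) (fun p : Gr R k n * Gr R l n => col_mx (sect s1 p.1) (sect s2 p.2)).
  by apply: mc_gr_stack => // x [].
have oO1 := open_gdom c w0 oO hS.
set O1 := O `&` _ in oO1.
have rep x : O1 x -> rowspan (usubmx (G (col_mx (sect s1 x.1) (sect s2 x.2)))) = (gmap x).1 /\
    rowspan (dsubmx (G (col_mx (sect s1 x.1) (sect s2 x.2)))) = (gmap x).2.
  move=> [[h1 h2] h3]; have [_] := gmap_rep (rowspan_sect h1) (rowspan_sect h2).
  exact.
have O1p : O1 p.
  by split=> //; have [e _] := gmap_rep (rowspan_sect c1) (rowspan_sect c2); exact/e.
have SC1 := @cont_class R _ _ oO1.
have hS1 : mx_class (cont_on O1) (fun p : Gr R k n * Gr R l n => col_mx (sect s1 p.1) (sect s2 p.2)).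
  by move=> i j x [Ox _]; exact: hS.
have hG : mx_class (cont_on O1) (fun p => G (col_mx (sect s1 p.1) (sect s2 p.2))).
  by apply: (mc_gtwist SC1) hS1 => x [_ h] j; exact: h.
have nO1 : \forall z \near p, O1 z by exact: open_nbhs_nbhs.
move=> A [[A1 A2] /= [hA1 hA2] sA].
have e1 : \forall z \near p,
    rowspan (usubmx (G (col_mx (sect s1 z.1) (sect s2 z.2)))) = (gmap z).1.
  by apply: filterS nO1 => z /rep[].
have e2 : \forall z \near p,
    rowspan (dsubmx (G (col_mx (sect s1 z.1) (sect s2 z.2)))) = (gmap z).2.
  by apply: filterS nO1 => z /rep[].
have n1 := rowspan_near (mx_class_cont (mc_usub SC1 hG) O1p) e1 hA1.
have n2 := rowspan_near (mx_class_cont (mc_dsub SC1 hG) O1p) e2 hA2.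
suff : nbhs p (gmap @^-1` A) by [].
by apply: filterS2 n1 n2 => z h1 h2; apply: sA.
Qed.

(** Coordinates are turned into reduced matrices, twisted, and reduced again. On [O3] the window
    determinants and the two chart minors of the image do not vanish, so this composite is a
    rational formula on an open set. *)
Lemma gmap_smooth (A : set (Gr R k n * Gr R l n)) : A `<=` gmap_dom ->
  smooth_within (prod_atlas (@gr_atlas R k n) (@gr_atlas R l n))
    (prod_atlas (@gr_atlas R k n) (@gr_atlas R l n)) A gmap.
Proof.
move=> Ad p /Ad dp.
have [s1 [s1' [s1K s1'K c1]]] := exists_chart p.1.
have [s2 [s2' [s2K s2'K c2]]] := exists_chart p.2.
have [t1 [t1' [t1K t1'K b1]]] := exists_chart (gmap p).1.
have [t2 [t2' [t2K t2'K b2]]] := exists_chart (gmap p).2.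
pose E := ('M[R]_(k, n - k) * 'M[R]_(l, n - l))%type.
pose U (x : E) := col_mx (chart_mx s1' x.1) (chart_mx s2' x.2).
have smU O : open O -> mx_class [set f : E -> R | smooth_on O f] U.
  move=> oO; have SC := smooth_class oO.
  apply: (mc_col SC (f := fun x : E => chart_mx s1' x.1)
     (g := fun x : E => chart_mx s2' x.2)) => i j.
    have -> : (fun x : E => chart_mx s1' x.1 i j) = fun x : E => match s1' j with inl a => (i == a)%:R
        | inr b => x.1 i b end by apply/funext => x; rewrite mxE.
    case: (s1' j) => [a|b]; first exact: (fc_cst SC).
    move=> d; apply: Ck_linear => // [a x z|x]; first by rewrite !mxE.
    apply: (@continuous_comp _ _ _ fst (fun V : 'M[R]_(k, n - k) => V i b)).
      exact: cvg_fst.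
    exact: coord_continuous.
  have -> : (fun x : E => chart_mx s2' x.2 i j) = fun x : E => match s2' j with inl a => (i == a)%:R
      | inr b => x.2 i b end by apply/funext => x; rewrite mxE.
  case: (s2' j) => [a|b]; first exact: (fc_cst SC).
  move=> d; apply: Ck_linear => // [a x z|x]; first by rewrite !mxE.
  apply: (@continuous_comp _ _ _ snd (fun V : 'M[R]_(l, n - l) => V i b)).
    exact: cvg_snd.
  exact: coord_continuous.
have cU : mx_class (cont_on setT) U.
  by move=> i j; exact: Ck_cont (smU setT openT i j 0%N).
have oO1 := open_gdom c w0 openT cU; set O1 := setT `&` _ in oO1.
have smG O : open O -> O `<=` O1 -> mx_class [set f : E -> R | smooth_on O f] (G \o U).
  move=> oO OO1; apply: (mc_gtwist (smooth_class oO)) (smU _ oO) => x /OO1[_ h] j.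
  exact: h.
have cG O : open O -> O `<=` O1 -> mx_class (cont_on O) (G \o U).
  by move=> oO OO1 i j; exact: Ck_cont (smG O oO OO1 i j 0%N).
pose f1 x := \det (colsub (t1 \o inl) (usubmx (G (U x)))).
pose f2 x := \det (colsub (t2 \o inl) (dsubmx (G (U x)))).
have oO2 : open (O1 `&` [set x | f1 x != 0]).
  apply: open_neq0 => //; have SC := @cont_class R _ _ oO1.
  by apply: (fc_det SC); apply: (mc_sub SC); apply: (mc_usub SC); exact: cG.
set O2 := O1 `&` _ in oO2.
have oO3 : open (O2 `&` [set x | f2 x != 0]).
  apply: open_neq0 => //; have SC := @cont_class R _ _ oO2.
  by apply: (fc_det SC); apply: (mc_sub SC); apply: (mc_dsub SC); apply: cG => // x [].
set O3 := O2 `&` _ in oO3.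
have SC3 := smooth_class oO3.
have sm3 := smG O3 oO3 (fun x h => h.1.1).
pose h1 x := invmx (colsub (t1 \o inl) (usubmx (G (U x)))) *m colsub (t1 \o inr) (usubmx (G (U x))).
pose h2 x := invmx (colsub (t2 \o inl) (dsubmx (G (U x)))) *m colsub (t2 \o inr) (dsubmx (G (U x))).
have sh1 : mx_class [set f : E -> R | smooth_on O3 f] h1.
  apply: (mc_mul SC3); last by apply: (mc_sub SC3); exact: (mc_usub SC3 sm3).
  apply: (mc_inv SC3); last by apply: (mc_sub SC3); exact: (mc_usub SC3 sm3).
  by move=> x [[_ h] _]; rewrite unitmxE unitfE.
have sh2 : mx_class [set f : E -> R | smooth_on O3 f] h2.
  apply: (mc_mul SC3); last by apply: (mc_sub SC3); exact: (mc_dsub SC3 sm3).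
  apply: (mc_inv SC3); last by apply: (mc_sub SC3); exact: (mc_dsub SC3 sm3).
  by move=> x [_ h]; rewrite unitmxE unitfE.
pose coord (y : Gr R k n * Gr R l n) : E := ((gr_chart R s1).2 y.1, (gr_chart R s2).2 y.2).
have rep y : (gr_chart R s1).1 y.1 -> (gr_chart R s2).1 y.2 ->
    rowspan (chart_mx s1' (coord y).1) = y.1 /\ rowspan (chart_mx s2' (coord y).2) = y.2.
  move=> u1 u2; rewrite /coord -(sect_chart_mx s1'K u1) -(sect_chart_mx s2'K u2).
  by rewrite !rowspan_sect.
exists ((gr_chart R s1).1 `*` (gr_chart R s2).1, coord),
   ((gr_chart R t1).1 `*` (gr_chart R t2).1,
    fun y : Gr R k n * Gr R l n => ((gr_chart R t1).2 y.1, (gr_chart R t2).2 y.2)),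
   O3, (fun x => (h1 x, h2 x)).
split.
- split; first by exists (gr_chart R s1), (gr_chart R s2); split=> //;
    [exists s1 => //; exists s1'|exists s2 => //; exists s2'].
  by exists (gr_chart R t1), (gr_chart R t2); split=> //;
    [exists t1 => //; exists t1'|exists t2 => //; exists t2'].
- by split.
- split=> //; have [r1 r2] := rep _ c1 c2; have [e1 e2] := gmap_rep r1 r2.
  have Np : N (U (coord p)) by exact/e1.
  have [g1 g2] := e2 Np.
  split; first split; first by split.
    by rewrite /= /f1 -unitfE -unitmxE; apply/(chart_rep t1 g1).1.
  by rewrite /= /f2 -unitfE -unitmxE; apply/(chart_rep t2 g2).1.
- exact: smooth_pair.
- move=> y _ [u1 u2] [[[_ Ny] d1] d2].
  have [r1 r2] := rep _ u1 u2; have [_ e2] := gmap_rep r1 r2.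
  have [g1 g2] := e2 Ny; have [i1 j1] := chart_rep t1 g1; have [i2 j2] := chart_rep t2 g2.
  have v1 : (gr_chart R t1).1 (gmap y).1 by apply/i1; rewrite unitmxE unitfE.
  have v2 : (gr_chart R t2).1 (gmap y).2 by apply/i2; rewrite unitmxE unitfE.
  by split=> //; congr pair; [exact: j1|exact: j2].
Qed.

End GrMap.

(** * Passing from arbitrary representatives to the chosen one *)

Section Transfer.
Variables (R : realType) (r n : nat).
Implicit Types (A : 'M[R]_(r, n)) (V : Gr R r n).

Lemma tnn_rep A V : rowspan A = V -> tnn A -> tnn (gr_mx V).
Proof. by move=> /rowspan_eqP[g ug ->] h; rewrite -(mulKmx ug (gr_mx V)); exact: tnn_mull. Qed.

Lemma tpos_alt_rep A V : rowspan A = V -> tpos (alt A) -> tpos (alt (gr_mx V)).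
Proof.
move=> /rowspan_eqP[g ug ->]; rewrite altM => h.
by rewrite -(mulKmx ug (alt _)); apply: tpos_mull; rewrite ?unitmx_inv.
Qed.

Lemma has_ranks_rep c A V f : (0 < n)%N -> rowspan A = V ->
  has_ranks (extcol c A) f -> has_ranks (extcol c (gr_mx V)) f.
Proof.
move=> n0 /rowspan_eqP[g ug ->] h a b ab; have := h a b ab.
rewrite win_extcolM // -mxrank_tr trmx_mul mxrankMfree ?mxrank_tr //.
by rewrite row_free_unit unitmx_tr.
Qed.

Lemma has_ranks_eq k (A B : int -> 'cV[R]_k) f : A =1 B -> has_ranks A f -> has_ranks B f.
Proof. by move=> e h a b ab; rewrite -(eq_win _ _ e); exact: h. Qed.

End Transfer.

Lemma rank_colsub_rev (F : fieldType) k n (A : 'M[F]_(k, n)) :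
  \rank (colsub (@rev_ord n) A) = \rank A.
Proof.
have le (B : 'M[F]_(k, n)) : (\rank (colsub (@rev_ord n) B) <= \rank B)%N.
  have -> : colsub (@rev_ord n) B = B *m colsub (@rev_ord n) 1%:M.
    by rewrite mulmx_colsub mulmx1.
  exact: mxrankM_maxl.
apply/eqP; rewrite eqn_leq le /=.
have := le (colsub (@rev_ord n) A).
by rewrite (_ : colsub _ (colsub _ A) = A) //; apply/matrixP => i j; rewrite !mxE rev_ordK.
Qed.

Lemma eq_twrel (F : realFieldType) k l (U U' T T' : int -> 'cV[F]_(k + l)) :
  U =1 U' -> T =1 T' -> twrel U T -> twrel U' T'.
Proof. by move=> eU eT h j i hi; rewrite -eU -eT h. Qed.

Lemma swap_inj (F : realFieldType) k l : injective (@swap F k l).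
Proof. exact: can_inj (@swapK F k l). Qed.

Lemma twrel_uniql (F : realFieldType) k l (U U' T : int -> 'cV[F]_(k + l)) :
  twrel U T -> twrel U' T -> U =1 U'.
Proof.
move=> /twrel_rev h /twrel_rev h' j.
have := twrel_uniqr h h' (k%:Z - l%:Z - j).
rewrite opprB addrCA subrr addr0 => /(scalerI (sgz_neq0 F k%:Z)).
exact: swap_inj.
Qed.

(** * The stacked twist map *)

Section Main.
Variables (R : realType) (k l m n : nat).
Hypotheses (m_even : ~~ odd m) (klm : (k + l + m)%N = n) (n0 : (0 < n)%N).

Let c : R := (-1) ^+ k.+1.
Let c' : R := (-1) ^+ l.+1.
Let c0 : c != 0. Proof. by rewrite /c signr_eq0. Qed.
Let c'0 : c' != 0. Proof. by rewrite /c' signr_eq0. Qed.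
Let cu : c \is a GRing.unit. Proof. by rewrite unitfE. Qed.
Let cu' : c' \is a GRing.unit. Proof. by rewrite unitfE. Qed.
Let kln : (k + l <= n)%N. Proof. by rewrite -klm leq_addr. Qed.
Let lkm : (l + k + m)%N = n. Proof. by rewrite [(l + k)%N]addnC. Qed.

(* Reversal of the order of the columns turns the inverse of the stacked twist
   map into the stacked twist map with k and l exchanged. *)
Lemma twrel_positive_inv (T : int -> 'cV[R]_(k + l)) : qper n c' T ->
  tnn (win (dof T) 1 n) -> (forall a, row_free (win (dof T) a (k + l))) ->
  (forall a, row_free (win (dof T) a n)) ->
  tpos (win (falt (uof T)) 1 n) ->
  exists U, [/\ twrel U T, tnn (win (uof U) 1 n) & tpos (win (falt (dof U)) 1 n)].
Proof.
(* The shift [l - k] is that of [twrel_rev] with [k] and [l] exchanged, so that reversing a second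
   time gives back [T]. *)
move=> hT tT fT fTn pT; pose b := l%:Z - k%:Z.
pose V (j : int) : 'cV[R]_(l + k) := swap (T (b - j)).
have [hu hd] := qper_sub hT.
have winZ p (s : R) (A : int -> 'cV[R]_p) a d : win (fun j => s *: A j) a d = s *: win A a d.
  by apply/matrixP => i j; rewrite !mxE.
have uV : uof V =1 frev b (dof T) by move=> j; rewrite /uof /V /swap col_mxKu.
have dV : dof V =1 frev b (uof T) by move=> j; rewrite /dof /V /swap col_mxKd.
have qV : qper n c' V.
  move=> j; have e1 : uof V (j + n%:Z) = c' *: uof V j.
    by rewrite !uV; exact: (qper_frev b hd).
  have e2 : dof V (j + n%:Z) = c' *: dof V j.
    by rewrite !dV; exact: (qper_frev b hu).
  by rewrite -[V (j + n%:Z)]vsubmxK -[V j]vsubmxK scale_col_mx; congr col_mx.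
have tV : tnn (win (uof V) 1 n).
  by rewrite (eq_win _ _ uV); apply: tnn_frev; apply: (tnn_win _ n0 hd tT).
have fV a : row_free (win (uof V) a (l + k)).
  by rewrite (eq_win _ _ uV) win_frev /row_free rank_colsub_rev [(l + k)%N]addnC; exact: fT.
have fVn : row_free (win (uof V) 1 n).
  by rewrite (eq_win _ _ uV) win_frev /row_free rank_colsub_rev; exact: fTn.
have pV : tpos (win (falt (dof V)) 1 n).
  have e : falt (dof V) =1 (fun j => (-1) ^ b *: frev b (falt (uof T)) j).
    move=> j; rewrite /falt dV /frev scalerA exprzDr ?unitrN1 // mulrA sgz_sqr.
    by rewrite mul1r sgzN.
  rewrite (eq_win _ _ e) winZ.
  apply: tposZ; rewrite ?sgz_neq0 //; apply: tpos_frev.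
  exact: (tpos_win _ n0 (qper_falt_flip' m_even klm hu) pT).
have e0 := extcol_win n0 c'0 qV.
have nV : nondeg (extcol c' (win V 1 n)).
  by move=> a; rewrite (eq_win _ _ e0); exact: (positive_nondeg m_even lkm n0 qV tV fV pV).
have := TT_twrel m_even lkm n0 nV; set S := (X in twrel _ X) => hS.
have hVS : twrel V S by exact: (eq_twrel e0 (frefl S) hS).
have [q1 q2] := twrel_positive m_even lkm n0 qV hVS tV fVn pV.
have qS := twrel_qper m_even lkm n0 qV hVS; have [hSu hSd] := qper_sub qS.
have hU := twrel_rev hVS.
pose U (j : int) : 'cV[R]_(k + l) := (-1) ^ l%:Z *: swap (S (- j)).
have uU : uof U =1 (fun j => (-1) ^ l%:Z *: frev 0 (dof S) j).
  by move=> j; rewrite /uof /U linearZ /= /swap col_mxKu /frev add0r.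
have dU : dof U =1 (fun j => (-1) ^ l%:Z *: frev 0 (uof S) j).
  by move=> j; rewrite /dof /U linearZ /= /swap col_mxKd /frev add0r.
exists U; split.
- move=> j i hi; have := hU j i hi.
  rewrite -/b (_ : swap (V (b - j)) = T j); last by rewrite /V swapK; congr T; lia.
  by rewrite linearZ /= -scalemxAl -scalemxAr.
- rewrite (eq_win _ _ uU) winZ; apply: tnnZ; apply: tnn_frev.
  exact: (tnn_win _ n0 hSd q2).
- have e : falt (dof U) =1 (fun j => (-1) ^ l%:Z *: frev 0 (falt (uof S)) j).
    move=> j; rewrite /falt dU /frev !scalerA add0r sgzN.
    by rewrite mulrC.
  rewrite (eq_win _ _ e) winZ.
  apply: tposZ; rewrite ?sgz_neq0 //; apply: tpos_frev.
  exact: (tpos_win _ n0 (qper_falt_flip' m_even lkm hSu) q1).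
Qed.

Let G1 (U : 'M[R]_(k + l, n)) := gtwist c (- l%:Z) 0 (fun j => (-1) ^ j) U.
Let G2 (T : 'M[R]_(k + l, n)) :=
  gtwist c' (1 - k%:Z) (k + l).-1 (fun j => (-1) ^ (j + l%:Z)) T.

Lemma gdom_twrel U : gdom c (- l%:Z) U -> twrel (extcol c U) (extcol c' (G1 U)).
Proof. by move=> h; apply: (TT_twrel m_even klm n0) => a; exact: (gdom_win n0 c0 h). Qed.

Lemma gdom_twrel_inv T : gdom c' (1 - k%:Z) T -> twrel (extcol c (G2 T)) (extcol c' T).
Proof.
move=> h; apply/twrel_grel_inv; apply: gtwist_grel => //; last exact: (gdom_win n0 c'0 h).
move=> j t /=; rewrite (addrAC j) [LHS]exprzDr ?unitrN1 // mulrC sgz_mul_int.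
congr (_ ^ t * _); rewrite /c /c' -exprD; apply: sgn_parity.
by rewrite -klm !oddD (negbTE m_even) /=; case: (odd k); case: (odd l).
Qed.

Lemma unit_row_free p e (U : 'M[R]_(p, n)) : (p <= n)%N ->
  win (extcol e U) 1 p \in unitmx -> row_free U.
Proof.
move=> pn; rewrite (win_widen _ _ pn) win_extcol unitmxE unitfE.
exact: det_minor_row_free.
Qed.

Lemma G1_free U : gdom c (- l%:Z) U -> row_free (G1 U).
Proof. by move=> /gdom_twrel h; apply: unit_row_free (twrel_unitr 1 h). Qed.

Lemma G2_free U : gdom c' (1 - k%:Z) U -> row_free (G2 U).
Proof. by move=> /gdom_twrel_inv h; apply: unit_row_free (twrel_unitl 1 h). Qed.

Lemma G2G1 U : gdom c (- l%:Z) U -> gdom c' (1 - k%:Z) (G1 U) /\ G2 (G1 U) = U.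
Proof.
move=> /gdom_twrel h; have d : gdom c' (1 - k%:Z) (G1 U).
  by move=> j; exact: twrel_unitr h.
split=> //; have e := twrel_uniql (gdom_twrel_inv d) h.
by rewrite -[LHS](win_extcol c) (eq_win _ _ e) win_extcol.
Qed.

Lemma G1G2 T : gdom c' (1 - k%:Z) T -> gdom c (- l%:Z) (G2 T) /\ G1 (G2 T) = T.
Proof.
move=> /gdom_twrel_inv h; have d : gdom c (- l%:Z) (G2 T).
  by move=> j; exact: twrel_unitl h.
split=> //; have e := twrel_uniqr (gdom_twrel d) h.
by rewrite -[LHS](win_extcol c') (eq_win _ _ e) win_extcol.
Qed.

Definition gtheta := @gmap R k l n c (- l%:Z) 0 (fun j => (-1) ^ j).
Definition gtheta_inv := @gmap R k l n c' (1 - k%:Z) (k + l).-1 (fun j => (-1) ^ (j + l%:Z)).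
Let dom1 := @gmap_dom R k l n c (- l%:Z).
Let dom2 := @gmap_dom R k l n c' (1 - k%:Z).

Lemma gthetaK p : dom1 p -> dom2 (gtheta p) /\ gtheta_inv (gtheta p) = p.
Proof.
move=> d; have [_ /(_ d)[e1 e2]] := gmap_rep n0 G1_free
  (rowspan_gr_mx p.1) (rowspan_gr_mx p.2).
have [d2 e] := G2G1 d.
have [iN h2] := gmap_rep n0 G2_free e1 e2.
rewrite vsubmxK in iN h2; have [g1 g2] := h2 d2; split; first exact/iN.
move: g1 g2; rewrite -/(G2 _) -/(G1 _) e col_mxKu col_mxKd !rowspan_gr_mx.
rewrite -/gtheta -/(gtheta_inv _); case: (gtheta_inv _) => a b /= /gr_inj <- /gr_inj <-.
by case: (p).
Qed.

Lemma gtheta_invK q : dom2 q -> dom1 (gtheta_inv q) /\ gtheta (gtheta_inv q) = q.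
Proof.
move=> d; have [_ /(_ d)[e1 e2]] := gmap_rep n0 G2_free
  (rowspan_gr_mx q.1) (rowspan_gr_mx q.2).
have [d2 e] := G1G2 d.
have [iN h2] := gmap_rep n0 G1_free e1 e2.
rewrite vsubmxK in iN h2; have [g1 g2] := h2 d2; split; first exact/iN.
move: g1 g2; rewrite -/(G1 _) -/(G2 _) e col_mxKu col_mxKd !rowspan_gr_mx.
rewrite -/gtheta_inv -/(gtheta _); case: (gtheta _) => a b /= /gr_inj <- /gr_inj <-.
by case: (q).
Qed.

Lemma dom1_theta p : dom1 p -> theta_dom p /\ theta p = gtheta p.
Proof.
move=> d; split.
  by apply: nondeg_Mat_circ => a; exact: (gdom_win n0 c0 d).
by rewrite /theta (twist_gtwist (gdom_twrel d)) win_extcol.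
Qed.

(** Nonnegativity of V alone does not make the stack nondegenerate. The bound on [f] supplies what
    is missing: every window of V of length [k + l] has rank [k]. *)
Lemma theta_forward f g p : affperm n k l f -> cancel f g -> cancel g f ->
  positroid_cell f p.1 -> Gr_perp_gt0 (k + m) p.2 ->
  [/\ dom1 p, Gr_perp_gt0 (l + m) (gtheta p).1 & positroid_cell g (gtheta p).2].
Proof.
move=> hf fK gK /(@positroid_cellE R k n c _ f n0 cu)[tV rV].
have kml : (k + m + l)%N = n by rewrite addnAC.
move=> /(Gr_perp_tpos _ kml) tW.
have [_ _ _ fb] := hf; pose U := extcol c (col_mx (gr_mx p.1) (gr_mx p.2)).
have qU : qper n c U by exact: extcol_qper.
have uU : uof U =1 extcol c (gr_mx p.1) by move=> j; rewrite uof_extcol // col_mxKu.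
have tU : tnn (win (uof U) 1 n) by rewrite win_uof_extcol col_mxKu.
have pU : tpos (win (falt (dof U)) 1 n).
  by apply/tpos_falt1; rewrite win_dof_extcol col_mxKd.
have rU : has_ranks (uof U) f by apply: has_ranks_eq rV => j; rewrite uU.
have fU a : row_free (win (uof U) a n).
  by rewrite (eq_win _ _ uU); apply: row_free_extcol => //; exact: row_free_gr_mx.
have [hk fkl] := has_ranks_window n0 kln fb rU fU.
have nU := positive_nondeg m_even klm n0 qU tU fkl pU.
have d : dom1 p by move=> j; exact: nU.
have hT := gdom_twrel d.
have [q1 q2] := twrel_positive m_even klm n0 qU hT tU (fU 1) pU.
have [_ /(_ d)[e1 e2]] := gmap_rep n0 G1_free
  (rowspan_gr_mx p.1) (rowspan_gr_mx p.2).
split=> //.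
  apply/Gr_perp_tpos; first by rewrite addnAC.
  by apply: (tpos_alt_rep e1); move/tpos_falt1: q1; rewrite win_uof_extcol.
apply/(@positroid_cellE R l n c' _ g n0 cu'); split.
  by apply: (tnn_rep e2); rewrite win_dof_extcol in q2.
apply: (has_ranks_rep n0 e2); apply: has_ranks_eq (dof_extcol _ _ n0) _.
apply: (has_ranks_inverse fK gK fb hk) rU => a e hd.
by have [] := twrel_rank a hT hd.
Qed.

Lemma theta_backward f g q : affperm n k l f -> cancel f g -> cancel g f ->
  Gr_perp_gt0 (l + m) q.1 -> positroid_cell g q.2 ->
  [/\ dom2 q, positroid_cell f (gtheta_inv q).1 & Gr_perp_gt0 (k + m) (gtheta_inv q).2].
Proof.
move=> hf fK gK.
have lmk : (l + m + k)%N = n by rewrite addnAC.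
move=> /(Gr_perp_tpos _ lmk) tW.
move=> /(@positroid_cellE R l n c' _ g n0 cu')[tV rV].
have [_ _ _ gb] := affperm_inv n0 hf fK gK.
pose T := extcol c' (col_mx (gr_mx q.1) (gr_mx q.2)).
have qT : qper n c' T by exact: extcol_qper.
have uT : dof T =1 extcol c' (gr_mx q.2) by move=> j; rewrite dof_extcol // col_mxKd.
have tT : tnn (win (dof T) 1 n) by rewrite win_dof_extcol col_mxKd.
have pT : tpos (win (falt (uof T)) 1 n).
  by apply/tpos_falt1; rewrite win_uof_extcol col_mxKu.
have rT : has_ranks (dof T) g by apply: has_ranks_eq rV => j; rewrite uT.
have fT a : row_free (win (dof T) a n).
  by rewrite (eq_win _ _ uT); apply: row_free_extcol => //; exact: row_free_gr_mx.
have lkn : (l + k <= n)%N by rewrite addnC.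
have [hk fkl] := has_ranks_window n0 lkn gb rT fT.
have fkl' a : row_free (win (dof T) a (k + l)) by rewrite [(k + l)%N]addnC fkl.
have [U [hU q1 q2]] := twrel_positive_inv qT tT fkl' fT pT.
have d : dom2 q by move=> j; exact: twrel_unitr hU.
have hU' := gdom_twrel_inv d; have eU := twrel_uniql hU hU'.
have [_ /(_ d)[e1 e2]] := gmap_rep n0 G2_free
  (rowspan_gr_mx q.1) (rowspan_gr_mx q.2).
have e3 : uof U =1 uof (extcol c (G2 (col_mx (gr_mx q.1) (gr_mx q.2)))).
  by move=> j; rewrite /uof eU.
have e4 : falt (dof U) =1 falt (dof (extcol c (G2 (col_mx (gr_mx q.1) (gr_mx q.2))))).
  by move=> j; rewrite /falt /dof eU.
split=> //; last first.
  apply/Gr_perp_tpos; first by rewrite addnAC.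
  apply: (tpos_alt_rep e2); move: q2; rewrite (eq_win _ _ e4) => /tpos_falt1.
  by rewrite win_dof_extcol.
apply/(@positroid_cellE R k n c _ f n0 cu); split.
  by apply: (tnn_rep e1); rewrite (eq_win _ _ e3) win_uof_extcol in q1.
apply: (has_ranks_rep n0 e1); apply: has_ranks_eq (uof_extcol _ _ n0) _.
apply: (has_ranks_eq e3).
apply: (has_ranks_inverse gK fK gb hk) rT => a e hd.
(* The rank formula is stated from [U] to [T]; read at the complementary length [k + l - e] it gives
   the ranks of [U] from those of [T]. *)
have hd' : (k + l - e <= k + l)%N by lia.
have [+ _] := twrel_rank (a + e%:Z - k%:Z) hU hd'.
rewrite (_ : a + e%:Z - k%:Z + (k + l - e)%N%:Z - l%:Z = a); last by lia.
rewrite (_ : (k + l - (k + l - e))%N = e); last by lia.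
rewrite [(l + k)%N]addnC; lia.
Qed.

End Main.

Lemma eq_smooth_within (R : realType) (E F : normedModType R) (M N : topologicalType)
    (aM : atlas E M) (aN : atlas F N) (A : set M) (f g : M -> N) :
  (forall x, A x -> f x = g x) -> smooth_within aM aN A f -> smooth_within aM aN A g.
Proof.
move=> e h x Ax; have [p [q [O [u [h1 h2 h3 h4 h5]]]]] := h x Ax.
exists p, q, O, u; split=> //; first by rewrite -e.
by move=> y Ay; rewrite -e //; exact: h5.
Qed.

Lemma set_bij_cancel (M N : Type) (A : set M) (B : set N) (f : M -> N) (g : N -> M) :
  (forall x, A x -> B (f x) /\ g (f x) = x) ->
  (forall y, B y -> A (g y) /\ f (g y) = y) -> set_bij A B f.
Proof.
move=> hf hg; split.
- by move=> x /hf[].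
- by move=> x y /set_mem Ax /set_mem Ay e; rewrite -(hf x Ax).2 -(hf y Ay).2 e.
- by move=> y /hg[Ay e]; exists (g y).
Qed.

Lemma within_continuous (M N : topologicalType) (A : set M) (f g : M -> N) :
  (forall x, A x -> f x = g x) -> (forall x, A x -> {for x, continuous f}) ->
  {within A, continuous g}.
Proof.
move=> e cf; have h : {within A, continuous f}.
  by apply: continuous_in_subspaceT => x /set_mem; exact: cf.
by apply: subspace_eq_continuous h => x /set_mem /e.
Qed.

(** As [theta] is a total function, the inclusion in its natural domain is a separate clause. The
    inverse of [f] appears as a map [g] with both cancellation laws. *)
Theorem mainTheorem3 (R : realType) (k l m n : nat) (hn : (2 <= n)%N)
    (hm : ~~ odd m) (hklmn : (k + l + m)%N = n) :
  [/\ @Gr_ge R m k n `*` @Gr_perp_gt0 R (k + m) l n `<=` @theta_dom R k l n,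
      homeomorphism_on
        (@Gr_ge R m k n `*` @Gr_perp_gt0 R (k + m) l n)
        (@Gr_perp_gt0 R (l + m) k n `*` @Gr_ge R m l n)
        (@theta R k l n)
    & forall f g : int -> int, affperm n k l f -> cancel f g -> cancel g f ->
        diffeomorphism_on
          (prod_atlas (@gr_atlas R k n) (@gr_atlas R l n))
          (prod_atlas (@gr_atlas R k n) (@gr_atlas R l n))
          (@positroid_cell R k n f `*` @Gr_perp_gt0 R (k + m) l n)
          (@Gr_perp_gt0 R (l + m) k n `*` @positroid_cell R l n g)
          (@theta R k l n)].
Proof.
have n0 : (0 < n)%N by exact: ltnW.
set A := _ `*` _; set B := _ `*` _; pose gth := @gtheta R k l n; pose ginv := @gtheta_inv R k l n.
have fwd f g p : affperm n k l f -> cancel f g -> cancel g f ->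
    (@positroid_cell R k n f `*` @Gr_perp_gt0 R (k + m) l n) p ->
    [/\ theta_dom p, {for p, continuous gth}, theta p = gth p, ginv (gth p) = p &
      (@Gr_perp_gt0 R (l + m) k n `*` @positroid_cell R l n g) (gth p)].
  move=> hf fK gK [h1 h2].
  have [d q1 q2] := theta_forward hm hklmn n0 hf fK gK h1 h2.
  have [d2 e] := gthetaK hm hklmn n0 d; have [t1 t2] := dom1_theta hm hklmn n0 d.
  split=> //; apply: gmap_continuous => //.
  by move=> U; apply: G1_free hm hklmn n0 U.
have bwd f g q : affperm n k l f -> cancel f g -> cancel g f ->
    (@Gr_perp_gt0 R (l + m) k n `*` @positroid_cell R l n g) q ->
    [/\ {for q, continuous ginv}, theta (ginv q) = q &
      (@positroid_cell R k n f `*` @Gr_perp_gt0 R (k + m) l n) (ginv q)].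
  move=> hf fK gK [h1 h2].
  have [d q1 q2] := theta_backward hm hklmn n0 hf fK gK h1 h2.
  have [d2 e] := gtheta_invK hm hklmn n0 d; have [t1 t2] := dom1_theta hm hklmn n0 d2.
  split=> //; last by rewrite t2.
  apply: gmap_continuous => //.
  by move=> U; apply: G2_free hm hklmn n0 U.
(* The index sets of the two unions of cells become [affperm n k l] and [affperm n l k], which
   inversion exchanges; so the statement on the unions follows cell by cell. *)
have nk : (n - k - m)%N = l by lia.
have nl : (n - l - m)%N = k by lia.
have inv f : affperm n k l f -> exists g, [/\ cancel f g, cancel g f & affperm n l k g].
  move=> hf; have [[g fK gK] _ _ _] := hf; exists g; split=> //.
  exact: affperm_inv hf fK gK.
have inv' g : affperm n l k g -> exists f, [/\ cancel f g, cancel g f & affperm n k l f].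
  move=> hg; have [[f gK fK] _ _ _] := hg; exists f; split=> //.
  exact: affperm_inv hg gK fK.
have fA p : A p -> [/\ theta_dom p, {for p, continuous gth}, theta p = gth p,
    ginv (gth p) = p & B (gth p)].
  move=> [[f]]; rewrite /= nk => hf h1 h2; have [g [fK gK hg]] := inv f hf.
  have [d c e K [b1 b2]] := fwd f g p hf fK gK (conj h1 h2).
  by split=> //; split=> //; exists g; rewrite //= nl.
have fB q : B q -> [/\ {for q, continuous ginv}, theta (ginv q) = q & A (ginv q)].
  move=> [h1 [g]]; rewrite /= nl => hg h2; have [f [fK gK hf]] := inv' g hg.
  have [c e [a1 a2]] := bwd f g q hf fK gK (conj h1 h2).
  by split=> //; split=> //; exists f; rewrite //= nk.
split.
- by move=> p /fA[].
- split.
  + apply: (@set_bij_cancel _ _ _ _ _ ginv) => [p /fA[_ _ -> -> b]|q /fB[_ -> a]] //.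
  + by apply: (@within_continuous _ _ _ gth) => p /fA[].
  + exists ginv; first by move=> p /fA[_ _ -> ->].
    by apply: (@within_continuous _ _ _ ginv) => // q /fB[].
- move=> f g hf fK gK; split.
  + apply: (@set_bij_cancel _ _ _ _ _ ginv) => [p /(fwd f g p hf fK gK)[_ _ -> -> b]|
      q /(bwd f g q hf fK gK)[_ -> a]] //.
  + apply: (@eq_smooth_within _ _ _ _ _ _ _ _ gth).
      by move=> p /(fwd f g p hf fK gK)[].
    apply: gmap_smooth => //.
      by move=> U; apply: G1_free hm hklmn n0 U.
    by move=> p [h1 h2]; have [] := theta_forward hm hklmn n0 hf fK gK h1 h2.
  + exists ginv; first by move=> p /(fwd f g p hf fK gK)[_ _ -> ->].
    apply: gmap_smooth => //.
      by move=> U; apply: G2_free hm hklmn n0 U.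
    by move=> q [h1 h2]; have [] := theta_backward hm hklmn n0 hf fK gK h1 h2.
Qed.
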